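(* Let the standing assumptions in the context hold, let $\mathcal T^t_\alpha$ be any temporal mesh and $\mathcal T^x_\nu$ any spatial mesh as in the context (no relation between the temporal and spatial mesh sizes is required), and let $\Pi_h$ be either $\Pi_h^0$ or $\Pi_h^{\mathcal{RT},1}$. Then the system matrix $$K := A_{h_t}^{\mathcal H_T}\otimes M_{h_x}^{\mathcal N} + M_{h_t}^{\mathcal H_T}\otimes A_{h_x}^{\mathcal N}$$ is positive definite, and hence the Galerkin--Bubnov finite element method: find $\underline A_h \in S^1_{0,}(\mathcal T^t_\alpha)\otimes\mathcal N^0_{\mathrm{I},0}(\mathcal T^x_\nu)$ such that $$(\epsilon\,\mathcal H_T\partial_t\underline A_h,\partial_t\underline v_h)_{L^2(Q)} + (\mu^{-1}\operatorname{curl}_x\underline A_h,\operatorname{curl}_x\mathcal H_T\underline v_h)_{L^2(Q)} = (\Pi_h\underline j,\mathcal H_T\underline v_h)_{L^2(Q)}$$ for all $\underline v_h \in S^1_{0,}(\mathcal T^t_\alpha)\otimes\mathcal N^0_{\mathrm{I},0}(\mathcal T^x_\nu)$, is uniquely solvable.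
   Context: Standing assumptions. $d \in \{2,3\}$; $\Omega \subset \mathbb{R}^d$ is a bounded Lipschitz domain, polygonal for $d=2$ and polyhedral for $d=3$; $T>0$; $Q := (0,T)\times\Omega$ is star-shaped with respect to a ball. $\epsilon \in L^\infty(\Omega;\mathbb{R}^{d\times d})$ is symmetric and uniformly positive definite. For $d=2$, $\mu \in L^\infty(\Omega;\mathbb{R})$ with $\operatorname{ess\,inf}_\Omega \mu>0$; for $d=3$, $\mu\in L^\infty(\Omega;\mathbb{R}^{3\times 3})$ is symmetric and uniformly positive definite. $\underline j\in L^2(Q;\mathbb{R}^d)$. For $d=2$, $\operatorname{curl}_x \underline f = \partial_{x_1} f_2 - \partial_{x_2} f_1$; for $d=3$ it is the usual curl. $H_0(\operatorname{curl};\Omega)$ is the subspace of $H(\operatorname{curl};\Omega)$ with vanishing tangential trace. Positive definite (for a possibly nonsymmetric real matrix $K$) means $\underline{y}^\top K\underline{y}>0$ for all real vectors $\underline{y}\neq 0$. Modified Hilbert transformation. For $v\in L^2(0,T)$ with $v(t)=\sum_{k=0}^\infty v_k\sin\left(\left(\frac\pi2+k\pi\right)\frac tT\right)$, set $(\mathcal H_Tv)(t)=\sum_{k=0}^\infty v_k\cos\left(\left(\frac\pi2+k\pi\right)\frac tT\right)$. On functions of $(t,x)$, $\mathcal H_T$ acts in the time variable only; e.g. $\mathcal H_T(\varphi\,\underline\psi)=(\mathcal H_T\varphi)\,\underline\psi$ for $\varphi=\varphi(t)$, $\underline\psi=\underline\psi(x)$. It is known that $(v,\mathcal H_Tv)_{L^2(0,T)}>0$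 for $0\neq v\in H^s_{0,}(0,T)$, $0<s\le1$, where $H^s_{0,}(0,T)=[H^1_{0,}(0,T),L^2(0,T)]_s$ is the interpolation space (with $s=1$ giving $H^1_{0,}(0,T)$ and $s=0$ giving $L^2(0,T)$) and $H^1_{0,}(0,T)=\{v\in H^1(0,T):v(0)=0\}$. Meshes and spaces. The temporal mesh $\mathcal T^t_\alpha$ is given by $0=t_0<t_1<\dots<t_{N^t}=T$. $S^0(\mathcal T^t_\alpha)$ is the space of piecewise constant functions, $S^1(\mathcal T^t_\alpha)$ the space of continuous piecewise linear functions with hat-function basis $\varphi^1_0,\dots,\varphi^1_{N^t}$, and $S^1_{0,}(\mathcal T^t_\alpha)=\operatorname{span}\{\varphi^1_l\}_{l=1}^{N^t}$ its subspace of functions vanishing at $t=0$. The spatial mesh $\mathcal T^x_\nu$ is a member of a shape-regular, globally quasi-uniform sequence of admissible (conforming) decompositions of $\Omega$ into triangles ($d=2$) or tetrahedra ($d=3$). $S^0_d(\mathcal T^x_\nu)$ is the space of $\mathbb{R}^d$-valued piecewise constant functions; $\mathcal{RT}^0(\mathcal T^x_\nu)\subset H(\operatorname{div};\Omega)$ is the lowest-order Raviart--Thomas space (locally $\underline a+bx$, $\underline a\in\mathbb{R}^d$, $b\in\mathbb{R}$). $\mathcal N^0_{\mathrm{I},0}(\mathcal T^x_\nu)\subset H_0(\operatorname{curl};\Omega)$ is the lowest-order Nédélec space of the first kind with zero tangential trace (locally $\underline a+b(-x_2,x_1)^\top$ with $\underline a\in\mathbb{R}^2,b\in\mathbb{R}$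 for $d=2$; $\underline a+\underline b\times x$ with $\underline a,\underline b\in\mathbb{R}^3$ for $d=3$), with basis $\underline\psi^{\mathcal N}_1,\dots,\underline\psi^{\mathcal N}_{N_x^{\mathcal N}}$. Projections. $\Pi_h^0$ is the $L^2(Q)$-orthogonal projection onto $S^0(\mathcal T^t_\alpha)\otimes S^0_d(\mathcal T^x_\nu)$; $\Pi_h^{\mathcal{RT},1}$ is the $L^2(Q)$-orthogonal projection onto $S^1(\mathcal T^t_\alpha)\otimes\mathcal{RT}^0(\mathcal T^x_\nu)$. Matrices. For $\ell,\kappa=1,\dots,N_x^{\mathcal N}$: $A_{h_x}^{\mathcal N}[\ell,\kappa]=(\mu^{-1}\operatorname{curl}_x\underline\psi^{\mathcal N}_\kappa,\operatorname{curl}_x\underline\psi^{\mathcal N}_\ell)_{L^2(\Omega)}$, $M_{h_x}^{\mathcal N}[\ell,\kappa]=(\epsilon\underline\psi^{\mathcal N}_\kappa,\underline\psi^{\mathcal N}_\ell)_{L^2(\Omega)}$. For $l,k=1,\dots,N^t$: $A_{h_t}^{\mathcal H_T}[l,k]=(\mathcal H_T\partial_t\varphi^1_k,\partial_t\varphi^1_l)_{L^2(0,T)}$, $M_{h_t}^{\mathcal H_T}[l,k]=(\varphi^1_k,\mathcal H_T\varphi^1_l)_{L^2(0,T)}$. Here $\otimes$ between matrices is the Kronecker product. *)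

(* Defs.v *)
From HB Require Import structures.
From mathcomp Require Import all_boot all_order all_algebra.
From mathcomp Require Import mxtens.
From mathcomp Require Import all_classical all_reals all_analysis.

Set Implicit Arguments.
Unset Strict Implicit.
Unset Printing Implicit Defensive.

Import Order.TTheory GRing.Theory Num.Theory.
Import numFieldTopology.Exports numFieldNormedType.Exports.

Local Open Scope classical_set_scope.
Local Open Scope ring_scope.

(* Column vectors 'cV[R]_n model R^n.  The sigma-algebra is generated by the
   coordinates (as the library does for tuples), hence is the Borel one. *)
Definition measure_cV_display : measure_display -> measure_display.
Proof. exact. Qed.

Section measurable_cV.
Context {d} {T : sigmaRingType d}.
Variable n : nat.

Definition cV_coord (i : 'I_n) (x : 'cV[T]_n) : T := x i ord0.

Let cV_set0 : g_sigma_preimage cV_coord set0.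
Proof. exact: sigma_algebra0. Qed.

Let cV_setC A : g_sigma_preimage cV_coord A -> g_sigma_preimage cV_coord (~` A).
Proof. exact: sigma_algebraC. Qed.

Let cV_bigcup (F : (set 'cV[T]_n)^nat) :
  (forall i, g_sigma_preimage cV_coord (F i)) ->
  g_sigma_preimage cV_coord (\bigcup_i (F i)).
Proof. exact: sigma_algebra_bigcup. Qed.

HB.instance Definition _ := @isMeasurable.Build (measure_cV_display d)
  'cV[T]_n (g_sigma_preimage cV_coord) cV_set0 cV_setC cV_bigcup.

End measurable_cV.

Section lebesgue_measure_cV.
Variable R : realType.

Definition cons_cV n (p : R * 'cV[R]_n) : 'cV[R]_n.+1 :=
  @col_mx R 1 n 1 (const_mx p.1) p.2.

Lemma cons_cV0 n p : @cons_cV n p ord0 ord0 = p.1.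
Proof.
have -> : ord0 = lshift n (ord0 : 'I_1) :> 'I_(1 + n) by apply/val_inj.
by rewrite /cons_cV (@col_mxEu R 1 n 1) mxE.
Qed.

Lemma cons_cVS n p (i : 'I_n) : @cons_cV n p (lift ord0 i) ord0 = p.2 i ord0.
Proof.
have -> : lift ord0 i = rshift 1 i :> 'I_(1 + n) by apply/val_inj.
by rewrite /cons_cV (@col_mxEd R 1 n 1).
Qed.

Lemma measurable_cons_cV n : measurable_fun setT (@cons_cV n).
Proof.
apply: (@measurability _ _ _ _ _ _
  (\big[setU/set0]_(i < n.+1)
     preimage_set_system setT (@cV_coord _ R n.+1 i) measurable)).
  by [].
move=> _ [A + <-]; rewrite -bigcup_seq => -[i _ [B mB <-]].
rewrite !setTI -comp_preimage -[X in measurable X]setTI.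
have [->|[j ->]] : i = ord0 \/ exists j, i = lift ord0 j.
  by case: (unliftP ord0 i) => [j|] ->; [right; exists j|left].
- rewrite (_ : _ \o _ = fst); first exact: measurable_fst.
  by apply/funext => p; exact: cons_cV0.
- rewrite (_ : _ \o _ = @cV_coord _ R n j \o snd); last first.
    by apply/funext => p; exact: cons_cVS.
  apply: (measurableT_comp _ (@measurable_snd _ _ _ _)) => //.
  move=> _ C mC; rewrite setTI; apply: sub_sigma_algebra => /=.
  rewrite -bigcup_seq/=; exists j => /=; first by rewrite mem_index_enum.
  by exists C => //; rewrite setTI.
Qed.

(* Lebesgue measure on R^n, by iterated products.  The product (m1 \x^ m2) only
   needs m1 to be sigma-finite. *)
Fixpoint leb n : {measure set 'cV[R]_n -> \bar R} :=
  if n is m.+1 then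
    measure_function_pushforward__canonical__measure_function_Measure
      [the measure _ _ of ((@lebesgue_measure R) \x^ leb m)%E]
      (@measurable_cons_cV m)
  else [the measure _ _ of dirac (0 : 'cV[R]_0)].

End lebesgue_measure_cV.

Section euclidean_geometry.
Variables (R : realType) (n : nat).
Implicit Types (x y : 'cV[R]_n) (A : set 'cV[R]_n).

Definition dotv x y : R := \sum_i x i ord0 * y i ord0.

Definition enorm x : R := Num.sqrt (dotv x x).

Definition eball x (r : R) : set 'cV[R]_n := [set y | enorm (y - x) < r].

Definition star_shaped_wrt_ball A := exists x0 : 'cV[R]_n, exists r : R,
  [/\ 0 < r, eball x0 r `<=` A &
    forall x y (s : R), A x -> eball x0 r y -> 0 <= s <= 1 ->
      A ((1 - s) *: x + s *: y)].

(* The convex hull of the points p i, i \in I. *)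
Definition face k (p : 'I_k -> 'cV[R]_n) (I : {set 'I_k}) : set 'cV[R]_n :=
  [set x | exists c : 'I_k -> R,
    [/\ forall i, 0 <= c i, forall i, i \notin I -> c i = 0,
        \sum_i c i = 1 & x = \sum_i c i *: p i]].

Definition simplex k (p : 'I_k -> 'cV[R]_n) := face p [set: 'I_k].

Definition affinely_independent k (p : 'I_k -> 'cV[R]_n) :=
  forall c : 'I_k -> R, \sum_i c i = 0 -> \sum_i c i *: p i = 0 ->
    forall i, c i = 0.

Definition boundary A := closure A `\` A°.

(* Near each boundary point, A is the part of a ball above a Lipschitz graph in
   the direction u; g is only relevant on the hyperplane orthogonal to u. *)
Definition lipschitz_boundary A := forall x0, boundary A x0 ->
  exists u : 'cV[R]_n, exists g : 'cV[R]_n -> R, exists r : R, exists L : R,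
  [/\ enorm u = 1, 0 < r,
      forall x y, `|g x - g y| <= L * enorm (x - y) &
      forall x, eball x0 r x -> A x <-> g (x - dotv x u *: u) < dotv x u].

(* The boundary is a finite union of (n-1)-simplices. *)
Definition polytopal_boundary A := exists N : nat,
  exists F : 'I_N -> 'I_n -> 'cV[R]_n,
    (forall i, affinely_independent (F i)) /\
    boundary A = \bigcup_(i in [set: 'I_N]) simplex (F i).

Definition polytopal_lipschitz_domain A :=
  [/\ A !=set0, open A, connected A & bounded_set A] /\
  lipschitz_boundary A /\ polytopal_boundary A.

Record simplicial_mesh := SimplicialMesh {
  ncells : nat;
  cell : 'I_ncells -> 'I_n.+1 -> 'cV[R]_n }.

Definition closed_cell (M : simplicial_mesh) (i : 'I_(ncells M)) :=
  simplex (cell i).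

Definition admissible_mesh A (M : simplicial_mesh) :=
  [/\ forall i, affinely_independent (@cell M i),
      closure A = \bigcup_(i in [set: 'I_(ncells M)]) closed_cell i &
      forall i j : 'I_(ncells M), i != j ->
        (closed_cell i)° `&` (closed_cell j)° = set0 /\
        exists I J : {set 'I_n.+1},
          closed_cell i `&` closed_cell j = face (cell i) I /\
          closed_cell i `&` closed_cell j = face (cell j) J].

Definition diameter A : R :=
  sup [set r | exists x y, [/\ A x, A y & r = enorm (x - y)]].

Definition inradius A : R := sup [set r | exists x, eball x r `<=` A].

Definition shape_regular (M : nat -> simplicial_mesh) := exists c : R,
  forall nu (i : 'I_(ncells (M nu))),
    diameter (closed_cell i) <= c * inradius (closed_cell i).

Definition globally_quasi_uniform (M : nat -> simplicial_mesh) := exists c : R,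
  forall nu (i j : 'I_(ncells (M nu))),
    diameter (closed_cell i) <= c * diameter (closed_cell j).

End euclidean_geometry.

Section L2_spaces.
Variable R : realType.

Section scalar.
Context d (X : measurableType d).
Variables (m : {measure set X -> \bar R}) (D : set X).

Definition L2 (f : X -> R) :=
  measurable_fun D f /\ m.-integrable D (fun x => (f x ^+ 2)%:E).

Definition Linfty (f : X -> R) := measurable_fun D f /\
  exists C : R, \forall x \ae m, D x -> `|f x| <= C.

Definition ess_inf_on (f : X -> R) : \bar R :=
  ereal_sup [set c | \forall x \ae m, D x -> (c <= (f x)%:E)%E].

Definition dot_L2 (f g : X -> R) : R := \int[m]_(x in D) (f x * g x).

(* The integral is extended-real valued, so that a divergent integral does not
   count as 0. *)
Definition cvg_L2 (f : nat -> X -> R) (g : X -> R) :=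
  (fun k => \int[m]_(x in D) ((f k x - g x) ^+ 2)%:E)%E @ \oo --> 0%E.

End scalar.

Section vector.
Variables (n k : nat) (D : set 'cV[R]_n).
Implicit Types f g : 'cV[R]_n -> 'cV[R]_k.

Definition L2v f := forall i, L2 (leb R n) D (fun x => f x i ord0).

Definition dot_L2v f g : R := \int[leb R n]_(x in D) dotv (f x) (g x).

Definition cvg_L2v (f : nat -> 'cV[R]_n -> 'cV[R]_k) g := forall i,
  cvg_L2 (leb R n) D (fun m x => f m x i ord0) (fun x => g x i ord0).

Definition orthogonal_projection (V : set ('cV[R]_n -> 'cV[R]_k)) f :=
  xget (fun=> 0)
    [set g | V g /\ forall v, V v -> dot_L2v (fun x => f x - g x) v = 0].

End vector.

End L2_spaces.

Section modified_Hilbert_transformation.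
Variable (R : realType) (T : R).

Definition freq (k : nat) : R := (pi / 2 + k%:R * pi) / T.

Definition mhilbert (v : R -> R) : R -> R := xget (fun=> 0)
  [set w | L2 (@lebesgue_measure R) `]0, T[ w /\
    exists c : nat -> R,
      cvg_L2 (@lebesgue_measure R) `]0, T[
        (fun n s => \sum_(k < n) c k * sin (freq k * s)) v /\
      cvg_L2 (@lebesgue_measure R) `]0, T[
        (fun n s => \sum_(k < n) c k * cos (freq k * s)) w].

End modified_Hilbert_transformation.

Section space_time.
Variables (R : realType) (n : nat).

(* Points of R^(1+n): coordinate 0 is the time, the others are the space. *)
Definition time_of (z : 'cV[R]_n.+1) : R := z ord0 ord0.

Definition space_of (z : 'cV[R]_n.+1) : 'cV[R]_n :=
  \col_i z (lift ord0 i) ord0.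

Definition cylinder (T : R) (Omega : set 'cV[R]_n) : set 'cV[R]_n.+1 :=
  [set z | 0 < time_of z < T /\ Omega (space_of z)].

Definition e_time : 'cV[R]_n.+1 := delta_mx ord0 ord0.

Definition e_space (i : 'I_n) : 'cV[R]_n.+1 := delta_mx (lift ord0 i) ord0.

Definition dt k (v : 'cV[R]_n.+1 -> 'cV[R]_k) (z : 'cV[R]_n.+1) : 'cV[R]_k :=
  \col_i 'D_e_time (fun y => v y i ord0) z.

(* The same transformation with coefficients c_k in L^2(Omega): the series
   converge in L^2(Q). *)
Definition mhilbert_x k (T : R) (Omega : set 'cV[R]_n)
    (v : 'cV[R]_n.+1 -> 'cV[R]_k) : 'cV[R]_n.+1 -> 'cV[R]_k :=
  let Q := cylinder T Omega in
  xget (fun=> 0)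
  [set w | L2v Q w /\
    exists c : nat -> 'cV[R]_n -> 'cV[R]_k,
    [/\ forall j, L2v Omega (c j),
      cvg_L2v Q (fun m z =>
        \sum_(j < m) sin (freq T j * time_of z) *: c j (space_of z)) v &
      cvg_L2v Q (fun m z =>
        \sum_(j < m) cos (freq T j * time_of z) *: c j (space_of z)) w]].

(* The algebraic tensor product of spaces of functions of t and of x. *)
Definition tensor_space k (T : R) (Omega : set 'cV[R]_n)
    (S : set (R -> R)) (V : set ('cV[R]_n -> 'cV[R]_k)) :
    set ('cV[R]_n.+1 -> 'cV[R]_k) :=
  [set v | exists m : nat, exists f : 'I_m -> R -> R,
    exists g : 'I_m -> 'cV[R]_n -> 'cV[R]_k,
    [/\ forall i, S (f i), forall i, V (g i) &
      forall z, cylinder T Omega z ->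
        v z = \sum_i f i (time_of z) *: g i (space_of z)]].

End space_time.

Section temporal_mesh.
Variables (R : realType) (T : R) (N : nat) (t : nat -> R).

Definition temporal_mesh :=
  [/\ t 0%N = 0, t N = T & forall l, (l < N)%N -> t l < t l.+1].

Definition S0_time : set (R -> R) :=
  [set f | forall l, (l < N)%N ->
    exists c : R, forall s, t l < s < t l.+1 -> f s = c].

Definition S1_time : set (R -> R) :=
  [set f | {within `[0, T], continuous f} /\ forall l, (l < N)%N ->
    exists a b : R, forall s, t l <= s <= t l.+1 -> f s = a + b * s].

Definition hat (l : nat) (s : R) : R :=
  if (0 < l)%N && (t l.-1 <= s <= t l) then (s - t l.-1) / (t l - t l.-1)
  else if (l < N)%N && (t l <= s <= t l.+1)
  then (t l.+1 - s) / (t l.+1 - t l)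
  else 0.

Definition S1_time_0 : set (R -> R) :=
  [set f | exists c : 'I_N -> R,
    forall s, 0 <= s <= T -> f s = \sum_l c l * hat l.+1 s].

End temporal_mesh.

Variant space_dim := Dim2 | Dim3.

Definition nat_of_dim (d : space_dim) : nat :=
  match d with Dim2 => 2%N | Dim3 => 3%N end.
Coercion nat_of_dim : space_dim >-> nat.

(* Number of components of the curl; a scalar is identified with a vector of
   R^1. *)
Definition curl_dim (d : space_dim) : nat :=
  match d with Dim2 => 1%N | Dim3 => 3%N end.

Section test_functions.
Variables (R : realType) (n : nat).

Definition C1 (f : 'cV[R]_n -> R) := forall v : 'cV[R]_n,
  (forall x, derivable f x v) /\ continuous (fun x => 'D_v f x).

Definition C1v k (f : 'cV[R]_n -> 'cV[R]_k) :=
  forall i, C1 (fun x => f x i ord0).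

Definition C1c k (D : set 'cV[R]_n) (f : 'cV[R]_n -> 'cV[R]_k) :=
  C1v f /\ exists K : set 'cV[R]_n,
    [/\ compact K, K `<=` D & forall x, ~ K x -> f x = 0].

End test_functions.

Section curl.
Variable R : realType.

Definition vec2 (a b : R) : 'cV[R]_2 := \col_i [:: a; b]`_i.

Definition vec3 (a b c : R) : 'cV[R]_3 := \col_i [:: a; b; c]`_i.

Definition cross (u v : 'cV[R]_3) : 'cV[R]_3 :=
  let u_ k := u (inord k) ord0 in let v_ k := v (inord k) ord0 in
  vec3 (u_ 1%N * v_ 2%N - u_ 2%N * v_ 1%N)
       (u_ 2%N * v_ 0%N - u_ 0%N * v_ 2%N)
       (u_ 0%N * v_ 1%N - u_ 1%N * v_ 0%N).

(* The formal adjoint of the curl, with e i the direction of the i-th space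
   coordinate: (d_2 phi, - d_1 phi) for d = 2, and the curl for d = 3. *)
Definition curl_adj (d : space_dim) n :
    ('I_d -> 'cV[R]_n) -> ('cV[R]_n -> 'cV[R]_(curl_dim d)) ->
    'cV[R]_n -> 'cV[R]_d :=
  match d with
  | Dim2 => fun e phi z =>
      let D i := 'D_(e (inord i)) (fun y => phi y ord0 ord0) z in
      vec2 (D 1%N) (- D 0%N)
  | Dim3 => fun e phi z =>
      let D i j := 'D_(e (inord i)) (fun y => phi y (inord j) ord0) z in
      vec3 (D 1%N 2%N - D 2%N 1%N)
           (D 2%N 0%N - D 0%N 2%N)
           (D 0%N 1%N - D 1%N 0%N)
  end.

Section weak_curl.
Variables (d : space_dim) (n : nat) (e : 'I_d -> 'cV[R]_n) (D : set 'cV[R]_n).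

(* g is the distributional curl of f on D: for d = 2 integrating by parts
   d_1 f_2 - d_2 f_1, for d = 3 the usual curl.  C^1 test functions define the
   same distributional derivatives of L^2 functions as smooth ones. *)
Definition is_weak_curl (f : 'cV[R]_n -> 'cV[R]_d)
    (g : 'cV[R]_n -> 'cV[R]_(curl_dim d)) :=
  L2v D g /\ forall phi, C1c D phi ->
    dot_L2v D g phi = dot_L2v D f (curl_adj e phi).

Definition weak_curl (f : 'cV[R]_n -> 'cV[R]_d) :
    'cV[R]_n -> 'cV[R]_(curl_dim d) :=
  xget (fun=> 0) [set g | is_weak_curl f g].

End weak_curl.

Section Hcurl.
Variables (d : space_dim) (Omega : set 'cV[R]_d).

Definition curl : ('cV[R]_d -> 'cV[R]_d) -> 'cV[R]_d -> 'cV[R]_(curl_dim d) :=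
  weak_curl (fun i => delta_mx i ord0) Omega.

Definition curl_x (T : R) :
    ('cV[R]_d.+1 -> 'cV[R]_d) -> 'cV[R]_d.+1 -> 'cV[R]_(curl_dim d) :=
  weak_curl (@e_space R d) (cylinder T Omega).

Definition Hcurl : set ('cV[R]_d -> 'cV[R]_d) :=
  [set f | L2v Omega f /\
    exists g, is_weak_curl (fun i => delta_mx i ord0) Omega f g].

(* The tangential trace of f as the functional of Green's formula,
   w |-> (curl f, w) - (f, curl w), on fields w that are C^1 up to the
   boundary. *)
Definition tangential_trace (f : 'cV[R]_d -> 'cV[R]_d)
    (w : 'cV[R]_d -> 'cV[R]_(curl_dim d)) : R :=
  dot_L2v Omega (curl f) w -
  dot_L2v Omega f (curl_adj (fun i => delta_mx i ord0) w).

Definition Hcurl0 : set ('cV[R]_d -> 'cV[R]_d) :=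
  [set f | Hcurl f /\ forall w, C1v w -> tangential_trace f w = 0].

End Hcurl.

End curl.

Section Hdiv.
Variables (R : realType) (n : nat) (Omega : set 'cV[R]_n).

Definition grad (phi : 'cV[R]_n -> 'cV[R]_1) (x : 'cV[R]_n) : 'cV[R]_n :=
  \col_i 'D_(delta_mx i ord0) (fun y => phi y ord0 ord0) x.

Definition Hdiv : set ('cV[R]_n -> 'cV[R]_n) :=
  [set f | L2v Omega f /\ exists g : 'cV[R]_n -> 'cV[R]_1,
    L2v Omega g /\ forall phi, C1c Omega phi ->
      dot_L2v Omega g phi = - dot_L2v Omega f (grad phi)].

End Hdiv.

(* Finite element functions are determined almost everywhere: their values on
   the faces of the cells are left free. *)
Section spatial_finite_elements.
Variables (R : realType) (d : space_dim) (Omega : set 'cV[R]_d).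
Variable M : simplicial_mesh R d.

Definition S0_space : set ('cV[R]_d -> 'cV[R]_d) :=
  [set f | L2v Omega f /\ forall i : 'I_(ncells M),
    exists a : 'cV[R]_d, forall x, (closed_cell i)° x -> f x = a].

Definition RT0 : set ('cV[R]_d -> 'cV[R]_d) :=
  [set f | Hdiv Omega f /\ forall i : 'I_(ncells M),
    exists (a : 'cV[R]_d) (b : R),
      forall x, (closed_cell i)° x -> f x = a + b *: x].

Definition nedelec_rot :
    'cV[R]_(curl_dim d) -> 'cV[R]_d -> 'cV[R]_d :=
  match d with
  | Dim2 => fun b x =>
      b ord0 ord0 *: vec2 (- x (inord 1) ord0) (x (inord 0) ord0)
  | Dim3 => fun b x => cross b x
  end.

Definition nedelec0 : set ('cV[R]_d -> 'cV[R]_d) :=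
  [set f | Hcurl0 Omega f /\ forall i : 'I_(ncells M),
    exists (a : 'cV[R]_d) (b : 'cV[R]_(curl_dim d)),
      forall x, (closed_cell i)° x -> f x = a + nedelec_rot b x].

Definition is_basis (V : set ('cV[R]_d -> 'cV[R]_d)) N
    (psi : 'I_N -> 'cV[R]_d -> 'cV[R]_d) :=
  [/\ forall i, V (psi i),
    forall c : 'I_N -> R,
      (\forall x \ae leb R d, Omega x -> \sum_i c i *: psi i x = 0) ->
      forall i, c i = 0 &
    forall f, V f -> exists c : 'I_N -> R,
      \forall x \ae leb R d, Omega x -> f x = \sum_i c i *: psi i x].

End spatial_finite_elements.

Section coefficients.
Variables (R : realType) (d : space_dim) (Omega : set 'cV[R]_d).

Definition uniformly_spd n (F : 'cV[R]_d -> 'M[R]_n) :=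
  [/\ forall i j, Linfty (leb R d) Omega (fun x => F x i j),
    \forall x \ae leb R d, Omega x -> (F x)^T = F x &
    exists c : R, 0 < c /\ \forall x \ae leb R d, Omega x ->
      forall y : 'cV[R]_n, c * dotv y y <= dotv y (F x *m y)].

Definition permeability : Type :=
  'cV[R]_d -> match d return Type with Dim2 => R | Dim3 => 'M[R]_3 end.

End coefficients.

Definition permeability_mx (R : realType) (d : space_dim) :
    permeability R d -> 'cV[R]_d -> 'M[R]_(curl_dim d) :=
  match d with
  | Dim2 => fun mu x => (mu x)%:M
  | Dim3 => fun mu x => mu x
  end.

Definition admissible_permeability (R : realType) (d : space_dim) :
    set 'cV[R]_d -> permeability R d -> Prop :=
  match d with
  | Dim2 => fun Omega mu => Linfty (leb R 2) Omega mu /\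
      (0 < ess_inf_on (leb R 2) Omega mu)%E
  | Dim3 => fun Omega mu => @uniformly_spd R Dim3 Omega 3 mu
  end.

Definition posdef (R : realType) n (K : 'M[R]_n) :=
  forall y : 'cV[R]_n, y != 0 -> 0 < (y^T *m K *m y) ord0 ord0.

Section system_matrix.
Variables (R : realType) (d : space_dim) (Omega : set 'cV[R]_d) (T : R).
Variables (eps : 'cV[R]_d -> 'M[R]_d) (mu : permeability R d).
Variables (N : nat) (t : nat -> R).
Variables (Nx : nat) (psi : 'I_Nx -> 'cV[R]_d -> 'cV[R]_d).

Let dot_T := dot_L2 (@lebesgue_measure R) `]0, T[.

Definition A_x : 'M[R]_Nx := \matrix_(l, k)
  dot_L2v Omega
    (fun x => invmx (permeability_mx mu x) *m curl Omega (psi k) x)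
    (curl Omega (psi l)).

Definition M_x : 'M[R]_Nx := \matrix_(l, k)
  dot_L2v Omega (fun x => eps x *m psi k x) (psi l).

(* The index l : 'I_N stands for the basis function number l.+1. *)
Definition A_t : 'M[R]_N := \matrix_(l, k)
  dot_T (mhilbert T (derive1 (hat N t k.+1))) (derive1 (hat N t l.+1)).

Definition M_t : 'M[R]_N := \matrix_(l, k)
  dot_T (hat N t k.+1) (mhilbert T (hat N t l.+1)).

Definition system_matrix : 'M[R]_(N * Nx) := A_t *t M_x + M_t *t A_x.

End system_matrix.

Section galerkin_bubnov.
Variables (R : realType) (d : space_dim) (Omega : set 'cV[R]_d) (T : R).
Variables (eps : 'cV[R]_d -> 'M[R]_d) (mu : permeability R d).
Variables (N : nat) (t : nat -> R) (M : simplicial_mesh R d).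

Let Q := cylinder T Omega.

Definition ansatz_space : set ('cV[R]_d.+1 -> 'cV[R]_d) :=
  tensor_space T Omega (S1_time_0 T N t) (nedelec0 Omega M).

Definition Pi0 : ('cV[R]_d.+1 -> 'cV[R]_d) -> 'cV[R]_d.+1 -> 'cV[R]_d :=
  orthogonal_projection Q
    (tensor_space T Omega (S0_time N t) (S0_space Omega M)).

Definition PiRT1 : ('cV[R]_d.+1 -> 'cV[R]_d) -> 'cV[R]_d.+1 -> 'cV[R]_d :=
  orthogonal_projection Q
    (tensor_space T Omega (S1_time T N t) (RT0 Omega M)).

Definition galerkin_solution (rhs A : 'cV[R]_d.+1 -> 'cV[R]_d) :=
  ansatz_space A /\ forall v, ansatz_space v ->
    dot_L2v Q (fun z => eps (space_of z) *m mhilbert_x T Omega (dt A) z)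
      (dt v) +
    dot_L2v Q (fun z => invmx (permeability_mx mu (space_of z)) *m
        curl_x Omega T A z)
      (curl_x Omega T (mhilbert_x T Omega v)) =
    dot_L2v Q rhs (mhilbert_x T Omega v).

Definition uniquely_solvable (rhs : 'cV[R]_d.+1 -> 'cV[R]_d) :=
  exists A, galerkin_solution rhs A /\ forall B, galerkin_solution rhs B ->
    \forall z \ae leb R d.+1, Q z -> B z = A z.

End galerkin_bubnov.

(* Main.v *)
From HB Require Import structures.
From mathcomp Require Import all_boot all_order all_algebra.
From mathcomp Require Import mxtens ring lra zify.
From mathcomp Require Import all_classical all_reals all_analysis measurable_realfun.
Require Import Defs.

Set Implicit Arguments.
Unset Strict Implicit.
Unset Printing Implicit Defensive.

Import Order.TTheory GRing.Theory Num.Theory.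
Import numFieldTopology.Exports numFieldNormedType.Exports.

Local Open Scope classical_set_scope.
Local Open Scope ring_scope.

(** Expand [v] in the sines [sin ((1/2 + k) pi s / T)], with coefficients [c k];
  the transform has the corresponding cosine series, and integrating
  [sin ((j + k + 1) pi s / T)] over (0, T) gives
  [(v, H_T v) = T / (2 pi) \int_(-1)^1 (\sum_k c k x^k)^2 dx],
  which is nonnegative and vanishes only for [v = 0].  Hence A_t is positive
  definite and M_t positive semidefinite, although neither is symmetric.  The
  space matrices are symmetric, so they have the form [W^T W], and the quadratic
  form of [A *t W^T W] is a sum of values of the quadratic form of [A].

  On a sum of tensors the time derivative, the transform and the curl act
  factorwise almost everywhere; for the weak curl this rests on its uniqueness
  (fundamental lemma, with C^1 bump functions), for the transform on the
  completeness of the sines (Weierstrass) and of L^2.  The Galerkin equations are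
  therefore the linear system with the invertible matrix K. *)

(** * Square integrable functions *)

(** The transform, the weak curl and the projections are values chosen by [xget], and finite element
    functions are fixed only inside the cells. Identities therefore hold almost everywhere, with no
    measurability at hand for functions such as [dt v]: integrals are compared without it, and each
    function of time is paired with a bounded measurable representative.

    Nonnegativity survives the passage to the limit in the series, strictness does not. It is
    recovered from the first nonzero coefficient, which keeps the power sums away from zero
    uniformly in the number of terms.

    Weierstrass enters because products of [sin (pi s / (2 T))] with polynomials in [cos (pi s / T)]
    are finite sine sums. A function is thus divided by this sine before it is approximated, and
    since the sine vanishes at [s = 0] the quotient has to be regularised.

    The curl may vanish on nonzero combinations of the basis, so the strictness of [K] comes from
    the tensor product of [A_t] and [M_x]. There the derivatives of the hats are independent because
    the hat at [t = 0] is left out. *)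

Section ae_integral.
Local Open Scope ereal_scope.
Context d (X : measurableType d) (R : realType).
Variables (m : {measure set X -> \bar R}) (D : set X).

Import HBNNSimple.

(** The integral of a nonnegative function is a supremum over the simple functions below it,
    measurable or not. A simple function below [f], cut to zero on the null set, lies below [g] and
    keeps its integral. *)
Lemma ge0_ae_le_integral_nomeas (f g : X -> \bar R) :
  (forall x, 0 <= f x) -> (forall x, 0 <= g x) ->
  {ae m, forall x, f x <= g x} -> \int[m]_x f x <= \int[m]_x g x.
Proof.
move=> f0 g0 [N [mN N0 fgN]].
rewrite [leLHS]ge0_integralTE//; apply: ge_ereal_sup => _ [h /= hf <-].
rewrite [leRHS]ge0_integralTE//; apply: ereal_sup_ubound.
have mNC : measurable (~` N) by exact: measurableC.
have hE x : proj_nnsfun h mNC x = (h \_ (~` N)) x by rewrite mrestrict.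
exists (proj_nnsfun h mNC).
  move=> x; rewrite hE /patch; case: ifPn => [|_]; last exact: g0.
  rewrite inE => Nx; apply: (le_trans (hf x)).
  by apply: contrapT => fg; apply: Nx; exact: fgN.
rewrite -!integralT_nnsfun; apply: ge0_ae_eq_integral => //.
- exact/measurable_EFinP.
- exact/measurable_EFinP.
- by move=> x _; rewrite lee_fin.
- by move=> x _; rewrite lee_fin.
exists N; split => // x /= H; apply: contrapT => Nx; apply: H => _.
have /= -> := hE x; by rewrite /patch mem_set.
Qed.

Lemma ge0_ae_eq_integral_nomeas (f g : X -> \bar R) :
  (forall x, 0 <= f x) -> (forall x, 0 <= g x) ->
  {ae m, forall x, f x = g x} -> \int[m]_x f x = \int[m]_x g x.
Proof.
move=> f0 g0 fg; apply/eqP; rewrite eq_le.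
rewrite !ge0_ae_le_integral_nomeas//; apply: filterS fg => x -> //.
Qed.

Lemma ae_eq_integral_nomeas (f g : X -> \bar R) :
  {ae m, forall x, D x -> f x = g x} ->
  \int[m]_(x in D) f x = \int[m]_(x in D) g x.
Proof.
move=> fg; rewrite integralE [RHS]integralE !(integral_mkcond D).
congr (_ - _); apply: ge0_ae_eq_integral_nomeas => [x|x|];
  rewrite ?erestrict_ge0//; apply: filterS fg => x fgx;
  by rewrite /patch; case: ifPn => //; rewrite inE => /fgx fgE; rewrite ?funeposE ?funenegE fgE.
Qed.

End ae_integral.

(** Kept squared, so that no root appears; the price is the factor 2 in [dist2_triangle]. *)
Definition dist2 d (X : measurableType d) (R : realType)
    (m : {measure set X -> \bar R}) (D : set X) (f g : X -> R) : R :=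
  dot_L2 m D (fun x => f x - g x) (fun x => f x - g x).

Section L2_space.
Context d (X : measurableType d) (R : realType).
Variables (m : {measure set X -> \bar R}) (D : set X).
Hypothesis mD : measurable D.

Local Notation L2 := (L2 m D).
Local Notation dot := (dot_L2 m D).
Local Notation dist2 := (dist2 m D).

Lemma eq_L2 (f g : X -> R) : (forall x, D x -> f x = g x) -> L2 f -> L2 g.
Proof.
move=> fg [mf f2]; have fgD : {in D, f =1 g} by move=> x /set_mem /fg.
split; first exact: eq_measurable_fun mf.
by apply: eq_integrable f2 => // x /fgD ->.
Qed.

Lemma L2_mul_integrable (f g : X -> R) : L2 f -> L2 g ->
  m.-integrable D (fun x => (f x * g x)%:E).
Proof.
move=> [mf f2] [mg g2]; have := integrableD mD f2 g2; apply: le_integrable => //.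
  by apply/measurable_EFinP; exact: measurable_funM.
move=> x _; change (`|(f x * g x)%:E| <= `|(f x ^+ 2 + g x ^+ 2)%:E|)%E.
rewrite !abse_EFin lee_fin normrM.
rewrite [leRHS]ger0_norm ?addr_ge0 ?sqr_ge0//.
have := sqr_ge0 (`|f x| - `|g x|); rewrite sqrrB !real_normK ?num_real//.
move: (normr_ge0 (f x)) (normr_ge0 (g x)) => *; nra.
Qed.

Lemma L2D (f g : X -> R) : L2 f -> L2 g -> L2 (fun x => f x + g x).
Proof.
move=> f2 g2; split; first by apply: measurable_funD; [case: f2|case: g2].
have := integrableD mD (integrableD mD f2.2 g2.2)
  (integrableZl mD 2 (L2_mul_integrable f2 g2)).
by apply: eq_integrable => // x _ /=; rewrite -EFinM -!EFinD; congr EFin; ring.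
Qed.

Lemma L2Z (a : R) (f : X -> R) : L2 f -> L2 (fun x => a * f x).
Proof.
move=> [mf f2]; split; first exact: measurable_funM.
have := integrableZl mD (a ^+ 2) f2.
by apply: eq_integrable => // x _ /=; rewrite -EFinM; congr EFin; ring.
Qed.

Lemma L2N (f : X -> R) : L2 f -> L2 (fun x => - f x).
Proof. by move=> /(L2Z (-1)); apply: eq_L2 => x _; rewrite mulN1r. Qed.

Lemma L2B (f g : X -> R) : L2 f -> L2 g -> L2 (fun x => f x - g x).
Proof. by move=> f2 /L2N; exact: L2D. Qed.

Lemma L2_0 : L2 (fun=> 0).
Proof.
split; first exact: measurable_cst.
by apply: eq_integrable (integrable0 m D) => // x _; rewrite expr0n.
Qed.

Lemma L2_sum (I : Type) (r : seq I) (f : I -> X -> R) :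
  (forall i, L2 (f i)) -> L2 (fun x => \sum_(i <- r) f i x).
Proof.
move=> f2; elim: r => [|i r IH].
  by apply: eq_L2 L2_0 => x _; rewrite big_nil.
by apply: eq_L2 (L2D (f2 i) IH) => x _; rewrite big_cons.
Qed.

Lemma L2_bounded_mul (C : R) (h f : X -> R) : measurable_fun D h ->
  (forall x, D x -> `|h x| <= C) -> L2 f -> L2 (fun x => h x * f x).
Proof.
move=> mh hC [mf f2]; split; first exact: measurable_funM.
have := integrableZl mD (C ^+ 2) f2; apply: le_integrable => //.
  by apply/measurable_EFinP; apply: measurable_funX; exact: measurable_funM.
move=> x /hC hx; rewrite -EFinM !abse_EFin lee_fin exprMn !normrM.
rewrite ler_wpM2r ?mulr_ge0// ler_pM// (le_trans hx)// ler_norm//.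
Qed.

Lemma L2_bounded (C : R) (f : X -> R) : (m D < +oo)%E -> measurable_fun D f ->
  (forall x, D x -> `|f x| <= C) -> L2 f.
Proof.
move=> Doo mf fC.
have L1 : L2 (fun=> 1).
  split=> //; apply/integrableP; split; first exact: measurable_cst.
  rewrite (eq_integral (fun=> 1%:E)); last first.
    by move=> x _; rewrite expr1n abse1.
  by rewrite integral_cst// mul1e.
by apply: eq_L2 (L2_bounded_mul mf fC L1) => x _; rewrite mulr1.
Qed.

Lemma dotC (f g : X -> R) : dot f g = dot g f.
Proof. by apply: eq_Rintegral => x _; rewrite mulrC. Qed.

Lemma dotDl (f g h : X -> R) : L2 f -> L2 g -> L2 h ->
  dot (fun x => f x + g x) h = dot f h + dot g h.
Proof.
move=> f2 g2 h2; rewrite /dot_L2 -RintegralD//; try exact: L2_mul_integrable.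
by apply: eq_Rintegral => x _; rewrite mulrDl.
Qed.

Lemma dotZl (a : R) (f h : X -> R) : L2 f -> L2 h ->
  dot (fun x => a * f x) h = a * dot f h.
Proof.
move=> f2 h2; rewrite /dot_L2 -RintegralZl//; last exact: L2_mul_integrable.
by apply: eq_Rintegral => x _; rewrite mulrA.
Qed.

Lemma dotDr (f g h : X -> R) : L2 f -> L2 g -> L2 h ->
  dot h (fun x => f x + g x) = dot h f + dot h g.
Proof. by move=> f2 g2 h2; rewrite dotC dotDl// dotC (dotC g). Qed.

Lemma dotZr (a : R) (f h : X -> R) : L2 f -> L2 h ->
  dot h (fun x => a * f x) = a * dot h f.
Proof. by move=> f2 h2; rewrite dotC dotZl// dotC. Qed.

Lemma dot0l (h : X -> R) : dot (fun=> 0) h = 0.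
Proof.
by rewrite /dot_L2 /Rintegral integral0_eq// => x _; rewrite mul0r.
Qed.

Lemma dot_suml (I : Type) (r : seq I) (a : I -> R) (f : I -> X -> R)
    (h : X -> R) : (forall i, L2 (f i)) -> L2 h ->
  dot (fun x => \sum_(i <- r) a i * f i x) h = \sum_(i <- r) a i * dot (f i) h.
Proof.
move=> f2 h2; elim: r => [|i r IH].
  by rewrite big_nil -[RHS](dot0l h); apply: eq_Rintegral => x _; rewrite big_nil.
rewrite big_cons -IH -dotZl// -dotDl//; first last.
- by apply: L2_sum => j; exact: L2Z.
- exact: L2Z.
by apply: eq_Rintegral => x _; rewrite big_cons.
Qed.

Lemma dot_sumr (I : Type) (r : seq I) (a : I -> R) (f : I -> X -> R)
    (h : X -> R) : (forall i, L2 (f i)) -> L2 h ->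
  dot h (fun x => \sum_(i <- r) a i * f i x) = \sum_(i <- r) a i * dot h (f i).
Proof.
move=> f2 h2; rewrite dotC dot_suml//.
by apply: eq_bigr => i _; rewrite dotC.
Qed.

Lemma dot_ge0 (f : X -> R) : 0 <= dot f f.
Proof. by apply: Rintegral_ge0 => x _; rewrite -expr2 sqr_ge0. Qed.

Lemma dotDD (f g : X -> R) : L2 f -> L2 g ->
  dot (fun x => f x + g x) (fun x => f x + g x) =
  dot f f + 2 * dot f g + dot g g.
Proof.
move=> f2 g2; have fg2 := L2D f2 g2.
rewrite dotDl// dotC (dotC g) !dotDl// (dotC g f); ring.
Qed.

Lemma dot_ZZ (a : R) (f : X -> R) : L2 f ->
  dot (fun x => a * f x) (fun x => a * f x) = a ^+ 2 * dot f f.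
Proof.
move=> f2; rewrite dotZl//; last exact: L2Z.
by rewrite dotC dotZl// mulrA -expr2.
Qed.

Lemma dot_CauchySchwarz (f g : X -> R) : L2 f -> L2 g ->
  dot f g ^+ 2 <= dot f f * dot g g.
Proof.
move=> f2 g2.
have P s : 0 <= dot f f + 2 * s * dot f g + s ^+ 2 * dot g g.
  have := dot_ge0 (fun x => f x + s * g x).
  rewrite dotDD//; last exact: L2Z.
  by rewrite (dotC f) dotZl// dot_ZZ// (dotC g) mulrA.
have := dot_ge0 f; have := dot_ge0 g; rewrite le_eqVlt => /predU1P[g0|g0] f0.
  (* If [g] has norm zero, [P] bounds an affine function of [s]; with a nonzero slope that function
     would take the value -1 at the point below. *)
  rewrite -g0 mulr0 in P *.
  have [->|fg0] := eqVneq (dot f g) 0; first by rewrite expr0n.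
  have := P (- (dot f f + 1) / (2 * dot f g)).
  rewrite mulr0 addr0 (_ : 2 * _ * _ = - (dot f f + 1)); first lra.
  by field.
(* The minimiser of the quadratic polynomial in [s]. *)
have := P (- dot f g / dot g g).
have g0' : dot g g != 0 by rewrite gt_eqF.
rewrite (_ : _ + _ + _ = dot f f - dot f g ^+ 2 / dot g g); last by field.
by rewrite subr_ge0 ler_pdivrMr.
Qed.

Lemma integral_sqr_dot (f : X -> R) : L2 f ->
  (\int[m]_(x in D) ((f x) ^+ 2)%:E)%E = (dot f f)%:E.
Proof.
move=> f2; rewrite /dot_L2 /Rintegral fineK; last first.
  by apply: integrable_fin_num => //; exact: L2_mul_integrable.
by apply: eq_integral => x _; rewrite expr2.
Qed.

Lemma dot_eq0 (f : X -> R) : L2 f -> dot f f = 0 ->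
  {ae m, forall x, D x -> f x = 0}.
Proof.
move=> f2 dot0; have := integral_sqr_dot f2; rewrite dot0 => f0.
have mf : measurable_fun D (fun x => (f x ^+ 2)%:E).
  by apply/measurable_EFinP; apply: measurable_funX; case: f2.
have /(ae_eq_integral_abs m mD mf) : (\int[m]_(x in D) `|(f x ^+ 2)%:E| = 0)%E.
  apply: etrans f0; apply: eq_integral => x _.
  by rewrite gee0_abs// lee_fin sqr_ge0.
apply: filterS => x /= H /H [] /eqP; rewrite sqrf_eq0 => /eqP; exact.
Qed.

Lemma dot_le_dot (f g : X -> R) : L2 f -> L2 g ->
  (forall x, D x -> `|f x| <= `|g x|) -> dot f f <= dot g g.
Proof.
move=> f2 g2 fg; apply: le_Rintegral => //; try exact: L2_mul_integrable.
move=> x Dx; rewrite -!expr2 -(real_normK (num_real (f x))).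
by rewrite -(real_normK (num_real (g x))) lerXn2r ?nnegrE ?normr_ge0 ?fg.
Qed.

Lemma ae_eq_dot (f f' g g' : X -> R) :
  {ae m, forall x, D x -> f x = f' x} -> {ae m, forall x, D x -> g x = g' x} ->
  dot f g = dot f' g'.
Proof.
move=> ff gg; congr fine; apply: ae_eq_integral_nomeas.
by near=> x => Dx; rewrite (near ff x)// (near gg x).
Unshelve. all: by end_near. Qed.

Lemma ae_eq_cvg_L2 (f : nat -> X -> R) (g g' : X -> R) :
  {ae m, forall x, D x -> g x = g' x} ->
  cvg_L2 m D f g -> cvg_L2 m D f g'.
Proof.
move=> gg; rewrite /cvg_L2.
rewrite (_ : (fun k => _) = (fun k => \int[m]_(x in D) ((f k x - g' x) ^+ 2)%:E)%E)//.
apply/funext => k; apply: ae_eq_integral_nomeas.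
by apply: filterS gg => x /[apply] ->.
Qed.

Lemma cvg_L2P (f : nat -> X -> R) (g : X -> R) :
  (forall k, L2 (f k)) -> L2 g ->
  cvg_L2 m D f g <->
  dist2 (f k) g @[k --> \oo] --> 0.
Proof.
move=> f2 g2; rewrite /cvg_L2.
rewrite (_ : (fun k => _) = EFin \o
  (fun k => dist2 (f k) g)); last first.
  by apply/funext => k; rewrite integral_sqr_dot//; exact: L2B.
split => [/fine_cvgP[]//|?]; apply/fine_cvgP; split => //; exact: nearW.
Qed.

Lemma dist2_ge0 (f g : X -> R) : 0 <= dist2 f g.
Proof. exact: dot_ge0. Qed.

Lemma dist2C (f g : X -> R) : dist2 f g = dist2 g f.
Proof. by apply: eq_Rintegral => x _; ring. Qed.

Lemma integral_sqr_dist2 (f g : X -> R) : L2 f -> L2 g ->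
  (\int[m]_(x in D) ((f x - g x) ^+ 2)%:E)%E = (dist2 f g)%:E.
Proof. by move=> f2 g2; rewrite integral_sqr_dot//; exact: L2B. Qed.

Lemma dist2E (f g : X -> R) : L2 f -> L2 g ->
  dist2 f g = dot f f - 2 * dot f g + dot g g.
Proof.
move=> f2 g2; have := dotDD f2 (L2Z (-1) g2).
rewrite dot_ZZ// dotZr// => H.
rewrite [LHS](_ : _ = dot (fun x => f x + -1 * g x) (fun x => f x + -1 * g x)).
  by rewrite H; ring.
by apply: eq_Rintegral => x _; ring.
Qed.

Lemma dist2_triangle (f g h : X -> R) : L2 f -> L2 g -> L2 h ->
  dist2 f h <= 2 * dist2 f g + 2 * dist2 g h.
Proof.
move=> f2 g2 h2; pose a := fun x => f x - g x; pose b := fun x => g x - h x.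
have a2 : L2 a by exact: L2B.
have b2 : L2 b by exact: L2B.
have -> : dist2 f h = dot (fun x => a x + b x) (fun x => a x + b x).
  by apply: eq_Rintegral => x _; rewrite /a /b; ring.
rewrite -[dist2 f g]/(dot a a) -[dist2 g h]/(dot b b) dotDD//.
(* The squared norm of [a - b] is nonnegative, so twice the cross term is at most the sum of the
   squares. *)
have := dist2_ge0 a b; rewrite dist2E//; lra.
Qed.

End L2_space.

(** * Convergence in L^2 and completeness *)

Section L2_convergence.
Context d (X : measurableType d) (R : realType).
Variables (m : {measure set X -> \bar R}) (D : set X).
Hypothesis mD : measurable D.

Local Notation L2 := (L2 m D).
Local Notation dot := (dot_L2 m D).
Local Notation dist2 := (dist2 m D).

Lemma bounded_cvg_dist2 (B : R) (u : nat -> X -> R) (v : X -> R) :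
  (m D < +oo)%E -> L2 v -> (forall n, L2 (u n)) ->
  (forall n x, D x -> `|v x - u n x| <= B) ->
  (forall x, D x -> u n x @[n --> \oo] --> v x) ->
  dist2 v (u n) @[n --> \oo] --> 0.
Proof.
move=> Doo v2 u2 vuB uv.
pose F n x : \bar R := ((v x - u n x) ^+ 2)%:E.
have mF n : measurable_fun D (F n).
  by apply/measurable_EFinP; apply: measurable_funX; exact: (L2B mD v2 (u2 n)).1.
have FB n x : D x -> (`|F n x| <= (B ^+ 2)%:E)%E.
  move=> Dx; rewrite /F abse_EFin lee_fin ger0_norm ?sqr_ge0//.
  have B0 : 0 <= B by exact: le_trans (normr_ge0 _) (vuB n _ Dx).
  by rewrite -(real_normK (num_real (_ - _))) lerXn2r ?nnegrE ?vuB.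
have Fcvg x : D x -> (F n x @[n --> \oo] --> 0)%E.
  move=> Dx; apply/fine_cvgP; split; first exact: nearW.
  have H : v x - u n x @[n --> \oo] --> v x - v x.
    by apply: cvgB; [exact: cvg_cst|exact: uv].
  have := cvgM H H; rewrite subrr mulr0 => H2.
  exact: H2.
have iB : m.-integrable D (fun=> (B ^+ 2)%:E).
  apply/integrableP; split; first exact: measurable_cst.
  rewrite (eq_integral (fun=> (B ^+ 2)%:E)); last first.
    by move=> x _; rewrite gee0_abs// lee_fin sqr_ge0.
  by rewrite integral_cst//= lte_mul_pinfty// lee_fin sqr_ge0.
have [_ _] := dominated_convergence mD mF (measurable_cst (0%E : \bar R)) (aeW m Fcvg) iB
  (aeW m (fun x n Dx => FB n x Dx)).
rewrite integral0 (_ : [sequence _]_n = EFin \o (fun n => dist2 v (u n))).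
  by move=> /fine_cvgP[].
by apply/funext => n; rewrite /= /F integral_sqr_dist2.
Qed.

Lemma cvg_dot0 (f g : nat -> X -> R) (C : R) :
  (forall k, L2 (f k)) -> (forall k, L2 (g k)) ->
  (forall k, dot (g k) (g k) <= C) ->
  dot (f k) (f k) @[k --> \oo] --> 0 ->
  dot (f k) (g k) @[k --> \oo] --> 0.
Proof.
move=> f2 g2 gC f0; apply/cvgr0Pnorm_le => e e0.
have C0 : 0 < `|C| + 1 by rewrite ltr_wpDl.
have e20 : 0 < e ^+ 2 / (`|C| + 1) by rewrite divr_gt0// exprn_gt0.
have /cvgr0Pnorm_le/(_ _ e20) := f0; apply: filterS => k.
rewrite ger0_norm ?dot_ge0 // => fk; rewrite ler_pdivlMr// in fk.
rewrite -(@ler_pXn2r _ 2)// ?nnegrE ?(ltW e0)//.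
rewrite real_normK ?num_real//; apply: (le_trans _ fk).
apply: (le_trans (dot_CauchySchwarz mD (f2 k) (g2 k))).
rewrite ler_wpM2l ?dot_ge0//; apply: (le_trans (gC k)).
by rewrite (le_trans (ler_norm _))// lerDl.
Qed.

Lemma cvg_dot (f g : nat -> X -> R) (f' g' : X -> R) :
  (forall k, L2 (f k)) -> (forall k, L2 (g k)) -> L2 f' -> L2 g' ->
  cvg_L2 m D f f' -> cvg_L2 m D g g' ->
  dot (f k) (g k) @[k --> \oo] --> dot f' g'.
Proof.
move=> f2 g2 f'2 g'2 /(cvg_L2P mD f2 f'2) ff /(cvg_L2P mD g2 g'2) gg.
have df k : L2 (fun x => f k x - f' x) by exact: L2B.
have dg k : L2 (fun x => g k x - g' x) by exact: L2B.
(* Expansion around the limits: each of the three error terms has a factor tending to zero in norm,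
   and the other factor is fixed or, in the last term, bounded because its norms converge. *)
have E k : dot (f k) (g k) = dot f' g' + dot (fun x => f k x - f' x) g' +
    dot (fun x => g k x - g' x) f' +
    dot (fun x => f k x - f' x) (fun x => g k x - g' x).
  rewrite [LHS](_ : _ = dot (fun x => (f k x - f' x) + f' x)
                           (fun x => (g k x - g' x) + g' x)); last first.
    by apply: eq_Rintegral => x _; rewrite !subrK.
  rewrite dotDl//; last exact: L2D.
  rewrite !(dotDr mD (dg k) g'2)// (dotC _ _ (fun x => g k x - g' x) f'); ring.
have -> : dot f' g' = dot f' g' + 0 + 0 + 0 by rewrite !addr0.
under eq_fun do rewrite E.
have G0 (h : X -> R) : dot h h <= dot h h by [].
apply: cvgD; last first.
  have [M [_ /= gM]] := cvg_seq_bounded (cvgP _ gg).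
  apply: (@cvg_dot0 _ _ (`|M| + 1)) => // k.
  by have := gM (`|M| + 1); rewrite (le_lt_trans (ler_norm _)) ?ltrDl// => /(_ isT k I);
    apply: le_trans; exact: ler_norm.
apply: cvgD; last by apply: (@cvg_dot0 _ (fun=> f')) => //.
apply: cvgD; first exact: cvg_cst.
by apply: (@cvg_dot0 _ (fun=> g')) => //.
Qed.

(** This makes the transform independent of the chosen expansion: two sine expansions of one [v]
    approach each other, and the corresponding cosine sums lie at the same distances. *)
Lemma cvg_L2_isometry_unique (S S' C C' : nat -> X -> R) (v w w' : X -> R) :
  (forall k, L2 (S k)) -> (forall k, L2 (S' k)) ->
  (forall k, L2 (C k)) -> (forall k, L2 (C' k)) ->
  L2 v -> L2 w -> L2 w' ->
  (forall k, dist2 (C k) (C' k) = dist2 (S k) (S' k)) ->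
  cvg_L2 m D S v -> cvg_L2 m D S' v -> cvg_L2 m D C w -> cvg_L2 m D C' w' ->
  {ae m, forall x, D x -> w x = w' x}.
Proof.
move=> S2 S'2 C2 C'2 v2 w2 w'2 CS /(cvg_L2P mD S2 v2) Sv /(cvg_L2P mD S'2 v2) S'v.
move=> /(cvg_L2P mD C2 w2) Cw /(cvg_L2P mD C'2 w'2) C'w.
suff ww : dist2 w w' = 0.
  have := dot_eq0 mD (L2B mD w2 w'2) ww.
  by apply: filterS => x /[apply] /eqP; rewrite subr_eq0 => /eqP.
apply/eqP; rewrite eq_le dist2_ge0 andbT.
(* The weights come from three uses of [dist2_triangle] along the chain [w], [C k], [C' k], [w'],
   with the middle distance replaced by the one from [S k] over [v] to [S' k]. *)
have H : 2 * dist2 (C k) w + 8 * dist2 (S k) v + 8 * dist2 (S' k) v +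
    4 * dist2 (C' k) w' @[k --> \oo] --> 2 * 0 + 8 * 0 + 8 * 0 + 4 * (0 : R).
  by repeat apply: cvgD; apply: cvgM => //; exact: cvg_cst.
rewrite !mulr0 !addr0 in H.
rewrite -(cvg_lim _ H)//; apply: limr_ge; first exact: cvgP H.
apply: nearW => k.
have := dist2_triangle mD w2 (C2 k) w'2; have := dist2_triangle mD (C2 k) (C'2 k) w'2.
have := dist2_triangle mD (S2 k) v2 (S'2 k).
rewrite (dist2C m D w (C k)) (dist2C m D v (S' k)) CS; lra.
Qed.

(** Riesz-Fischer: a rapidly converging subsequence has absolutely summable increments at almost
    every point, and Fatou turns its pointwise limit into the limit in L^2 of the whole sequence. *)
Lemma L2_complete (f : nat -> X -> R) : (forall k, L2 (f k)) ->
  (forall e, 0 < e -> exists N, forall p q, (N <= p)%N -> (N <= q)%N ->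
    dist2 (f p) (f q) <= e) ->
  exists w, L2 w /\ cvg_L2 m D f w.
Proof.
move=> f2 fC.
(* The first power of 2 pays for the weight in [a] below; what remains, [2 ^ -(k+1)], sums to 1. *)
have eps_gt0 k : 0 < ((2 ^ k * 2 ^ (k + 0.+1))%:R)^-1 :> R.
  by rewrite invr_gt0 ltr0n muln_gt0 !expn_gt0.
have /choice[N NP] := fun k => fC _ (eps_gt0 k).
(* A sum rather than [N k], so that the index dominates every earlier threshold. *)
pose n k := (\sum_(i < k.+1) N i)%N.
have Nn k j : (k <= j)%N -> (N k <= n j)%N.
  move=> kj; have kj' : (k < j.+1)%N by [].
  by rewrite /n (bigD1 (Ordinal kj'))//= leq_addr.
pose g k := f (n k).
have g2 k : L2 (g k) by exact: f2.
have mg k : measurable_fun D (g k) by case: (g2 k).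
pose a k x := 2 ^+ k * (g k.+1 x - g k x) ^+ 2.
have a0 k x : 0 <= a k x by apply: mulr_ge0; [exact: exprn_ge0|exact: sqr_ge0].
have ma k : measurable_fun D (EFin \o a k).
  apply/measurable_EFinP; apply: measurable_funM; first exact: measurable_cst.
  by apply: measurable_funX; exact: measurable_funB.
pose h x : \bar R := (\sum_(k <oo) (a k x)%:E)%E.
have h0 x : (0 <= h x)%E by apply: nneseries_ge0 => k _ _; rewrite lee_fin.
have mh : measurable_fun D h.
  apply: (@ge0_emeasurable_sum _ _ _ D (fun k => EFin \o a k) xpredT) => //.
  by move=> k x _ _; rewrite lee_fin.
have Ih : (\int[m]_(x in D) h x < +oo)%E.
  rewrite integral_nneseries//; last by move=> k x _; rewrite lee_fin.
  have := @cvg_geometric_eseries_half R 1 0.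
  move=> /cvg_lim H; apply: (@le_lt_trans _ _ (1 / 2 ^+ 0)%:E); last exact: ltry.
  rewrite -(H _)//; apply: lee_nneseries => k _.
    by move=> _; apply: integral_ge0 => x _; rewrite lee_fin.
  rewrite (_ : (\int[m]_(x in D) _)%E =
      (2 ^+ k)%:E * \int[m]_(x in D) ((g k.+1 x - g k x) ^+ 2)%:E)%E; last first.
    rewrite -ge0_integralZl//.
      by apply/measurable_EFinP; apply: measurable_funX; exact: measurable_funB.
    by move=> x _; rewrite lee_fin sqr_ge0.
  rewrite (integral_sqr_dist2 mD (g2 k.+1) (g2 k)) -EFinM lee_fin.
  have := NP k _ _ (Nn _ _ (leqnSn k)) (Nn _ _ (leqnn k)).
  rewrite natrM invfM natrX mul1r => H2.
  by rewrite -ler_pdivlMl ?exprn_gt0.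
have hfin : {ae m, forall x, D x -> h x \is a fin_num}.
  apply: integrable_ae => //; apply/integrableP; split => //.
  by under eq_integral do rewrite gee0_abs//.
have gcvg : {ae m, forall x, D x -> cvgn (g ^~ x)}.
  apply: filterS hfin => x /[apply] hx.
  have acvg : cvgn (series (a ^~ x)).
    apply: nondecreasing_is_cvgn.
      by apply: nondecreasing_series => k _ _; exact: a0.
    exists (fine (h x)) => _ [k _ <-].
    rewrite -lee_fin fineK// /series/= -sumEFin.
    by apply: nneseries_lim_ge => i _ _; rewrite lee_fin.
  have bcvg : cvgn (series (fun k => 2 / (2 ^ (k + 0.+1))%:R : R^o)).
    by apply: cvgP; exact: cvg_geometric_series_half.
  (* For [p = 2 ^ k] and an increment of size [z], [z <= p z^2 + 1/p]: the weighted squares,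
     summable because [h x] is finite, and a geometric series control the increments themselves. *)
  have : cvgn [normed series (telescope (g ^~ x))].
    apply: (@series_le_cvg _ _ (a ^~ x + (fun k => 2 / (2 ^ (k + 0.+1))%:R))) => //.
    - by move=> k /=.
    - by move=> k; rewrite !fctE addr_ge0// ?a0// divr_ge0.
    - move=> k; rewrite /telescope /a /= !fctE addn1 expnS natrM natrX.
      set y := g k.+1 x - g k x.
      have p0 : 0 < 2 ^+ k :> R by rewrite exprn_gt0.
      rewrite -[y ^+ 2]real_normK ?num_real//.
      set p := 2 ^+ k in p0 *; set z := `|y|.
      have z0 : 0 <= z by exact: normr_ge0.
      have p_neq0 : p != 0 by rewrite gt_eqF.
      rewrite (_ : 2 / (2 * p) = p^-1); last by field.
      rewrite -subr_ge0 (_ : _ - _ = ((p * z - 1) ^+ 2 + p * z) / p); last by field.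
      by rewrite divr_ge0 ?(ltW p0)// addr_ge0 ?sqr_ge0// mulr_ge0 ?(ltW p0).
    - by rewrite seriesD; apply: is_cvgD.
  move=> /normed_cvg; rewrite telescopeK => /(is_cvgD (is_cvg_cst (g 0%N x))).
  by congr (cvgn _); apply/funext => k; rewrite /= addrC subrK.
(* The upper limit is measurable without further argument and equals the limit wherever that
   exists. *)
pose w x := fine (limn_esup (fun k => (g k x)%:E)).
have gw : {ae m, forall x, D x -> g ^~ x @ \oo --> w x}.
  apply: filterS gcvg => x /[apply] gx.
  have H : ((g k x)%:E @[k --> \oo] --> (limn (g ^~ x))%:E)%E.
    by apply/fine_cvgP; split => //; exact: nearW.
  by rewrite /w (cvg_limn_einf_sup H).2.
have mw : measurable_fun D w.
  apply: measurableT_comp; first exact: fine_measurable.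
  by apply: measurable_fun_limn_esup => k; exact/measurable_EFinP.
have mfw p : measurable_fun D (fun x => f p x - w x).
  by apply: measurable_funB => //; case: (f2 p).
(* By Fatou the distance from [f p] to [w] is at most the lower limit of its distances to [g k],
   which the Cauchy property bounds. *)
have fw K p : (N K <= p)%N ->
    (\int[m]_(x in D) ((f p x - w x) ^+ 2)%:E <=
      ((2 ^ K * 2 ^ (K + 0.+1))%:R^-1)%:E)%E.
  move=> Kp.
  rewrite (ae_eq_integral_nomeas
      (g := fun x => limn_einf (fun k => ((f p x - g k x) ^+ 2)%:E))); last first.
    apply: filterS gw => x /[apply] gx.
    have H : (((f p x - g k x) ^+ 2)%:E @[k --> \oo] --> ((f p x - w x) ^+ 2)%:E)%E.
      apply/fine_cvgP; split; first exact: nearW.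
      apply: cvgM; apply: cvgB => //; exact: cvg_cst.
    by rewrite (cvg_limn_einf_sup H).1.
  apply: (le_trans (fatou _ _ _ _)) => //.
  - move=> k; apply/measurable_EFinP; apply: measurable_funX.
    by apply: measurable_funB => //; case: (f2 p).
  - by move=> k x _; rewrite lee_fin sqr_ge0.
  rewrite limn_einf_lim; apply: lime_le; first exact: is_cvg_einfs.
  exists K => // k /= Kk.
  apply: (@le_trans _ _ (\int[m]_(x in D) ((f p x - g k x) ^+ 2)%:E)%E).
    by apply: ereal_inf_lbound; exists k => /=.
  rewrite (integral_sqr_dist2 mD (f2 p) (g2 k)) lee_fin.
  by apply: NP => //; exact: Nn.
have w2 : L2 w.
  have fw2 : L2 (fun x => f (N 0%N) x - w x).
    split => //; apply/integrableP; split.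
      by apply/measurable_EFinP; exact: measurable_funX.
    under eq_integral do rewrite gee0_abs ?lee_fin ?sqr_ge0//.
    exact: le_lt_trans (fw 0%N _ (leqnn _)) (ltry _).
  by apply: (eq_L2 mD _ (L2B mD (f2 (N 0%N)) fw2)) => x _; ring.
exists w; split => //; apply/(cvg_L2P mD f2 w2).
apply/cvgr0Pnorm_le => e e0.
have [K Ke] : exists K, ((2 ^ K * 2 ^ (K + 0.+1))%:R)^-1 <= e.
  exists (Num.bound e^-1); rewrite -[leRHS]invrK lef_pV2 ?posrE ?invr_gt0 ?ltr0n ?muln_gt0 ?expn_gt0//.
  apply: (le_trans (ltW (archi_boundP _))); first by rewrite invr_ge0 ltW.
  rewrite ler_nat; apply: (@leq_trans (2 ^ Num.bound e^-1)%N).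
    exact/ltnW/ltn_expl.
  by rewrite leq_pmulr// expn_gt0.
exists (N K) => // p /= Kp; rewrite ger0_norm ?dist2_ge0//.
apply: (le_trans _ Ke); rewrite -lee_fin -(integral_sqr_dist2 mD (f2 p) w2).
exact: fw.
Qed.

End L2_convergence.

(** * Weierstrass approximation *)

Section Bernstein.
Variable R : realType.
Implicit Types (n : nat) (x : R).

Definition bernstein n k x : R := 'C(n, k)%:R * x ^+ k * (1 - x) ^+ (n - k).

Lemma bernstein_ge0 n k x : 0 <= x <= 1 -> 0 <= bernstein n k x.
Proof.
move=> /andP[x0 x1]; rewrite /bernstein mulr_ge0 ?exprn_ge0 ?subr_ge0//.
by rewrite mulr_ge0 ?exprn_ge0.
Qed.

Lemma sum_bernstein n x : \sum_(k < n.+1) bernstein n k x = 1.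
Proof.
transitivity ((1 - x + x) ^+ n); last by rewrite subrK expr1n.
rewrite exprDn; apply: eq_bigr => k _.
by rewrite /bernstein -mulr_natl; ring.
Qed.

Lemma sum_bernstein1 n x :
  \sum_(k < n.+1) k%:R * bernstein n k x = n%:R * x.
Proof.
case: n => [|n]; first by rewrite big_ord1 !mul0r.
rewrite big_ord_recl mul0r add0r -[RHS]mulr1 -[X in _ = _ * X](sum_bernstein n x).
rewrite mulr_sumr.
apply: eq_bigr => k _; rewrite /bernstein lift0 subSS exprS.
have /(congr1 (fun a => a%:R : R)) := mul_bin_diag n.+1 k.
rewrite !natrM /= => H.
rewrite [LHS](_ : _ = k.+1%:R * 'C(n.+1, k.+1)%:R * (x * x ^+ k * (1 - x) ^+ (n - k))); last by ring.
by rewrite -H; ring.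
Qed.

(** The factorial moment with [k (k - 1)] replaces the second moment: the binomial coefficient
    absorbs one factor [k], which leads back to the first moment for [n - 1]. *)
Lemma sum_bernstein2 n x :
  \sum_(k < n.+1) k%:R * (k%:R - 1) * bernstein n k x =
  n%:R * (n%:R - 1) * x ^+ 2.
Proof.
case: n => [|n]; first by rewrite big_ord1 !mul0r.
rewrite big_ord_recl !mul0r add0r -natr1 addrK.
rewrite (_ : _ * _ * _ = n.+1%:R * x * (n%:R * x)); last first.
  by rewrite -natr1; ring.
rewrite -(sum_bernstein1 n x) mulr_sumr.
apply: eq_bigr => k _; rewrite /bernstein lift0 subSS exprS -natr1 addrK.
have /(congr1 (fun a => a%:R : R)) := mul_bin_diag n.+1 k.
rewrite !natrM -!natr1 => /= H.
set c := 'C(n.+1, _)%:R in H *; rewrite [LHS](_ : _ = (k%:R + 1) * c * (k%:R * (x * x ^+ k) * (1 - x) ^+ (n - k))); last by ring.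
by rewrite -H; ring.
Qed.

(** The left side is the variance [x (1 - x) / n] of the mean of [n] Bernoulli variables with
    parameter [x]. *)
Lemma sum_bernstein_sqr n x : (0 < n)%N -> 0 <= x <= 1 ->
  \sum_(k < n.+1) (k%:R / n%:R - x) ^+ 2 * bernstein n k x <= n%:R^-1.
Proof.
move=> n0 /andP[x0 x1]; have n0' : n%:R != 0 :> R by rewrite pnatr_eq0 -lt0n.
rewrite (_ : \sum_(k < n.+1) _ = n%:R ^- 2 *
   (\sum_(k < n.+1) k%:R * (k%:R - 1) * bernstein n k x
   + (1 - 2 * n%:R * x) * (\sum_(k < n.+1) k%:R * bernstein n k x)
   + n%:R ^+ 2 * x ^+ 2 * \sum_(k < n.+1) bernstein n k x)); last first.
  rewrite !mulr_sumr -!big_split/= mulr_sumr; apply: eq_bigr => k _.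
  by field.
rewrite sum_bernstein2 sum_bernstein1 sum_bernstein.
rewrite (_ : _ * (_ + _ + _) = x * (1 - x) / n%:R); last by field.
rewrite -[leRHS]mul1r ler_wpM2r ?invr_ge0//; nra.
Qed.

(** Heine-Cantor in filter form: around each point one ball and all sufficiently small [de] work
    together, and compactness makes the range of [de] uniform. *)
Lemma uniform_continuity_itv (f : R -> R) (e : R) :
  {within `[0, 1], continuous f} -> 0 < e ->
  exists de : R, 0 < de /\ forall x y : R, 0 <= x <= 1 -> 0 <= y <= 1 ->
    `|x - y| < de -> `|f x - f y| <= e.
Proof.
move=> cf e0.
have := (compact_near_coveringP _).1 (@segment_compact R 0 1).
move=> /(_ R (nbhs (0 : R)^'+) (fun de x => x \in `[0, 1] ->
  forall y, y \in `[0, 1] -> `|x - y| < de -> `|f x - f y| <= e) _).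
have H x : `[0, 1]%classic x -> exists2 r : R, 0 < r &
    forall y, y \in `[0, 1] -> `|x - y| < r -> `|f x - f y| <= e / 2.
  move=> x01; have /subspace_continuousP/(_ x x01)/cvgrPdist_le := cf.
  have e20 : 0 < e / 2 by rewrite divr_gt0.
  move=> /(_ _ e20); rewrite near_withinE => -[r /= r0 xr].
  by exists r => // y y01 xy; exact: xr.
case.
  move=> x x01; have [r r0 xr] := H _ x01.
  exists (ball x (r / 2), [set d | 0 < d < r / 2]).
    split => /=; first by apply: nbhsx_ballx; rewrite divr_gt0.
    exists (r / 2); first by rewrite /= divr_gt0.
    by move=> d /=; rewrite sub0r normrN => dr d0; rewrite d0/= (le_lt_trans (ler_norm _)).
  move=> [x' d] /= [xx' /andP[d0 dr]] x'01 y y01 xy.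
  have h1 := xr _ x'01; have h2 := xr _ y01.
  have := ler_distD (f x) (f x') (f y).
  have := ler_distD x' x y.
  rewrite /ball /= in xx'.
  move=> h3 /le_trans; apply; rewrite (splitr e) lerD//.
    by rewrite distrC; apply: h1; apply: (lt_trans xx'); rewrite ltr_pdivrMr// ltr_pMr// ltr1n.
  apply: h2; apply: (le_lt_trans h3); rewrite (splitr r) ltrD//.
  exact: lt_trans xy dr.
move=> d /= d0 hd.
(* [hd] covers the radii strictly between 0 and [d], hence one half of [d]. *)
exists (d / 2); split; first by rewrite divr_gt0.
move=> x y x01 y01 xy; apply: (hd (d / 2)) => //=.
- by rewrite sub0r normrN gtr0_norm ?divr_gt0// ltr_pdivrMr// ltr_pMr// ltr1n.
- by rewrite divr_gt0.
Qed.

(** Bernstein's proof by Chebyshev's inequality: the weights [bernstein n k x] sum to 1 and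
    concentrate at nodes [k / n] near [x], where [f] varies little. *)
Lemma Weierstrass_approximation (f : R -> R) (e : R) :
  {within `[0, 1], continuous f} -> 0 < e ->
  exists p : {poly R}, forall x, 0 <= x <= 1 -> `|f x - p.[x]| <= e.
Proof.
move=> cf e0.
have [C [_ fC]] : bounded_set (f @` `[0, 1]).
  by apply: compact_bounded; apply: continuous_compact => //; exact: segment_compact.
pose B : R := `|C| + 1; have B0 : 0 < B by rewrite ltr_wpDl.
have fB x : 0 <= x <= 1 -> `|f x| <= B.
  move=> x01; apply: (fC B); last by exists x => //=; rewrite in_itv.
  by rewrite (le_lt_trans (ler_norm _))// ltrDl.
have [de [de0 fde]] : exists de : R, 0 < de /\ forall x y : R, 0 <= x <= 1 -> 0 <= y <= 1 ->
    `|x - y| < de -> `|f x - f y| <= e / 2.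
  by apply: uniform_continuity_itv => //; rewrite divr_gt0.
have [n [n0 nM]] : exists n, (0 < n)%N /\ 2 * B / de ^+ 2 / n%:R <= e / 2.
  pose a := 2 * B / de ^+ 2 / (e / 2).
  have a0 : 0 <= a.
    apply: divr_ge0; last by rewrite divr_ge0 ?(ltW e0).
    by apply: divr_ge0; [rewrite mulr_ge0 ?(ltW B0)|exact: sqr_ge0].
  have na := archi_boundP a0; exists (Num.bound a).+1; split => //.
  rewrite ler_pdivrMr ?ltr0n// -ler_pdivrMl ?divr_gt0// mulrC.
  by apply: (le_trans (ltW na)); rewrite ler_nat.
pose q k : {poly R} := 'C(n, k)%:R *: ('X ^+ k * (1 - 'X) ^+ (n - k)).
exists (\sum_(k < n.+1) f (k%:R / n%:R) *: q k) => x x01.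
have kn01 (k : 'I_n.+1) : 0 <= (k%:R / n%:R : R) <= 1.
  by rewrite divr_ge0//= ler_pdivrMr ?ltr0n// mul1r ler_nat -ltnS.
rewrite horner_sum (_ : \sum_(k < n.+1) _ =
  \sum_(k < n.+1) f (k%:R / n%:R) * bernstein n k x); last first.
  by apply: eq_bigr => k _; rewrite /q !hornerZ hornerM !horner_exp !hornerE /bernstein; ring.
rewrite -[f x]mulr1 -[X in f x * X](sum_bernstein n x) mulr_sumr -sumrB.
apply: (le_trans (ler_norm_sum _ _ _)).
(* Nodes closer than [de] contribute at most [e / 2]; at the others the difference is at most [2 B],
   and the squared distance divided by [de ^ 2] is at least 1. The sum of both bounds serves either
   case. *)
apply: (@le_trans _ _ (\sum_(k < n.+1) ((e / 2) * bernstein n k x +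
   2 * B / de ^+ 2 * ((k%:R / n%:R - x) ^+ 2 * bernstein n k x)))).
  apply: ler_sum => k _; rewrite -mulrBl normrM (ger0_norm (bernstein_ge0 _ _ x01)).
  rewrite [_ * (_ * bernstein _ _ _)]mulrA -mulrDl ler_wpM2r ?bernstein_ge0//.
  have [xk|kx] := ltP `|x - k%:R / n%:R| de.
    rewrite -[leLHS]addr0 lerD ?fde// mulr_ge0 ?sqr_ge0// divr_ge0 ?sqr_ge0//.
    by rewrite mulr_ge0// ltW.
  apply: (@le_trans _ _ (2 * B)).
    apply: (le_trans (ler_normB _ _)); have := fB _ x01; have := fB _ (kn01 k); lra.
  rewrite -[leLHS]add0r lerD ?divr_ge0 ?(ltW e0)//.
  rewrite mulrAC ler_pdivlMr ?exprn_gt0// ler_wpM2l ?mulr_ge0 ?(ltW B0)//.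
  rewrite -[leRHS]real_normK ?num_real// distrC lerXn2r ?nnegrE ?normr_ge0 ?(ltW de0)//.
rewrite big_split/= -!mulr_sumr sum_bernstein mulr1 [leRHS](splitr e) lerD2l.
apply: le_trans nM; rewrite ler_wpM2l ?sum_bernstein_sqr//.
by rewrite divr_ge0 ?sqr_ge0// mulr_ge0 ?(ltW B0).
Qed.

End Bernstein.

(** * The modified Hilbert transformation *)

Section trigonometric_integrals.
Variable R : realType.
Local Notation mu := (@lebesgue_measure R).

Lemma Rintegral_FTC (f F : R -> R) (a b : R) : a < b -> continuous f ->
  (forall x : R, is_derive x 1 F (f x)) ->
  \int[mu]_(x in `[a, b]) f x = F b - F a.
Proof.
move=> ab cf dF; rewrite /Rintegral (@continuous_FTC2 _ f F)//.
- exact: continuous_subspaceT.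
- have cF : continuous F.
    move=> x; apply: differentiable_continuous; apply/derivable1_diffP.
    by have [] := dF x.
  split => [x _||].
  + by have [] := dF x.
  + exact/cvg_at_right_filter/cF.
  + exact/cvg_at_left_filter/cF.
- by move=> x _; rewrite derive1E; have [_ ->] := dF x.
Qed.

Lemma Rintegral_FTC_oo (f F : R -> R) (a b : R) : a < b -> continuous f ->
  (forall x : R, is_derive x 1 F (f x)) ->
  \int[mu]_(x in `]a, b[) f x = F b - F a.
Proof.
move=> ab cf dF; rewrite -(Rintegral_FTC ab cf dF).
have icc : mu.-integrable `[a, b] (EFin \o f).
  apply: continuous_compact_integrable; first exact: segment_compact.
  exact: continuous_subspaceT.
have sub (x y : bool) : [set` Interval (BSide x a) (BSide y b)] `<=` `[a, b].
  by case: x; case: y => z /=; rewrite !in_itv/= => /andP[az zb];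
    rewrite ?az ?zb ?(ltW az) ?(ltW zb).
rewrite Rintegral_itv_bndo_bndc ?Rintegral_itv_obnd_cbnd//;
  by apply: integrableS icc => //; exact: sub.
Qed.

Lemma continuous_cosZ (a : R) : continuous (fun s => cos (a * s)).
Proof.
move=> s; apply: continuous_comp; last exact: continuous_cos.
by apply: cvgM; [exact: cvg_cst|exact: cvg_id].
Qed.

Lemma continuous_sinZ (a : R) : continuous (fun s => sin (a * s)).
Proof.
move=> s; apply: continuous_comp; last exact: continuous_sin.
by apply: cvgM; [exact: cvg_cst|exact: cvg_id].
Qed.

Lemma sin_npi n : sin (n%:R * pi) = 0 :> R.
Proof.
elim: n => [|n IH]; first by rewrite mul0r sin0.
by rewrite -natr1 mulrDl mul1r sinDpi IH oppr0.
Qed.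

Lemma cos_npi n : cos (n%:R * pi) = (-1) ^+ n :> R.
Proof.
elim: n => [|n IH]; first by rewrite mul0r cos0.
by rewrite -natr1 mulrDl mul1r cosDpi IH exprS mulN1r.
Qed.

Lemma integral_cosZ (T : R) n : 0 < T ->
  \int[mu]_(s in `]0, T[) cos (n%:R * pi / T * s) = if n == 0%N then T else 0.
Proof.
move=> T0; have cc := @continuous_cosZ (n%:R * pi / T); case: n cc => [|n] cc /=.
  have D (x : R) : is_derive x 1 id (cos (0%:R * pi / T * x)).
    by rewrite !mul0r cos0; exact: is_derive_id.
  by rewrite (Rintegral_FTC_oo T0 cc D) subr0.
have a0 : n.+1%:R * pi / T != 0 :> R.
  by rewrite !mulf_neq0 ?invr_eq0 ?pnatr_eq0 ?gt_eqF// pi_gt0.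
pose F s := (n.+1%:R * pi / T)^-1 * sin (n.+1%:R * pi / T * s).
have D (x : R) : is_derive x 1 F (cos (n.+1%:R * pi / T * x)).
  rewrite /F; set a := _ / T in a0 *; apply: is_derive_eq.
  by rewrite /GRing.scale/= !(mulr1, mulr0, addr0); field.
rewrite (Rintegral_FTC_oo T0 cc D) /F.
by rewrite mulr0 sin0 mulr0 subr0 divfK ?gt_eqF// sin_npi mulr0.
Qed.

Lemma integral_sinZ (T : R) n : 0 < T ->
  \int[mu]_(s in `]0, T[) sin (n.+1%:R * pi / T * s) =
  T / pi * ((1 - (-1) ^+ n.+1) / n.+1%:R).
Proof.
move=> T0.
have n0 : n.+1%:R != 0 :> R by rewrite pnatr_eq0.
have pi0 : pi != 0 :> R by rewrite gt_eqF// pi_gt0.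
have T0' : T != 0 by rewrite gt_eqF.
have a0 : n.+1%:R * pi / T != 0 :> R by rewrite !mulf_neq0 ?invr_eq0.
rewrite [RHS](_ : _ = (n.+1%:R * pi / T)^-1 * (1 - (-1) ^+ n.+1)); last first.
  by rewrite !invfM invrK; ring.
pose F s := - (n.+1%:R * pi / T)^-1 * cos (n.+1%:R * pi / T * s).
have D (x : R) : is_derive x 1 F (sin (n.+1%:R * pi / T * x)).
  rewrite /F; set a := _ / T in a0 *; apply: is_derive_eq.
  by rewrite /GRing.scale/= !(mulr1, mulr0, addr0); field.
rewrite (Rintegral_FTC_oo T0 (@continuous_sinZ _) D) /F.
by rewrite mulr0 cos0 divfK// cos_npi; ring.
Qed.

Lemma integral_expr n :
  \int[mu]_(x in `[-1, 1]) (x ^+ n) = (1 - (-1) ^+ n.+1) / n.+1%:R.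
Proof.
have n0 : n.+1%:R != 0 :> R by rewrite pnatr_eq0.
pose F (x : R) := n.+1%:R^-1 * x ^+ n.+1.
have D (x : R) : is_derive x 1 F (x ^+ n).
  have -> : F = n.+1%:R^-1 *: (@id R ^+ n.+1).
    by apply/funext => y; rewrite /F ?fctE /= ?exprfctE.
  apply: is_derive_eq.
  by rewrite /GRing.scale/= mulr1 mulKf.
have ab : -1 < 1 :> R by rewrite gtrN.
rewrite (Rintegral_FTC ab (@exprn_continuous _ n) D) /F expr1n; ring.
Qed.

End trigonometric_integrals.

(** * Orthogonality of the half-integer sines and cosines *)

Section sine_cosine_systems.
Variables (R : realType) (T : R).
Hypothesis T0 : 0 < T.
Local Notation mu := (@lebesgue_measure R).
Local Notation D := `]0, T[%classic.
Local Notation L2 := (L2 mu D).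
Local Notation dot := (dot_L2 mu D).
Local Notation dist2 := (dist2 mu D).

Definition sink (k : nat) (s : R) : R := sin (freq T k * s).
Definition cosk (k : nat) (s : R) : R := cos (freq T k * s).

Lemma measure_time_lty : (mu D < +oo)%E.
Proof. by rewrite lebesgue_measure_itv/= lte_fin T0 oppr0 adde0 ltry. Qed.

Lemma L2_sink k : L2 (sink k).
Proof.
apply: (@L2_bounded _ _ _ _ _ _ 1) => //; first exact: measure_time_lty.
  apply: measurable_funTS; exact: continuous_measurable_fun (@continuous_sinZ R (freq T k)).
by move=> s _; exact: sin_max.
Qed.

Lemma L2_cosk k : L2 (cosk k).
Proof.
apply: (@L2_bounded _ _ _ _ _ _ 1) => //; first exact: measure_time_lty.
  apply: measurable_funTS; exact: continuous_measurable_fun (@continuous_cosZ R (freq T k)).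
by move=> s _; exact: cos_max.
Qed.

Let integrable_cosZ (a : R) : mu.-integrable D (EFin \o (fun s => cos (a * s))).
Proof.
apply: measurable_bounded_integrable => //; first exact: measure_time_lty.
  by apply: measurable_funTS; exact: continuous_measurable_fun (@continuous_cosZ R a).
by exists 1; split; [exact: num_real|move=> x x1 y _ /=; rewrite (le_trans (cos_max _))// ltW].
Qed.

Let integrable_halfcosZ (a : R) :
  mu.-integrable D (EFin \o (fun s => 2^-1 * cos (a * s))).
Proof. exact: (integrableZl _ 2^-1 (integrable_cosZ a)). Qed.

Let freqE k : freq T k = (k%:R + 2^-1) * pi / T.
Proof. by rewrite /freq; field; rewrite gt_eqF. Qed.

(** The frequencies are half-odd multiples of [pi / T], so their sums and differences are integer
    multiples, whose cosines integrate to zero unless the multiple is zero. Ordering [j] and [k]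
    keeps the difference a natural number. *)
Lemma dot_sink j k : dot (sink j) (sink k) = if j == k then T / 2 else 0.
Proof.
wlog jk : j k / (j <= k)%N.
  move=> H; case: (leqP j k) => [/H//|/ltnW kj]; rewrite dotC H//.
  by rewrite eq_sym.
rewrite /dot_L2 [LHS](_ : _ = \int[mu]_(s in D) (2^-1 * cos ((k - j)%:R * pi / T * s)
    - 2^-1 * cos ((j + k).+1%:R * pi / T * s))); last first.
  apply: eq_Rintegral => s _; rewrite /sink !freqE.
  rewrite (_ : (k - j)%:R * pi / T * s = (k%:R + 2^-1) * pi / T * s - (j%:R + 2^-1) * pi / T * s); last first.
    by rewrite natrB//; ring.
  rewrite (_ : (j + k).+1%:R * pi / T * s = (k%:R + 2^-1) * pi / T * s + (j%:R + 2^-1) * pi / T * s); last first.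
    by rewrite -natr1 natrD; field; rewrite gt_eqF.
  by rewrite cosB cosD; field.
rewrite RintegralB//; try exact: integrable_halfcosZ.
rewrite !RintegralZl//; try exact: integrable_cosZ.
rewrite !integral_cosZ//= mulr0 subr0 subn_eq0.
case: (eqVneq j k) => [->|njk]; first by rewrite leqnn mulrC.
by rewrite leqNgt ltn_neqAle njk jk/= mulr0.
Qed.

Lemma dot_cosk j k : dot (cosk j) (cosk k) = if j == k then T / 2 else 0.
Proof.
wlog jk : j k / (j <= k)%N.
  move=> H; case: (leqP j k) => [/H//|/ltnW kj]; rewrite dotC H//.
  by rewrite eq_sym.
rewrite /dot_L2 [LHS](_ : _ = \int[mu]_(s in D) (2^-1 * cos ((k - j)%:R * pi / T * s)
    + 2^-1 * cos ((j + k).+1%:R * pi / T * s))); last first.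
  apply: eq_Rintegral => s _; rewrite /cosk !freqE.
  rewrite (_ : (k - j)%:R * pi / T * s = (k%:R + 2^-1) * pi / T * s - (j%:R + 2^-1) * pi / T * s); last first.
    by rewrite natrB//; ring.
  rewrite (_ : (j + k).+1%:R * pi / T * s = (k%:R + 2^-1) * pi / T * s + (j%:R + 2^-1) * pi / T * s); last first.
    by rewrite -natr1 natrD; field; rewrite gt_eqF.
  by rewrite cosB cosD; field.
rewrite RintegralD//; try exact: integrable_halfcosZ.
rewrite !RintegralZl//; try exact: integrable_cosZ.
rewrite !integral_cosZ//= mulr0 addr0 subn_eq0.
case: (eqVneq j k) => [->|njk]; first by rewrite leqnn mulrC.
by rewrite leqNgt ltn_neqAle njk jk/= mulr0.
Qed.

Local Notation powk := (fun (k : nat) (x : R) => x ^+ k).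

(* This identity turns the form [(v, H_T v)] into a squared norm of the power
   series with the coefficients of [v]. *)
Lemma dot_sink_cosk j k : dot (sink j) (cosk k) + dot (sink k) (cosk j) =
  T / pi * dot_L2 mu `[-1, 1] (powk j) (powk k).
Proof.
rewrite /dot_L2 -RintegralD//; first last.
- exact: (L2_mul_integrable _ (L2_sink k) (L2_cosk j)).
- exact: (L2_mul_integrable _ (L2_sink j) (L2_cosk k)).
under [in RHS]eq_Rintegral do rewrite -exprD.
rewrite integral_expr -integral_sinZ//; apply: eq_Rintegral => s _.
rewrite /sink /cosk !freqE.
rewrite (_ : (j + k).+1%:R * pi / T * s = (k%:R + 2^-1) * pi / T * s + (j%:R + 2^-1) * pi / T * s); last first.
  by rewrite -natr1 natrD; field; rewrite gt_eqF.
rewrite sinD; ring.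
Qed.

End sine_cosine_systems.

(** * Power sums with bounded coefficients *)

Section power_sums.
Variable R : realType.
Local Notation mu := (@lebesgue_measure R).
Local Notation D1 := `[-1, 1]%classic.

Definition pow_sum (c : nat -> R) (n : nat) (x : R) : R :=
  \sum_(k < n) c k * x ^+ k.

Lemma L2_pow k : L2 mu D1 (fun x : R => x ^+ k).
Proof.
have D1lty : (mu D1 < +oo)%E.
  by rewrite lebesgue_measure_itv/= lte_fin gtrN// -EFinB ltry.
apply: (L2_bounded (C := 1) _ D1lty) => // x; rewrite /= in_itv/= -ler_norml => x1.
by rewrite normrX exprn_ile1.
Qed.

Lemma L2_pow_sum c n : L2 mu D1 (pow_sum c n).
Proof. by apply: L2_sum => // k; apply: L2Z => //; exact: L2_pow. Qed.

Lemma sum_geometric_le2 (n : nat) (x : R) : 0 <= x <= 2^-1 ->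
  \sum_(k < n) x ^+ k <= 2.
Proof.
move=> /andP[x0 x1]; elim: n => [|n IH]; first by rewrite big_ord0.
rewrite big_ord_recl expr0 (_ : \sum_(i < n) _ = x * \sum_(k < n) x ^+ k).
  have := ler_wpM2l x0 IH; lra.
by rewrite mulr_sumr; apply: eq_bigr => i _; rewrite /= exprS.
Qed.

(* With [c i] the first nonzero coefficient, the term of degree [i] dominates
   the rest of the sum near [0], uniformly in the number of terms. *)
Lemma pow_sum_lower_bound (c : nat -> R) (M : R) (i : nat) :
  (forall k, `|c k| <= M) -> (forall k, (k < i)%N -> c k = 0) -> c i != 0 ->
  exists2 de : R, 0 < de <= 1 & forall n x, (i < n)%N -> 0 <= x <= de ->
    `|c i| / 2 * x ^+ i <= `|pow_sum c n x|.
Proof.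
move=> cM c0 ci; have ci0 : 0 < `|c i| by rewrite normr_gt0.
have M0 : 0 < M by exact: lt_le_trans ci0 (cM i).
(* Chosen so that the tail [x * r] stays below one half of [c i] in absolute value: [de <= 1/2]
   bounds the geometric sum by 2, hence [r] by [2 M], and [de * 2 M] is exactly that half. *)
pose de := `|c i| / (4 * M); exists de.
  rewrite divr_gt0 ?mulr_gt0//= ler_pdivrMr ?mulr_gt0//.
  by have := cM i; lra.
have de2 : de <= 2^-1.
  rewrite ler_pdivrMr ?mulr_gt0//; have := cM i; lra.
move=> n x ni /andP[x0 xde].
have -> : pow_sum c n x = x ^+ i * (c i + x * \sum_(k < n - i.+1) c (i.+1 + k)%N * x ^+ k).
  rewrite /pow_sum -(subnKC ni) big_split_ord/= big_ord_recr/= big1 ?add0r; last first.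
    by move=> k _; rewrite c0 ?mul0r.
  rewrite mulrDr (mulrC (c i)); congr (_ + _).
  rewrite addKn !mulr_sumr; apply: eq_bigr => k _; rewrite exprD exprS; ring.
rewrite normrM ger0_norm ?exprn_ge0// mulrC ler_wpM2l ?exprn_ge0//.
set r := \sum_(k < _) _.
have rM : `|r| <= M * 2.
  apply: (le_trans (ler_norm_sum _ _ _)).
  apply: (@le_trans _ _ (M * \sum_(k < n - i.+1) x ^+ k)).
    rewrite mulr_sumr; apply: ler_sum => k _.
    by rewrite normrM (ger0_norm (exprn_ge0 _ x0)) ler_wpM2r ?exprn_ge0.
  by rewrite ler_wpM2l ?(ltW M0)// sum_geometric_le2// x0 (le_trans xde).
have xr : `|x * r| <= `|c i| / 2.
  rewrite normrM (ger0_norm x0) (_ : _ / 2 = de * (M * 2)).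
    by rewrite ler_pM.
  by rewrite /de; field; rewrite gt_eqF.
have := lerB_dist (c i) (- (x * r)); rewrite normrN opprK; lra.
Qed.

(** The bound [eta] must not depend on [n], since it has to survive the limit of the partial
    sums. *)
Lemma dot_pow_sum_lower_bound (c : nat -> R) (M : R) (i : nat) :
  (forall k, `|c k| <= M) -> (forall k, (k < i)%N -> c k = 0) -> c i != 0 ->
  exists2 eta : R, 0 < eta & forall n, (i < n)%N ->
    eta <= dot_L2 mu D1 (pow_sum c n) (pow_sum c n).
Proof.
move=> cM c0 ci; have [de /andP[de0 de1] H] := pow_sum_lower_bound cM c0 ci.
(* The value of the lower bound at [de / 2], hence valid on the whole interval from [de / 2] to
   [de], whose length is [de / 2]. *)
pose a := `|c i| / 2 * (de / 2) ^+ i.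
have a0 : 0 < a by rewrite mulr_gt0 ?exprn_gt0 ?divr_gt0 ?normr_gt0.
exists (a ^+ 2 * (de / 2)); first by rewrite mulr_gt0 ?exprn_gt0// divr_gt0.
move=> n ni; have P2 := L2_pow_sum c n.
have sub : (`[de / 2, de] : set R) `<=` D1.
  move=> x /=; rewrite !in_itv/= => /andP[x1 x2]; apply/andP; split; lra.
pose I : set R := `[de / 2, de]%classic.
have mI : measurable I by exact: measurable_itv.
have muI : mu I = (de / 2)%:E.
  rewrite lebesgue_measure_itv/= lte_fin -EFinB ifT; last by lra.
  by congr EFin; lra.
rewrite -lee_fin -(integral_sqr_dot _ P2)//.
have muH : ((a ^+ 2 * (de / 2))%:E <=
    \int[mu]_(x in I) ((pow_sum c n x) ^+ 2)%:E)%E.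
  have -> : ((a ^+ 2 * (de / 2))%:E = \int[mu]_(x in I) (a ^+ 2)%:E)%E.
    by rewrite integral_cst//= muI.
  apply: (@ge0_le_integral _ _ _ mu I _ (fun=> (a ^+ 2)%:E)
            (fun x => (pow_sum c n x ^+ 2)%:E)) => //.
  - by move=> x _; rewrite lee_fin sqr_ge0.
  - apply/measurable_EFinP; apply: measurable_funX.
    exact: (measurable_funS _ sub P2.1).
  - move=> x; rewrite /I /= in_itv/= => /andP[x1 x2]; rewrite lee_fin.
    rewrite -(real_normK (num_real (pow_sum _ _ _))) lerXn2r ?nnegrE ?(ltW a0)//.
    apply: le_trans (H _ _ ni _); last by lra.
    by rewrite ler_wpM2l ?divr_ge0// lerXn2r ?nnegrE//; lra.
apply: (le_trans muH); apply: ge0_subset_integral => //.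
- by apply/measurable_EFinP; apply: measurable_funX; exact: P2.1.
- by move=> x _; rewrite lee_fin sqr_ge0.
Qed.

End power_sums.

(** * Sine and cosine series with common coefficients *)

Section sine_series.
Variables (R : realType) (T : R).
Hypothesis T0 : 0 < T.
Local Notation mu := (@lebesgue_measure R).
Local Notation D := `]0, T[%classic.
Local Notation L2 := (L2 mu D).
Local Notation dot := (dot_L2 mu D).
Local Notation dist2 := (dist2 mu D).

Definition sin_sum (c : nat -> R) (n : nat) (s : R) : R :=
  \sum_(k < n) c k * sin (freq T k * s).
Definition cos_sum (c : nat -> R) (n : nat) (s : R) : R :=
  \sum_(k < n) c k * cos (freq T k * s).

Lemma L2_sin_sum c n : L2 (sin_sum c n).
Proof. by apply: L2_sum => // k; apply: L2Z => //; exact: L2_sink. Qed.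

Lemma L2_cos_sum c n : L2 (cos_sum c n).
Proof. by apply: L2_sum => // k; apply: L2Z => //; exact: L2_cosk. Qed.

Lemma dot_sum_diag (f : nat -> R -> R) (a : R) (c : nat -> R) n :
  (forall k, L2 (f k)) -> (forall j k, dot (f j) (f k) = if j == k then a else 0) ->
  dot (fun s => \sum_(k < n) c k * f k s) (fun s => \sum_(k < n) c k * f k s) =
  a * \sum_(k < n) c k ^+ 2.
Proof.
move=> f2 ff; rewrite dot_suml//; last by apply: L2_sum => // k; exact: L2Z.
rewrite mulr_sumr; apply: eq_bigr => j _; rewrite dot_sumr// (bigD1 j)//= big1.
  by rewrite ff eqxx; ring.
by move=> k kj; rewrite ff eq_sym (negbTE kj : (k : nat) == j = false) mulr0.
Qed.

Lemma dot_sin_sum c n :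
  dot (sin_sum c n) (sin_sum c n) = T / 2 * \sum_(k < n) c k ^+ 2.
Proof. exact: (dot_sum_diag c n (L2_sink T0) (dot_sink T0)). Qed.

Lemma dot_cos_sum c n :
  dot (cos_sum c n) (cos_sum c n) = T / 2 * \sum_(k < n) c k ^+ 2.
Proof. exact: (dot_sum_diag c n (L2_cosk T0) (dot_cosk T0)). Qed.

(** Mixed products of sines and cosines are not orthogonal, but only the symmetric part of the
    double sum counts, and [dot_sink_cosk] evaluates that part. Averaging over both orders halves
    the constant [T / pi]. *)
Lemma dot_sin_sum_cos_sum c n : dot (sin_sum c n) (cos_sum c n) =
  T / (2 * pi) * dot_L2 mu `[-1, 1] (pow_sum c n) (pow_sum c n).
Proof.
have S2 k := L2_sink T0 k; have C2 k := L2_cosk T0 k.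
pose A (j k : 'I_n) := c j * (c k * dot (sink T j) (cosk T k)).
have E : dot (sin_sum c n) (cos_sum c n) = \sum_j \sum_k A j k.
  transitivity (\sum_(j < n) c j * dot (sink T j) (cos_sum c n)).
    by apply: (dot_suml _ (index_enum 'I_n) (fun k => c k)) => [//|k|]; [exact: S2|exact: L2_cos_sum].
  apply: eq_bigr => j _; rewrite -mulr_sumr; congr (_ * _).
  by apply: (dot_sumr _ (index_enum 'I_n) (fun k => c k)) => [//|k|]; [exact: C2|exact: S2].
have E2 : \sum_j \sum_k A j k = 2^-1 * \sum_j \sum_k (A j k + A k j).
  under [in RHS]eq_bigr do rewrite big_split/=.
  by rewrite big_split/= [X in _ + X]exchange_big/=; field.
have p2 k := @L2_pow R k.
rewrite E E2 -[RHS]/(_ * dot_L2 mu `[-1, 1] (fun x => \sum_(k < n) c k * x ^+ k) _).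
rewrite (dot_suml _ (index_enum 'I_n) (fun k => c k) (fun k => p2 k))//; last exact: L2_pow_sum.
rewrite !mulr_sumr; apply: eq_bigr => j _.
rewrite (dot_sumr _ (index_enum 'I_n) (fun k => c k) (fun k => p2 k))//.
rewrite !mulr_sumr; apply: eq_bigr => k _.
have -> : A j k + A k j = c j * c k * (T / pi * dot_L2 mu `[-1, 1] (fun x => x ^+ j) (fun x => x ^+ k)).
  by rewrite -dot_sink_cosk// /A; ring.
have pi0 : pi != 0 :> R by rewrite gt_eqF// pi_gt0.
set z := (X in _ * (T / pi * X)); rewrite -[X in _ = _ * (_ * (_ * X))]/z.
by move: (pi : R) pi0 => p p0; field.
Qed.

Variables (v w : R -> R) (c : nat -> R).
Hypotheses (v2 : L2 v) (w2 : L2 w).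
Hypotheses (Sv : cvg_L2 mu D (sin_sum c) v) (Cw : cvg_L2 mu D (cos_sum c) w).

Let cvg_vw : dot (sin_sum c n) (cos_sum c n) @[n --> \oo] --> dot v w.
Proof. by apply: cvg_dot => // k; [exact: L2_sin_sum|exact: L2_cos_sum]. Qed.

Lemma dot_mhilbert_ge0 : 0 <= dot v w.
Proof.
rewrite -(cvg_lim _ cvg_vw)//; apply: limr_ge; first exact: cvgP cvg_vw.
apply: nearW => n; rewrite dot_sin_sum_cos_sum mulr_ge0 ?dot_ge0//.
by rewrite divr_ge0 ?mulr_ge0 ?pi_ge0 ?(ltW T0).
Qed.

(** By strong induction on the index every coefficient is zero: a first nonzero one would keep the
    approximating forms above a fixed positive number, while they tend to 0. *)
Lemma dot_mhilbert_eq0 : dot v w = 0 -> {ae mu, forall s, D s -> v s = 0}.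
Proof.
move=> vw0.
have [M cM] : exists M, forall k, `|c k| <= M.
  have H : dot (sin_sum c n) (sin_sum c n) @[n --> \oo] --> dot v v.
    by apply: cvg_dot => // k; exact: L2_sin_sum.
  have [B [_ /= HB]] := cvg_seq_bounded (cvgP _ H).
  pose K := (`|B| + 1) * (2 / T); exists (K + 1) => k.
  (* The squared norms of the sine sums converge, so they are bounded, and the one of length [k.+1]
     contains this term. *)
  have : T / 2 * c k ^+ 2 <= `|B| + 1.
    have := HB (`|B| + 1); rewrite (le_lt_trans (ler_norm _)) ?ltrDl// => /(_ isT k.+1 I).
    apply: le_trans; rewrite /= ger0_norm ?dot_ge0// dot_sin_sum ler_wpM2l//.
      by rewrite divr_ge0// ltW.
    by rewrite big_ord_recr/= lerDr sumr_ge0// => i _; rewrite sqr_ge0.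
  rewrite -ler_pdivlMl ?divr_gt0// invf_div mulrC -/K => cK.
  have := sqr_ge0 (`|c k| - 1); rewrite -(real_normK (num_real (c k))) in cK.
  have := normr_ge0 (c k); nra.
have c0 : forall k, c k = 0.
  elim/ltn_ind => i IH; apply/eqP/negPn/negP => ci.
  have [eta eta0 H] := dot_pow_sum_lower_bound cM IH ci.
  have a0 : 0 < T / (2 * pi) by rewrite divr_gt0// mulr_gt0// pi_gt0.
  suff : T / (2 * pi) * eta <= 0 by rewrite leNgt mulr_gt0.
  rewrite -vw0 -(cvg_lim _ cvg_vw)//; apply: limr_ge; first exact: cvgP cvg_vw.
  exists i.+1 => // n /= ni.
  by rewrite dot_sin_sum_cos_sum ler_wpM2l ?(ltW a0)// H.
have S0 n : sin_sum c n = (fun=> 0).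
  by apply/funext => s; rewrite /sin_sum big1// => k _; rewrite c0 mul0r.
apply: (dot_eq0 _ v2) => //.
have : dot (sin_sum c n) (sin_sum c n) @[n --> \oo] --> dot v v.
  by apply: cvg_dot => // k; exact: L2_sin_sum.
under eq_fun do rewrite S0 dot0l.
by move=> /cvg_lim <- //; rewrite lim_cst.
Qed.

End sine_series.

(** * Completeness of the sines in L^2(0, T) *)

Section completeness.
Variables (R : realType) (T : R).
Hypothesis T0 : 0 < T.
Local Notation mu := (@lebesgue_measure R).
Local Notation D := `]0, T[%classic.
Local Notation L2 := (L2 mu D).
Local Notation dot := (dot_L2 mu D).
Local Notation dist2 := (dist2 mu D).

Let mD : measurable (D : set (measurableTypeR R)). Proof. exact: measurable_itv. Qed.

Definition in_sine_span (f : R -> R) : Prop :=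
  exists n (c : nat -> R), f = sin_sum T c n.

Lemma in_sine_span0 : in_sine_span (fun=> 0).
Proof.
by exists 0%N, (fun=> 0); apply/funext => s; rewrite /sin_sum big_ord0.
Qed.

Lemma in_sine_span_sin k a : in_sine_span (fun s => a * sin (freq T k * s)).
Proof.
exists k.+1, (fun j => if j == k then a else 0); apply/funext => s.
rewrite /sin_sum big_ord_recr/= eqxx big1 ?add0r// => j _.
by rewrite ltn_eqF// mul0r.
Qed.

Lemma in_sine_spanD f g : in_sine_span f -> in_sine_span g ->
  in_sine_span (fun s => f s + g s).
Proof.
have widen n c N : (n <= N)%N ->
    sin_sum T c n = sin_sum T (fun k => if (k < n)%N then c k else 0) N.
  move=> nN; apply/funext => s; rewrite /sin_sum (big_ord_widen _ (fun k => c k * sin (freq T k * s)) nN).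
  by rewrite big_mkcond; apply: eq_bigr => k _; case: ifP; rewrite ?mul0r.
move=> [n [c ->]] [n' [c' ->]]; exists (n + n')%N.
rewrite (widen n c _ (leq_addr n' n)) (widen n' c' _ (leq_addl n n')).
exists (fun k => (if (k < n)%N then c k else 0) + if (k < n')%N then c' k else 0).
apply/funext => s; rewrite /sin_sum -big_split/=.
by apply: eq_bigr => k _; rewrite mulrDl.
Qed.

Lemma in_sine_spanZ a f : in_sine_span f -> in_sine_span (fun s => a * f s).
Proof.
move=> [n [c ->]]; exists n, (fun k => a * c k); apply/funext => s.
by rewrite /sin_sum mulr_sumr; apply: eq_bigr => k _; rewrite mulrA.
Qed.

Lemma in_sine_span_sum n (f : nat -> R -> R) : (forall k, in_sine_span (f k)) ->
  in_sine_span (fun s => \sum_(k < n) f k s).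
Proof.
move=> fV; elim: n => [|n IH].
  by have := in_sine_span0; congr in_sine_span; apply/funext => s; rewrite big_ord0.
have := in_sine_spanD IH (fV n); congr in_sine_span.
by apply/funext => s; rewrite big_ord_recr.
Qed.

(* Product-to-sum: [2 cos x sin ((k + 1/2) x)] is
   [sin ((k + 3/2) x) + sin ((k - 1/2) x)]. *)
Lemma in_sine_span_cos f : in_sine_span f ->
  in_sine_span (fun s => cos (pi / T * s) * f s).
Proof.
move=> [n [c ->]].
have -> : (fun s => cos (pi / T * s) * sin_sum T c n s) =
    (fun s => \sum_(k < n) (c k * (cos (pi / T * s) * sin (freq T k * s)))).
  apply/funext => s; rewrite mulr_sumr; apply: eq_bigr => k _; ring.
apply: (@in_sine_span_sum n
  (fun k s => c k * (cos (pi / T * s) * sin (freq T k * s)))) => k.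
apply: in_sine_spanZ.
have freqS j : freq T j.+1 = freq T j + pi / T.
  by rewrite /freq -natr1; field; rewrite gt_eqF.
have E s : cos (pi / T * s) * sin (freq T k * s) =
    2^-1 * sin (freq T k.+1 * s) + 2^-1 * sin ((freq T k - pi / T) * s).
  rewrite freqS (_ : (freq T k + pi / T) * s = freq T k * s + pi / T * s); last by ring.
  rewrite (_ : (freq T k - pi / T) * s = freq T k * s - pi / T * s); last by ring.
  by rewrite sinB sinD; field.
rewrite (_ : (fun s => _) = fun s => 2^-1 * sin (freq T k.+1 * s) +
    2^-1 * sin ((freq T k - pi / T) * s)); last by apply/funext => s; exact: E.
apply: in_sine_spanD; first exact: in_sine_span_sin.
(* For [k = 0] the lower frequency is the negative of the first one; oddness of the sine keeps the
   term in the span. *)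
case: k {E} => [|k].
  have := in_sine_span_sin 0 (- 2^-1); congr in_sine_span; apply/funext => s.
  rewrite (_ : (freq T 0 - pi / T) * s = - (freq T 0 * s)).
    by rewrite sinN mulrN mulNr.
  by rewrite /freq; field; rewrite gt_eqF.
by rewrite freqS addrK; exact: in_sine_span_sin.
Qed.

Lemma in_sine_span_poly (p : {poly R}) :
  in_sine_span (fun s => sin (freq T 0 * s) * p.[cos (pi / T * s)]).
Proof.
elim/poly_ind: p => [|p c IH].
  by have := in_sine_span0; congr in_sine_span; apply/funext => s; rewrite horner0 mulr0.
have := in_sine_spanD (in_sine_span_cos IH) (in_sine_span_sin 0 c).
congr in_sine_span; apply/funext => s; rewrite hornerMXaddC; ring.
Qed.

(** The substitution [u = (1 + cos (pi s / T)) / 2] is a homeomorphism from [0 <= s <= T] onto the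
    unit interval, so Weierstrass applies to [g] written in [u]. *)
Lemma cos_poly_approximation (g : R -> R) (e : R) : continuous g -> 0 < e ->
  exists p : {poly R}, forall s, 0 <= s <= T ->
    `|g s - p.[cos (pi / T * s)]| <= e.
Proof.
move=> cg e0.
pose F (u : R) := g (T / pi * acos (2 * u - 1)).
have cF : {within `[0, 1], continuous F}.
  apply/subspace_continuousP => x x01.
  have cacos : {within `[-1, 1], continuous (@acos R)}.
    have := @segment_can_ge_continuous R 0 pi cos acos (pi_ge0 R).
    rewrite cos0 cospi; apply.
      exact/continuous_subspaceT/continuous_cos.
    exact: cosK.
  apply: (@cvg_comp _ _ _ _ g _ (nbhs (T / pi * acos (2 * x - 1)))); last exact: cg.
  apply: cvgM; first exact: cvg_cst.
  move: x01; rewrite /= in_itv/= => /andP[x0 x1].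
  have H := (@subspace_continuousP _ _ _ _).1 cacos (2 * x - 1).
  apply: (@cvg_comp _ _ _ (fun u => 2 * u - 1) (@acos R) _
    (within `[-1, 1] (nbhs (2 * x - 1)))); last first.
    by apply: H; rewrite /= in_itv/=; apply/andP; split; lra.
  have aff : 2 * u - 1 @[u --> x] --> 2 * x - 1.
    by apply: cvgB; [apply: cvgM; [exact: cvg_cst|exact: cvg_id]|exact: cvg_cst].
  move=> A HA; have := aff _ HA; rewrite /within/=; apply: (@filterS _ (nbhs x)) => u h.
  by rewrite /= in_itv/= => /andP[u0 u1]; apply: h; rewrite /= in_itv/=; apply/andP; split; lra.
have [p pF] := Weierstrass_approximation cF e0.
exists (p \Po (2^-1%:P * ('X + 1%:P))) => s /andP[s0 sT].
rewrite horner_comp !hornerE.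
have x01 : 0 <= pi / T * s <= pi.
  rewrite mulr_ge0 ?divr_ge0 ?pi_ge0 ?(ltW T0)//=.
  by rewrite mulrAC ler_pdivrMr// ler_wpM2l ?pi_ge0.
set x := pi / T * s in x01 *.
have := pF (2^-1 * (cos x + 1)); rewrite /F.
rewrite (_ : 2 * (2^-1 * (cos x + 1)) - 1 = cos x); last by field.
rewrite cosK ?in_itv//= (_ : T / pi * x = s); last first.
  have pi0 : pi != 0 :> R by rewrite gt_eqF// pi_gt0.
  by rewrite /x; move: (pi : R) pi0 => q q0; field; rewrite gt_eqF// q0.
apply; have := cos_geN1 x; have := cos_le1 x; lra.
Qed.

Lemma dist2_le_of_bound (f g : R -> R) (e : R) : 0 <= e -> L2 f -> L2 g ->
  (forall s, D s -> `|f s - g s| <= e) -> dist2 f g <= e ^+ 2 * T.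
Proof.
move=> e0 f2 g2 fg.
rewrite -lee_fin -(integral_sqr_dist2 mD f2 g2).
apply: (@le_trans _ _ (\int[mu]_(s in D) (e ^+ 2)%:E)%E).
  apply: ge0_le_integral => //.
  - by move=> s _; rewrite lee_fin sqr_ge0.
  - by apply/measurable_EFinP; apply: measurable_funX; exact: (L2B mD f2 g2).1.
  - move=> s Ds; rewrite lee_fin -(real_normK (num_real (_ - _))).
    by rewrite lerXn2r ?nnegrE// fg.
by rewrite integral_cst//= lebesgue_measure_itv/= lte_fin T0 oppr0 adde0 EFinM.
Qed.

Definition sine_approximable (v : R -> R) : Prop :=
  forall e : R, 0 < e -> exists2 f, in_sine_span f & dist2 v f <= e.

Lemma sine_approximable_closed (v : R -> R) : L2 v ->
  (forall e : R, 0 < e -> exists u, [/\ L2 u, sine_approximable u & dist2 v u <= e]) ->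
  sine_approximable v.
Proof.
move=> v2 H e e0; have e4 : 0 < e / 4 by rewrite divr_gt0.
have [u [u2 ua vu]] := H _ e4; have [f [n [c fE]] uf] := ua _ e4.
exists f; first by exists n, c.
have f2 : L2 f by rewrite fE; exact: L2_sin_sum.
have := dist2_triangle mD v2 u2 f2; lra.
Qed.

Lemma L2_continuous (g : R -> R) : continuous g -> L2 g.
Proof.
move=> cg.
have [B [_ gB]] : bounded_set (g @` `[0, T]).
  apply: compact_bounded; apply: continuous_compact; last exact: segment_compact.
  exact: continuous_subspaceT.
apply: (L2_bounded (C := `|B| + 1) _ (measure_time_lty T0)) => //.
  by apply: measurable_funTS; exact: continuous_measurable_fun.
move=> s; rewrite /= in_itv/= => /andP[s0 sT]; apply: (gB (`|B| + 1)).
  by rewrite (le_lt_trans (ler_norm _))// ltrDl.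
by exists s => //=; rewrite in_itv/= !ltW.
Qed.

(** The sine factor carries polynomials in the cosine into the span ([in_sine_span_poly]); being
    bounded by 1, it does not enlarge the error. *)
Lemma sine_approximable_sinM (g : R -> R) : continuous g ->
  sine_approximable (fun s => sin (freq T 0 * s) * g s).
Proof.
move=> cg e e0.
(* Both bounds together give [de ^ 2 * T <= de * T <= e]. *)
pose de := Num.min 1 (e / T).
have de0 : 0 < de by rewrite lt_min ltr01 divr_gt0.
have [p gp] := cos_poly_approximation cg de0.
have [n [c E]] := in_sine_span_poly p.
exists (fun s => sin (freq T 0 * s) * p.[cos (pi / T * s)]); first by exists n, c.
have P2 : L2 (fun s => sin (freq T 0 * s) * p.[cos (pi / T * s)]).
  by rewrite E; exact: L2_sin_sum.
have G2 : L2 (fun s => sin (freq T 0 * s) * g s).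
  apply: (@L2_bounded_mul _ _ _ _ _ mD 1) => //.
  - by have [] := L2_sink T0 0.
  - by move=> s _; exact: sin_max.
  - exact: L2_continuous.
apply: (le_trans (dist2_le_of_bound (ltW de0) G2 P2 _)).
  move=> s; rewrite /= in_itv/= => /andP[s0 sT].
  rewrite -mulrBr normrM -[leRHS]mul1r ler_pM// ?sin_max// gp//.
  by rewrite !ltW.
have : de <= 1 by rewrite ge_min lexx.
have : de <= e / T by rewrite ge_min lexx orbT.
rewrite ler_pdivlMr// => H1 H2; apply: le_trans H1.
by rewrite ler_wpM2r ?(ltW T0)// expr2 ler_piMl ?(ltW de0).
Qed.

(** Continuous functions are dense in L^1. Truncating the approximant at the bound of [v] makes the
    error at most [2 * B1], so its square is at most [2 * B1] times the L^1 error. *)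
Lemma continuous_approximation (v : R -> R) (B e : R) : measurable_fun D v ->
  (forall s, D s -> `|v s| <= B) -> 0 < e ->
  exists2 g, continuous g & dist2 v g <= e.
Proof.
move=> mv vB e0; pose B1 := `|B| + 1; have B10 : 0 < B1 by rewrite ltr_wpDl.
have vB1 s : D s -> `|v s| <= B1.
  by move=> /vB /le_trans; apply; rewrite (le_trans (ler_norm _))// lerDl.
have v2 : L2 v by exact: (L2_bounded mD (measure_time_lty T0) mv vB1).
have iv : mu.-integrable D (EFin \o v).
  apply: measurable_bounded_integrable => //; first exact: measure_time_lty.
  by exists B1; split; [exact: num_real|move=> x x1 y Dy /=; rewrite (le_trans (vB1 _ Dy))// ltW].
have [g_ [cg ig gv]] := approximation_continuous_integrable mD (measure_time_lty T0) iv.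
have eB : 0 < e / (2 * B1) by rewrite divr_gt0// mulr_gt0.
have [n nP] : exists n, (\int[mu]_(s in D) `|(v s - g_ n s)%:E| <= (e / (2 * B1))%:E)%E.
  move/fine_cvgP : gv => [fin /cvgr0Pnorm_le/(_ _ eB) H].
  near \oo => n; exists n; rewrite -[leLHS]fineK; last by near: n.
  rewrite lee_fin (le_trans (ler_norm _))//; near: n; exact: H.
(* Truncation to the interval from [-B1] to [B1], written with absolute values so that it inherits
   continuity and the Lipschitz constant 1 from them. *)
pose clip (x : R) := (`|x + B1| - `|x - B1|) / 2.
have clipE x : `|x| <= B1 -> clip x = x.
  rewrite ler_norml => /andP[x1 x2]; rewrite /clip ger0_norm; last by lra.
  by rewrite ler0_norm; [field|lra].
have clip_le x : `|clip x| <= B1.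
  rewrite /clip normrM (ger0_norm (_ : 0 <= 2^-1))// ler_pdivrMr//.
  apply: (le_trans (ler_dist_dist _ _)).
  rewrite (_ : x + B1 - (x - B1) = B1 * 2); last by ring.
  by rewrite ger0_norm// mulr_ge0 ?(ltW B10).
have clip_lip x y : `|clip x - clip y| <= `|x - y|.
  have := ler_dist_dist (x + B1) (y + B1); have := ler_dist_dist (x - B1) (y - B1).
  rewrite (_ : x - B1 - (y - B1) = x - y); last by ring.
  rewrite (_ : x + B1 - (y + B1) = x - y); last by ring.
  rewrite /clip !ler_norml => /andP[h1 h2] /andP[h3 h4]; apply/andP; split; lra.
have cclip : continuous (fun s => clip (g_ n s)).
  move=> s; rewrite /clip; apply: cvgM; last exact: cvg_cst.
  by apply: cvgB; apply: cvg_norm; [apply: cvgD|apply: cvgB]; rewrite //; [exact: cg|exact: cvg_cst|exact: cg|exact: cvg_cst].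
have mvg : measurable_fun D (fun s => `|(v s - g_ n s)%:E|%E).
  apply: measurableT_comp => //; apply/measurable_EFinP; apply: measurable_funB => //.
  by apply: measurable_funTS; exact: continuous_measurable_fun (cg n).
exists (fun s => clip (g_ n s)) => //.
have c2 := L2_continuous cclip.
rewrite -lee_fin -(integral_sqr_dist2 mD v2 c2).
apply: (@le_trans _ _ (\int[mu]_(s in D) ((2 * B1)%:E * `|(v s - g_ n s)%:E|))%E).
  apply: ge0_le_integral => //.
  - by move=> s _; rewrite lee_fin sqr_ge0.
  - by apply/measurable_EFinP; apply: measurable_funX; exact: (L2B mD v2 c2).1.
  - exact: measurable_funeM.
  - move=> s Ds; rewrite abse_EFin -EFinM lee_fin -(real_normK (num_real (_ - _))) expr2.
    rewrite ler_pM//.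
      by apply: (le_trans (ler_normB _ _)); have := clip_le (g_ n s); have := vB1 _ Ds; lra.
    by rewrite -{1}(clipE (v s)) ?vB1.
rewrite ge0_integralZl//; last by rewrite lee_fin ltW// mulr_gt0.
apply: (@le_trans _ _ ((2 * B1)%:E * (e / (2 * B1))%:E)%E).
  by rewrite lee_wpmul2l// lee_fin ltW// mulr_gt0.
by rewrite -EFinM lee_fin mulrC divfK// gt_eqF// mulr_gt0.
Unshelve. all: by end_near. Qed.

(** Dividing [v] by the first sine, which is positive on [D], reduces the claim to
    [sine_approximable_sinM]. *)
Lemma sine_approximable_bounded (v : R -> R) (B : R) : measurable_fun D v ->
  (forall s, D s -> `|v s| <= B) -> sine_approximable v.
Proof.
move=> mv vB; pose sn s : R := sin (freq T 0 * s).
have sn0 s : D s -> 0 < sn s.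
  rewrite /= in_itv/= => /andP[s0 sT]; apply: sin_gt0_pi; rewrite /freq mul0r addr0.
  rewrite mulr_gt0 ?divr_gt0 ?pi_gt0//=.
  rewrite mulrAC ltr_pdivrMr// -subr_gt0 (_ : _ - _ = pi * (T - s / 2)); last by field.
  by rewrite mulr_gt0 ?pi_gt0//; lra.
have msn : measurable_fun D sn by have [] := L2_sink T0 0.
have v2 : L2 v by exact: (L2_bounded mD (measure_time_lty T0) mv vB).
pose de (n : nat) : R := n.+1%:R^-1; have de0 n : 0 < de n by rewrite invr_gt0.
(* The shift [de n] keeps the quotient bounded near [s = 0]; it is removed by dominated convergence,
   since [sn * h n] tends to [v] with errors at most [B]. *)
pose h n s := (sn s + de n)^-1 * v s.
have mh n : measurable_fun D (h n).
  apply: measurable_funM => //.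
  apply: open_continuous_measurable_fun; first exact: interval_open.
  move=> s /set_mem Ds; apply: cvgV; first by rewrite gt_eqF ?addr_gt0 ?sn0.
  by apply: cvgD; [exact: continuous_sinZ|exact: cvg_cst].
have snde n s : D s -> 0 < sn s + de n by move=> /sn0 ?; rewrite addr_gt0.
have hB n s : D s -> `|h n s| <= n.+1%:R * B.
  move=> Ds; rewrite /h normrM ler_pM ?vB// gtr0_norm ?invr_gt0 ?snde//.
  by rewrite -[leRHS]invrK lef_pV2 ?posrE ?snde// lerDr ltW ?sn0.
pose u n s := sn s * h n s.
have u2 n : L2 (u n).
  apply: (L2_bounded_mul mD msn (C := 1)) => [s _|]; first exact: sin_max.
  exact: (L2_bounded mD (measure_time_lty T0) (mh n) (hB n)).
apply: sine_approximable_closed => // e e0; have e4 : 0 < e / 4 by rewrite divr_gt0.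
have [n vun] : exists n, dist2 v (u n) <= e / 4.
  have vuE n s : D s -> v s - u n s = v s * (de n * (sn s + de n)^-1).
    by move=> Ds; rewrite /u /h; field; rewrite gt_eqF ?snde.
  have vuB n s : D s -> `|v s - u n s| <= B.
    move=> Ds; rewrite vuE// normrM -[leRHS]mulr1 ler_pM ?vB//.
    rewrite ger0_norm ?mulr_ge0 ?invr_ge0 ?(ltW (snde _ _ Ds)) ?(ltW (de0 n))//.
    by rewrite ler_pdivrMr ?snde// mul1r lerDr ltW ?sn0.
  have uv s : D s -> u n s @[n --> \oo] --> v s.
    move=> Ds; have dcvg : de n @[n --> \oo] --> (0 : R) by exact: cvg_harmonic.
    rewrite (_ : v s = sn s * ((sn s + 0)^-1 * v s)); last first.
      by rewrite addr0; field; rewrite gt_eqF ?sn0.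
    apply: cvgM; first exact: cvg_cst.
    apply: cvgM; last exact: cvg_cst.
    apply: cvgV; first by rewrite addr0 gt_eqF ?sn0.
    by apply: cvgD => //; exact: cvg_cst.
  have /cvgr0Pnorm_le/(_ _ e4) :=
    bounded_cvg_dist2 mD (measure_time_lty T0) v2 u2 vuB uv.
  by move=> [n _ /(_ n (leqnn n))] /=; rewrite ger0_norm ?dist2_ge0//; exists n.
have [g cg hg] := continuous_approximation (mh n) (hB n) e4.
exists (fun s => sn s * g s).
have g2 : L2 (fun s => sn s * g s).
  by apply: (L2_bounded_mul mD msn (C := 1)) => [s _|]; [exact: sin_max|exact: L2_continuous].
split => //; first exact: sine_approximable_sinM.
have ug : dist2 (u n) (fun s => sn s * g s) <= dist2 (h n) g.
  apply: (dot_le_dot mD) => //.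
  - exact: L2B.
  - apply: L2B => //; last exact: L2_continuous.
    exact: (L2_bounded mD (measure_time_lty T0) (mh n) (hB n)).
  - by move=> s _; rewrite -mulrBr normrM ler_piMl// sin_max.
apply: (le_trans (dist2_triangle mD v2 (u2 n) g2)).
rewrite [leRHS](_ : e = 2 * (e / 4) + 2 * (e / 4)); last by field.
by rewrite lerD ?ler_wpM2l// (le_trans ug).
Qed.

Definition sine_coef (v : R -> R) (k : nat) : R := 2 / T * dot v (sink T k).

(** Completing the square: only the last sum depends on [a], so the Fourier coefficients give the
    best approximation of each length, and more terms only improve it. *)
Lemma dist2_sin_sum (v : R -> R) (a : nat -> R) n : L2 v ->
  dist2 v (sin_sum T a n) = dot v v - T / 2 * \sum_(k < n) sine_coef v k ^+ 2
    + T / 2 * \sum_(k < n) (a k - sine_coef v k) ^+ 2.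
Proof.
move=> v2; have S2 := L2_sin_sum T0 a n.
rewrite dist2E//.
have -> : dot v (sin_sum T a n) = T / 2 * \sum_(k < n) a k * sine_coef v k.
  rewrite mulr_sumr; transitivity (\sum_(k < n) a k * dot v (sink T k)).
    by apply: (dot_sumr _ (index_enum 'I_n) (fun k => a k)) => [//|k|//]; exact: L2_sink.
  by apply: eq_bigr => k _; rewrite /sine_coef; field; rewrite gt_eqF.
rewrite dot_sin_sum//.
have -> : \sum_(k < n) (a k - sine_coef v k) ^+ 2 = \sum_(k < n) a k ^+ 2
    - 2 * (\sum_(k < n) a k * sine_coef v k) + \sum_(k < n) sine_coef v k ^+ 2.
  rewrite mulr_sumr -sumrB -big_split/=; apply: eq_bigr => k _; ring.
by field.
Qed.

Lemma sine_series_cvg (v : R -> R) : L2 v -> sine_approximable v ->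
  cvg_L2 mu D (sin_sum T (sine_coef v)) v.
Proof.
move=> v2 va; apply/(cvg_L2P mD (fun k => L2_sin_sum T0 _ k) v2).
apply/cvgr0Pnorm_le => e e0; have [f [n [a ->]] ve] := va _ e0.
exists n => // N /= nN; rewrite ger0_norm ?dist2_ge0// dist2C; apply: le_trans ve.
rewrite !dist2_sin_sum// -!addrA lerD2l.
have -> : \sum_(k < N) (sine_coef v k - sine_coef v k) ^+ 2 = 0.
  by rewrite big1// => k _; rewrite subrr expr0n.
have T2 : 0 < T / 2 by rewrite divr_gt0.
rewrite mulr0 addr0 -[leLHS]addr0 lerD//; last first.
  by rewrite mulr_ge0 ?(ltW T2)// sumr_ge0// => k _; rewrite sqr_ge0.
rewrite lerN2 ler_wpM2l ?(ltW T2)// -(subnKC nN) big_split_ord/= lerDl.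
by rewrite sumr_ge0// => k _; rewrite sqr_ge0.
Qed.

(** Sines and cosines have the same Gram matrix, so the cosine sums are Cauchy as soon as the sine
    sums are. *)
Lemma dist2_cos_sum (c : nat -> R) p q :
  dist2 (cos_sum T c p) (cos_sum T c q) = dist2 (sin_sum T c p) (sin_sum T c q).
Proof.
wlog pq : p q / (p <= q)%N.
  by move=> H; case: (leqP p q) => [/H//|/ltnW/H]; rewrite dist2C => ->; rewrite dist2C.
pose c' k := if (k < p)%N then 0 else c k.
have E (f : nat -> R -> R) s : \sum_(k < q) c k * f k s - \sum_(k < p) c k * f k s =
    \sum_(k < q) c' k * f k s.
  rewrite -(subnKC pq) !big_split_ord/= addrAC subrr add0r.
  rewrite [X in _ = X + _]big1 ?add0r.
    by apply: eq_bigr => k _; rewrite /c' ltnNge leq_addr.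
  by move=> k _; rewrite /c' ltn_ord mul0r.
rewrite dist2C [RHS]dist2C.
transitivity (dot (cos_sum T c' q) (cos_sum T c' q)).
  by apply: eq_Rintegral => s _; rewrite /cos_sum -(E (fun k s => cos (freq T k * s))).
rewrite dot_cos_sum// -dot_sin_sum//.
by apply: eq_Rintegral => s _; rewrite /sin_sum -(E (fun k s => sin (freq T k * s))).
Qed.

Lemma cos_series_cvg (v : R -> R) (c : nat -> R) : L2 v ->
  cvg_L2 mu D (sin_sum T c) v ->
  exists w, L2 w /\ cvg_L2 mu D (cos_sum T c) w.
Proof.
move=> v2 /(cvg_L2P mD (fun k => L2_sin_sum T0 _ k) v2) Sv.
apply: L2_complete => //; first by move=> k; exact: L2_cos_sum.
move=> e e0; have e4 : 0 < e / 4 by rewrite divr_gt0.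
move/cvgr0Pnorm_le : Sv => /(_ _ e4)[N _ HN]; exists N => p q Np Nq.
rewrite dist2_cos_sum.
have := HN _ Np; have := HN _ Nq; rewrite /= !ger0_norm ?dist2_ge0//.
have := dist2_triangle mD (L2_sin_sum T0 c p) v2 (L2_sin_sum T0 c q).
rewrite (dist2C mu D v); lra.
Qed.

(** The value of [mhilbert] is a choice; completeness shows that there is something to choose. The
    coefficients returned are those of the chosen value, and [v'] is the representative of [v] off
    the mesh nodes. *)
Lemma mhilbertP (v v' : R -> R) (B : R) :
  {ae mu, forall s, D s -> v s = v' s} -> measurable_fun D v' ->
  (forall s, D s -> `|v' s| <= B) ->
  L2 (mhilbert T v) /\ exists c : nat -> R,
    cvg_L2 mu D (sin_sum T c) v' /\ cvg_L2 mu D (cos_sum T c) (mhilbert T v).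
Proof.
move=> vv mv vB.
have v2 : L2 v' by exact: (L2_bounded mD (measure_time_lty T0) mv vB).
have Sv := sine_series_cvg v2 (sine_approximable_bounded mv vB).
have [w [w2 Cw]] := cos_series_cvg v2 Sv.
have vv' : {ae mu, forall s, D s -> v' s = v s}.
  exact: ae_eq_sym.
have : [set w | L2 w /\ exists c : nat -> R,
    cvg_L2 mu D (sin_sum T c) v /\ cvg_L2 mu D (cos_sum T c) w] (mhilbert T v).
  apply: xgetPex; exists w; split=> //; exists (sine_coef v'); split => //.
  exact: ae_eq_cvg_L2 Sv.
move=> [h2 [c [Sc Cc]]]; split => //; exists c; split => //.
exact: ae_eq_cvg_L2 Sc.
Qed.

End completeness.

(** * Lebesgue measure on R^n *)

Section leb_product.
Variable R : realType.

Lemma measurable_cV_coord n (i : 'I_n) :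
  measurable_fun setT (@cV_coord _ R n i).
Proof.
move=> _ C mC; rewrite setTI; apply: sub_sigma_algebra => /=.
by rewrite -bigcup_seq/=; exists i; [rewrite /= mem_index_enum|exists C => //; rewrite setTI].
Qed.

Lemma measurable_fun_cV d (X : measurableType d) n (D : set X) (f : X -> 'cV[R]_n) :
  (forall i, measurable_fun D (fun x => f x i ord0)) -> measurable_fun D f.
Proof.
move=> mf mD; suff: measurable_fun D f by apply.
apply: (@measurability _ _ _ _ _ _
  (\big[setU/set0]_(i < n)
     preimage_set_system setT (@cV_coord _ R n i) measurable)).
  by [].
move=> _ [A + <-]; rewrite -bigcup_seq => -[i _ [B mB <-]].
by rewrite [X in f @^-1` X]setTI; exact: mf.
Qed.

Lemma measurable_time_of n : measurable_fun setT (@time_of R n).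
Proof. exact: measurable_cV_coord. Qed.

Lemma measurable_space_of n : measurable_fun setT (@space_of R n).
Proof.
apply: measurable_fun_cV => i.
rewrite (_ : (fun x => _) = @cV_coord _ R n.+1 (lift ord0 i)).
  exact: measurable_cV_coord.
by apply/funext => x; rewrite mxE.
Qed.

Lemma time_of_cons n (p : R * 'cV[R]_n) : time_of (cons_cV p) = p.1.
Proof. exact: cons_cV0. Qed.

Lemma space_of_cons n (p : R * 'cV[R]_n) : space_of (cons_cV p) = p.2.
Proof. by apply/colP => i; rewrite mxE cons_cVS. Qed.

Let measurable_cons_cV' n :
  @measurable_fun _ _ (measurableTypeR R * 'cV[R]_n)%type _ setT (@cons_cV R n).
Proof. exact: measurable_cons_cV. Qed.

Lemma leb_prod n (A : set R) (B : set 'cV[R]_n) :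
  measurable A -> measurable B ->
  leb R n.+1 [set z | A (time_of z) /\ B (space_of z)] =
  (lebesgue_measure A * leb R n B)%E.
Proof.
move=> mA mB; rewrite /= /pushforward.
rewrite (_ : _ @^-1` _ = A `*` B); last first.
  by apply/seteqP; split => p /=; rewrite time_of_cons space_of_cons.
exact: product_measure2E.
Qed.

Lemma measurable_prod_set n (A : set R) (B : set 'cV[R]_n) :
  measurable A -> measurable B ->
  measurable [set z | A (time_of z) /\ B (space_of z)].
Proof.
move=> mA mB.
rewrite (_ : [set z | _] = (@time_of R n @^-1` A) `&` (@space_of R n @^-1` B)) //.
apply: measurableI; rewrite -[X in measurable X]setTI.
  exact: measurable_time_of.
exact: measurable_space_of.
Qed.

Lemma sigma_finite_leb n : sigma_finite setT (leb R n).
Proof.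
elim: n => [|n IH].
  exists (fun=> setT); first by rewrite bigcup_const.
  by move=> i; split => //=; rewrite diracT ltry.
have /sigma_finiteP[F [TF ndF Foo]] := sigma_finiteT (@lebesgue_measure R).
have /sigma_finiteP[G [TG ndG Goo]] := IH.
exists (fun k => [set z | F k (time_of z) /\ G k (space_of z)]).
  apply/seteqP; split => // z _.
  have [i _ Fi] : (\bigcup_k F k) (time_of z) by rewrite -TF.
  have [j _ Gj] : (\bigcup_k G k) (space_of z) by rewrite -TG.
  exists (maxn i j) => //=; split.
    by move: Fi; apply/subsetPset/ndF; rewrite leq_maxl.
  by move: Gj; apply/subsetPset/ndG; rewrite leq_maxr.
move=> k; have [mF Fk] := Foo k; have [mG Gk] := Goo k; split.
  exact: measurable_prod_set.
by rewrite leb_prod// lte_mul_pinfty// ge0_fin_numE.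
Qed.

(** A copy of the measure to attach the sigma-finite structure that the Fubini theorems ask for;
    [leb] itself returns a plain measure. *)
Definition sleb n : set 'cV[R]_n -> \bar R := leb R n.
Arguments sleb n _ : clear implicits.

HB.instance Definition _ n := Measure.copy (sleb n) (leb R n).

HB.instance Definition _ n :=
  Measure_isSigmaFinite.Build _ _ _ (sleb n) (sigma_finite_leb n).

Local Open Scope ereal_scope.

Lemma leb_Tonelli n (F : 'cV[R]_n.+1 -> \bar R) : measurable_fun setT F ->
  (forall z, 0 <= F z) ->
  \int[leb R n.+1]_z F z =
  \int[leb R n]_x \int[lebesgue_measure]_s F (cons_cV (s, x)).
Proof.
move=> mF F0; rewrite (ge0_integral_pushforward (@measurable_cons_cV' n))//.
pose f (p : measurableTypeR R * 'cV[R]_n) := F (cons_cV p).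
have mf : measurable_fun setT f.
  exact: (measurableT_comp mF (@measurable_cons_cV' n)).
rewrite -[RHS](@fubini_tonelli2 _ _ _ _ R lebesgue_measure (sleb n) f)//; last first.
  by move=> p; exact: F0.
(* [leb] is built with the product [\x^], whereas Tonelli speaks of [\x]; they agree on rectangles
   and hence everywhere. *)
rewrite preimage_setT; apply: eq_measure_integral => A mA _ /=.
apply/esym; apply: (@product_measure_unique _ _ _ _ R lebesgue_measure (sleb n)) => //.
by move=> B C mB mC; rewrite /= product_measure2E.
Qed.

Section integrable.
Variables (n : nat) (F : 'cV[R]_n.+1 -> \bar R).
Hypothesis iF : (leb R n.+1).-integrable setT F.

Let f (p : measurableTypeR R * 'cV[R]_n) := F (cons_cV p).

Let mf : measurable_fun setT f.
Proof.
apply: measurableT_comp; first exact: (measurable_int _ iF).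
exact: measurable_cons_cV.
Qed.

Let if2 : (lebesgue_measure \x^ leb R n).-integrable setT f.
Proof.
apply/integrableP; split => //.
have /integrableP[mF] := iF; rewrite (ge0_integral_pushforward (@measurable_cons_cV' n))//.
by apply: measurableT_comp.
Qed.

Let eqm A : measurable A ->
  (lebesgue_measure \x sleb n) A = (lebesgue_measure \x^ leb R n) A.
Proof.
move=> mA.
apply: (@product_measure_unique _ _ _ _ R lebesgue_measure (sleb n)) => //.
by move=> B C mB mC; rewrite /= product_measure2E.
Qed.

Let if1 : (lebesgue_measure \x sleb n).-integrable setT f.
Proof.
apply/integrableP; split => //; have /integrableP[_] := if2.
congr (_ < _); apply: eq_measure_integral => A mA _.
by apply/esym; exact: eqm.
Qed.

Let integral_leb_prod :
  \int[leb R n.+1]_z F z = \int[lebesgue_measure \x^ leb R n]_p f p.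
Proof.
exact: (integral_pushforward (@measurable_cons_cV' n) (measurable_int _ iF) if2
  measurableT).
Qed.

Lemma leb_Fubini21 : \int[leb R n.+1]_z F z =
  \int[leb R n]_x \int[lebesgue_measure]_s F (cons_cV (s, x)).
Proof.
rewrite integral_leb_prod.
by have := @integral21_prod_meas2 _ _ _ _ R lebesgue_measure (sleb n) f if1.
Qed.

Lemma leb_Fubini12 : \int[leb R n.+1]_z F z =
  \int[lebesgue_measure]_s \int[leb R n]_x F (cons_cV (s, x)).
Proof.
rewrite integral_leb_prod.
by have := @integral12_prod_meas2 _ _ _ _ R lebesgue_measure (sleb n) f if1.
Qed.

End integrable.

Lemma ae_space_of n (P : 'cV[R]_n -> Prop) : {ae leb R n, forall x, P x} ->
  {ae leb R n.+1, forall z, P (space_of z)}.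
Proof.
move=> [N [mN N0 PN]]; exists [set z | setT (time_of z) /\ N (space_of z)]; split.
- exact: (@measurable_prod_set n setT N).
- by rewrite leb_prod// N0 mule0.
- by move=> z Pz; split => //; apply: PN.
Qed.

Lemma ae_time_of n (P : R -> Prop) : {ae lebesgue_measure, forall s, P s} ->
  {ae leb R n.+1, forall z, P (time_of z)}.
Proof.
move=> [N [mN N0 PN]]; exists [set z | N (time_of z) /\ setT (space_of z)]; split.
- exact: measurable_prod_set.
- by rewrite leb_prod// N0 mul0e.
- by move=> z Pz; split => //; apply: PN.
Qed.

Section product_set.
Variables (n : nat) (A : set (measurableTypeR R)) (B : set 'cV[R]_n).
Hypotheses (mA : measurable A) (mB : measurable B).

Definition prod_set : set 'cV[R]_n.+1 := [set z | A (time_of z) /\ B (space_of z)].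

Lemma measurable_prod_set' : measurable prod_set.
Proof. exact: measurable_prod_set. Qed.

Lemma prod_set_cons s x : prod_set (cons_cV (s, x)) = (A s /\ B x).
Proof. by rewrite /prod_set/= time_of_cons space_of_cons. Qed.

Lemma patch_prod_set (F : 'cV[R]_n.+1 -> \bar R) s x :
  (F \_ prod_set) (cons_cV (s, x)) =
  if s \in A then ((fun x => F (cons_cV (s, x))) \_ B) x else 0.
Proof.
rewrite /patch; case: ifPn => [|/negP].
  by rewrite inE prod_set_cons => -[As Bx]; rewrite !mem_set.
rewrite inE prod_set_cons => ABsx; case: ifPn => // /set_mem As.
by case: ifPn => // /set_mem Bx; exfalso; apply: ABsx.
Qed.

Lemma prod_set_Fubini12 (F : 'cV[R]_n.+1 -> \bar R) :
  (leb R n.+1).-integrable prod_set F ->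
  \int[leb R n.+1]_(z in prod_set) F z =
  \int[lebesgue_measure]_(s in A) \int[leb R n]_(x in B) F (cons_cV (s, x)).
Proof.
move=> iF; rewrite integral_mkcond leb_Fubini12; last first.
  by rewrite -integrable_mkcond//; exact: measurable_prod_set'.
rewrite [RHS]integral_mkcond; apply: eq_integral => s _.
rewrite [in RHS]/patch; case: ifPn => As; last first.
  by rewrite integral0_eq// => x _; rewrite patch_prod_set (negbTE As).
by rewrite [RHS]integral_mkcond; apply: eq_integral => x _; rewrite patch_prod_set As.
Qed.

Lemma prod_set_Fubini21 (F : 'cV[R]_n.+1 -> \bar R) :
  (leb R n.+1).-integrable prod_set F ->
  \int[leb R n.+1]_(z in prod_set) F z =
  \int[leb R n]_(x in B) \int[lebesgue_measure]_(s in A) F (cons_cV (s, x)).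
Proof.
move=> iF; rewrite integral_mkcond leb_Fubini21; last first.
  by rewrite -integrable_mkcond//; exact: measurable_prod_set'.
rewrite [RHS]integral_mkcond; apply: eq_integral => x _.
rewrite [in RHS]/patch; case: ifPn => Bx; last first.
  rewrite integral0_eq// => s _; rewrite patch_prod_set; case: ifP => //.
  by rewrite /patch (negbTE Bx).
rewrite [RHS]integral_mkcond; apply: eq_integral => s _; rewrite patch_prod_set.
by rewrite [RHS]/patch; case: ifP => // _; rewrite /patch Bx.
Qed.

Lemma prod_set_Tonelli (F : 'cV[R]_n.+1 -> \bar R) :
  measurable_fun prod_set F -> (forall z, prod_set z -> 0 <= F z) ->
  \int[leb R n.+1]_(z in prod_set) F z =
  \int[leb R n]_(x in B) \int[lebesgue_measure]_(s in A) F (cons_cV (s, x)).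
Proof.
move=> mF F0; rewrite integral_mkcond leb_Tonelli; last 2 first.
- by apply/(measurable_restrictT _ _).1 => //; exact: measurable_prod_set'.
- by move=> z; rewrite /patch; case: ifPn => // /set_mem /F0.
rewrite [RHS]integral_mkcond; apply: eq_integral => x _.
rewrite [in RHS]/patch; case: ifPn => Bx; last first.
  rewrite integral0_eq// => s _; rewrite patch_prod_set; case: ifP => //.
  by rewrite /patch (negbTE Bx).
rewrite [RHS]integral_mkcond; apply: eq_integral => s _; rewrite patch_prod_set.
by rewrite [RHS]/patch; case: ifP => // _; rewrite /patch Bx.
Qed.

Lemma measurable_comp_time_of (f : R -> R) : measurable_fun A f ->
  measurable_fun prod_set (fun z => f (time_of z)).
Proof.
move=> mf; apply: (measurable_comp mA _ mf).
  by move=> _ [z [Az _] <-].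
apply: measurable_funTS; exact: measurable_time_of.
Qed.

Lemma measurable_comp_space_of (g : 'cV[R]_n -> R) : measurable_fun B g ->
  measurable_fun prod_set (fun z => g (space_of z)).
Proof.
move=> mg; apply: (measurable_comp mB _ mg).
  by move=> _ [z [_ Bz] <-].
apply: measurable_funTS; exact: measurable_space_of.
Qed.

Local Open Scope ring_scope.

Lemma L2_tensor (f : R -> R) (g : 'cV[R]_n -> R) :
  L2 lebesgue_measure A f -> L2 (leb R n) B g ->
  L2 (leb R n.+1) prod_set (fun z => f (time_of z) * g (space_of z)).
Proof.
move=> [mf f2] [mg g2]; split.
  by apply: measurable_funM; [exact: measurable_comp_time_of|exact: measurable_comp_space_of].
apply/integrableP; split.
  apply/measurable_EFinP; apply: measurable_funX.
  by apply: measurable_funM; [exact: measurable_comp_time_of|exact: measurable_comp_space_of].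
have /integrableP[mf2 if2] := f2; have /integrableP[mg2 ig2] := g2.
rewrite prod_set_Tonelli//; last first.
  apply: measurableT_comp => //; apply/measurable_EFinP; apply: measurable_funX.
  by apply: measurable_funM; [exact: measurable_comp_time_of|exact: measurable_comp_space_of].
set I := (\int[_]_(x in A) _)%E in if2; set J := (\int[_]_(x in B) _)%E in ig2.
have I0 : (0 <= I)%E by exact: integral_ge0.
rewrite [ltLHS](_ : _ = I * J)%E; first by apply: lte_mul_pinfty => //; rewrite ge0_fin_numE.
rewrite -ge0_integralZl//; last exact: measurableT_comp.
apply: eq_integral => x _; rewrite muleC -ge0_integralZl//; last exact: measurableT_comp.
apply: eq_integral => s _; rewrite time_of_cons space_of_cons/= -EFinM -normrM.
by rewrite exprMn mulrC.
Qed.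

Lemma dot_tensor (f f' : R -> R) (g g' : 'cV[R]_n -> R) :
  L2 lebesgue_measure A f -> L2 lebesgue_measure A f' ->
  L2 (leb R n) B g -> L2 (leb R n) B g' ->
  dot_L2 (leb R n.+1) prod_set (fun z => f (time_of z) * g (space_of z))
    (fun z => f' (time_of z) * g' (space_of z)) =
  dot_L2 lebesgue_measure A f f' * dot_L2 (leb R n) B g g'.
Proof.
move=> f2 f2' g2 g2'; rewrite /dot_L2 {1}/Rintegral prod_set_Fubini21; last first.
  by apply: (L2_mul_integrable measurable_prod_set'); exact: L2_tensor.
have iff := L2_mul_integrable mA f2 f2'; have igg := L2_mul_integrable mB g2 g2'.
rewrite -RintegralZl//; congr fine; apply: eq_integral => x _.
rewrite EFinM fineK; last exact: integrable_fin_num.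
rewrite muleC -integralZl//; apply: eq_integral => s _.
by rewrite time_of_cons space_of_cons -!EFinM; congr EFin => /=; ring.
Qed.

End product_set.

End leb_product.

(** * Boxes, open sets and measurability in R^n *)

Section cV_topology.
Variable R : realType.

Lemma nbhs_cVP n (x : 'cV[R]_n) (A : set 'cV[R]_n) :
  nbhs x A <-> exists2 e : R, 0 < e &
    forall y : 'cV[R]_n, (forall i, `|x i ord0 - y i ord0| < e) -> A y.
Proof.
split=> [/nbhs_ballP[e /= e0 xA]|[e e0 xA]].
  by exists e => // y xy; apply: xA; split => // i j; rewrite ord1; exact: xy.
by apply/nbhs_ballP; exists e => //= y [_ xy]; apply: xA => i; exact: xy.
Qed.

Lemma cvg_cV n (T : Type) (F : set_system T) (FF : Filter F) (f : T -> 'cV[R]_n)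
    (y : 'cV[R]_n) :
  (forall i, f x i ord0 @[x --> F] --> y i ord0) -> f x @[x --> F] --> y.
Proof.
move=> fy A /nbhs_cVP[e e0 yA]; rewrite /= nbhs_filterE.
have : \forall x \near F, forall i, `|y i ord0 - f x i ord0| < e.
  by apply: filter_forall => i; have := fy i => /cvgrPdist_lt/(_ e e0).
by apply: filterS => x xe; apply: yA.
Qed.

Lemma continuous_cV n (T : topologicalType) (f : T -> 'cV[R]_n) :
  (forall i, continuous (fun x => f x i ord0)) -> continuous f.
Proof. by move=> cf x; apply: cvg_cV => i; exact: cf. Qed.

Lemma continuous_time_of n : continuous (@time_of R n).
Proof. exact: coord_continuous. Qed.

Lemma continuous_space_of n : continuous (@space_of R n).
Proof.
apply: continuous_cV => i; rewrite (_ : (fun x => _) =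
  fun x : 'cV[R]_n.+1 => x (lift ord0 i) ord0); first exact: coord_continuous.
by apply/funext => x; rewrite mxE.
Qed.

Lemma continuous_cons_cV n (s : R) : continuous (fun x : 'cV[R]_n => cons_cV (s, x)).
Proof.
apply: continuous_cV => i; have [j ->|->] := unliftP ord0 i.
  rewrite (_ : (fun x => _) = fun x : 'cV[R]_n => x j ord0).
    exact: coord_continuous.
  by apply/funext => x; rewrite cons_cVS.
rewrite (_ : (fun x => _) = fun=> s); first exact: cst_continuous.
by apply/funext => x; rewrite cons_cV0.
Qed.

Definition box n (a b : 'cV[R]_n) : set 'cV[R]_n :=
  [set x | forall i, a i ord0 < x i ord0 < b i ord0].

Definition cbox n (a b : 'cV[R]_n) : set 'cV[R]_n :=
  [set x | forall i, a i ord0 <= x i ord0 <= b i ord0].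

Lemma compact_cbox n (a b : 'cV[R]_n) : compact (cbox a b).
Proof.
have -> : cbox a b = (fun v : 'rV[R]_n => v^T) @`
    [set v : 'rV[R]_n | forall i, `[a i ord0, b i ord0]%classic (v ord0 i)].
  apply/seteqP; split => [x xab|_ [v vab <-] i]; last first.
    by have := vab i; rewrite /= in_itv/= mxE.
  exists x^T; last by rewrite trmxK.
  by move=> i; rewrite /= in_itv/= mxE.
apply: continuous_compact; last first.
  by apply: (@rV_compact _ _ (fun i => `[a i ord0, b i ord0]%classic)) => i; exact: segment_compact.
apply: continuous_subspaceT; apply: continuous_cV => i.
rewrite (_ : (fun x => _) = fun x : 'rV[R]_n => x ord0 i).
  exact: coord_continuous.
by apply/funext => x; rewrite mxE.
Qed.

Lemma measurable_box n (a b : 'cV[R]_n) : measurable (box a b).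
Proof.
rewrite (_ : box a b = \bigcap_(i in [set: 'I_n])
   ((fun x : 'cV[R]_n => x i ord0) @^-1` `]a i ord0, b i ord0[%classic)); last first.
  by apply/seteqP; split => x xab i; [move=> _|move: (xab i I)]; rewrite /= in_itv/=.
apply: fin_bigcap_measurable => // i _; rewrite -[X in measurable X]setTI.
by apply: measurable_cV_coord.
Qed.

Definition ratcV n (q : 'cV[rat]_n) : 'cV[R]_n := map_mx ratr q.

(** Rational corners leave countably many boxes, and the closed box inside [U] later serves as a
    compact support. *)
Lemma open_rat_box n (U : set 'cV[R]_n) x : open U -> U x ->
  exists a b : 'cV[rat]_n, box (ratcV a) (ratcV b) x /\ cbox (ratcV a) (ratcV b) `<=` U.
Proof.
move=> oU Ux; have /nbhs_cVP[e e0 xU] : nbhs x U by exact: open_nbhs_nbhs.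
have A i : exists q : rat, ratr q \in `]x i ord0 - e, x i ord0[.
  by apply: rat_in_itvoo; rewrite ltrBlDr ltrDl.
have B i : exists q : rat, ratr q \in `]x i ord0, x i ord0 + e[.
  by apply: rat_in_itvoo; rewrite ltrDl.
have [a ha] := choice A; have [b hb] := choice B.
exists (\col_i a i), (\col_i b i); split.
  move=> i; rewrite !mxE; have := ha i; have := hb i; rewrite !in_itv/=.
  by move=> /andP[-> _] /andP[_ ->].
move=> y yab; apply: xU => i; have := yab i; rewrite !mxE.
have := ha i; have := hb i; rewrite !in_itv/=.
by move=> /andP[? ?] /andP[? ?] /andP[? ?]; rewrite ltr_norml; apply/andP; split; lra.
Qed.

Lemma open_bigcup_box n (U : set 'cV[R]_n) : open U ->
  U = \bigcup_(p in [set p : 'cV[rat]_n * 'cV[rat]_n | cbox (ratcV p.1) (ratcV p.2) `<=` U])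
    box (ratcV p.1) (ratcV p.2).
Proof.
move=> oU; apply/seteqP; split => [x Ux|x [p /= pU xp]].
  by have [a [b [xab abU]]] := open_rat_box oU Ux; exists (a, b).
by apply: pU => i; have /andP[/ltW -> /ltW ->] := xp i.
Qed.

Lemma open_measurable_cV n (U : set 'cV[R]_n) : open U -> measurable U.
Proof.
move=> oU; rewrite (open_bigcup_box oU); rewrite bigcup_mkcond.
apply: countable_bigcupT_measurable; first exact: countableP.
by move=> p; case: ifP => // _; exact: measurable_box.
Qed.

Lemma continuous_measurable_cV n (f : 'cV[R]_n -> R) : continuous f ->
  measurable_fun setT f.
Proof.
move=> /continuousP cf; apply: (measurability _ (RGenOInfty.measurableE R)).
move=> _ [_ [x ->] <-]; rewrite setTI; apply: open_measurable_cV; apply: cf.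
exact: rray_open.
Qed.

Lemma cylinderE n T (Omega : set 'cV[R]_n) :
  cylinder T Omega = prod_set `]0, T[ Omega.
Proof. by apply/seteqP; split => z; rewrite /cylinder/prod_set/= in_itv. Qed.

Lemma open_cylinder n T (Omega : set 'cV[R]_n) : open Omega ->
  open (cylinder T Omega).
Proof.
move=> oO; rewrite cylinderE.
rewrite (_ : prod_set _ _ = (@time_of R n @^-1` `]0, T[%classic) `&` (@space_of R n @^-1` Omega)) //.
apply: openI; apply: open_comp => //.
- by move=> x _; exact: continuous_time_of.
- by move=> x _; exact: continuous_space_of.
Qed.

Lemma leb_bounded n (M : R) :
  (leb R n [set x : 'cV[R]_n | forall i, (`|x i ord0| <= M)%R] < +oo)%E.
Proof.
elim: n => [|n IH]; first by rewrite /= diracE ltry.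
rewrite (_ : [set x | _] = prod_set `[- M, M]
    [set x : 'cV[R]_n | forall i, (`|x i ord0| <= M)%R]); last first.
  apply/seteqP; split => z /=.
    move=> zM; split; first by rewrite /= in_itv/= -ler_norml; exact: zM.
    by move=> i; rewrite mxE.
  rewrite /prod_set/= in_itv/= -ler_norml => -[z0 zM] i; have [j ->|->//] := unliftP ord0 i.
  by have := zM j; rewrite mxE.
rewrite leb_prod//; last first.
  rewrite (_ : [set x | _] = \bigcap_(i in [set: 'I_n])
     ((fun x : 'cV[R]_n => x i ord0) @^-1` `[- M, M]%classic)); last first.
    by apply/seteqP; split => x xab i; [move=> _|move: (xab i I)]; rewrite /= in_itv/= -ler_norml.
  apply: fin_bigcap_measurable => // i _; rewrite -[X in measurable X]setTI.
  by apply: measurable_cV_coord.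
rewrite lte_mul_pinfty// ge0_fin_numE// lebesgue_measure_itv/=.
by case: ifP => // _; rewrite -EFinD ltry.
Qed.

Lemma leb_bounded_set n (A : set 'cV[R]_n) : measurable A -> bounded_set A ->
  (leb R n A < +oo)%E.
Proof.
move=> mA [M [_ AM]]; have := AM (M + 1); rewrite ltrDl ltr01 => /(_ isT) {}AM.
apply: le_lt_trans (leb_bounded n (M + 1)); apply: le_measure => //; rewrite ?inE//.
  rewrite (_ : [set x | _] = cbox (const_mx (- (M+1))) (const_mx (M+1))); last first.
    by apply/seteqP; split => x xM i; have := xM i; rewrite !mxE ler_norml.
  rewrite -[cbox _ _]setCK; apply: measurableC; apply: open_measurable_cV; apply: closed_openC.
  by apply: compact_closed; [exact: norm_hausdorff|exact: compact_cbox].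
move=> x Ax i; have := AM x Ax; apply: le_trans.
by rewrite [leRHS]/Num.norm/= mx_normrE; apply: (le_bigmax _ (fun ij => `|x ij.1 ij.2|) (i, ord0)).
Qed.

Lemma measurable_itvoo (T : R) : measurable (`]0, T[%classic : set (measurableTypeR R)).
Proof. exact: measurable_itv. Qed.

Lemma leb_cylinder_lty n T (Omega : set 'cV[R]_n) : open Omega -> bounded_set Omega ->
  (leb R n.+1 (cylinder T Omega) < +oo)%E.
Proof.
move=> oO bO; rewrite cylinderE leb_prod//; last exact: open_measurable_cV.
rewrite lte_mul_pinfty//; last by apply: leb_bounded_set => //; exact: open_measurable_cV.
rewrite ge0_fin_numE// lebesgue_measure_itv/=.
by case: ifP => // _; rewrite -EFinD ltry.
Qed.

End cV_topology.

(** * The fundamental lemma *)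

Section C1_functions.
Variable R : realType.

(** A quadratic remainder bound settles the derivative of [sqr_pos] at its junction 0 together with
    all other points. *)
Lemma is_derive_quadratic (f : R -> R) (u l : R) :
  (forall h, `|f (h + u) - f u - h * l| <= h ^+ 2) -> is_derive u 1 f l.
Proof.
move=> fl.
suff cf : h^-1 *: ((f \o shift u) (h *: (1:R)) - f u) @[h --> 0^'] --> l.
  by apply: DeriveDef; [exact: (cvgP l)|exact: cvg_lim].
apply/cvgrPdist_lt => e e0; near=> h.
have h0 : h != 0 by near: h; exact: nbhs_dnbhs_neq.
have he : `|h| < e.
  near: h; apply: dnbhs0_lt; exact: e0.
apply: le_lt_trans he.
have n0 : 0 < `|h| by rewrite normr_gt0.
rewrite -(ler_pM2l n0) -normrM -expr2 real_normK ?num_real//.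
rewrite (le_trans _ (fl h))// /GRing.scale/= mulr1 distrC mulrBr mulrA divff// mul1r.
by rewrite lexx.
Unshelve. all: by end_near.
Qed.

Definition sqr_pos (u : R) : R := Num.max 0 u ^+ 2.

Lemma is_derive_sqr_pos (u : R) : is_derive u 1 sqr_pos (2 * Num.max 0 u).
Proof.
apply: is_derive_quadratic => h; rewrite /sqr_pos /Num.max.
case: ltP => hu; case: ltP => u0.
- by rewrite (_ : _ - _ - _ = h ^+ 2) ?ger0_norm ?sqr_ge0//; ring.
- rewrite (_ : _ - _ - _ = (h + u) ^+ 2); last by ring.
  rewrite ger0_norm ?sqr_ge0// lerXn2r ?nnegrE//; first exact: ltW.
    by lra.
  by rewrite gerDl.
- rewrite ler_norml; apply/andP; split; first by nra.
  by rewrite -subr_ge0 (_ : _ - _ = (h + u) ^+ 2) ?sqr_ge0//; ring.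
- by rewrite !mulr0 expr0n/= subrr sub0r oppr0 normr0 sqr_ge0.
Qed.

(** A C^1 replacement of the unit step: zero for [u <= 0], below 1 everywhere, and tending to 1 for
    [u > 0] when the argument is scaled up. The square inside smooths the corner at 0. *)
Definition ramp (u : R) : R := sqr_pos u / (1 + sqr_pos u).

Definition ramp' (u : R) : R := 2 * Num.max 0 u / (1 + sqr_pos u) ^+ 2.

Lemma sqr_pos_ge0 u : 0 <= sqr_pos u.
Proof. exact: sqr_ge0. Qed.

Lemma is_derive_ramp (u : R) : is_derive u 1 ramp (ramp' u).
Proof.
have D1 := is_derive_sqr_pos u; have p0 := sqr_pos_ge0 u.
have n0 : 1 + sqr_pos u != 0 by rewrite gt_eqF// ltr_pwDl.
have D2 : is_derive u 1 (fun v => (1 + sqr_pos v)^-1) (- (1 + sqr_pos u) ^- 2 *: (0 + 2 * Num.max 0 u)).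
  by apply: is_deriveV.
apply: is_derive_eq => //.
rewrite /ramp' /GRing.scale/=.
by field.
Qed.

Lemma continuous_ramp' : continuous ramp'.
Proof.
have cm : continuous (fun u : R => Num.max 0 u).
  by move=> u; apply: continuous_max; [exact: cst_continuous|exact: cvg_id].
have cs : continuous sqr_pos by move=> u; apply: cvgM; exact: cm.
move=> u; apply: cvgM; first by apply: cvgM; [exact: cvg_cst|exact: cm].
apply: cvgV; first by rewrite expf_neq0// gt_eqF// ltr_pwDl// sqr_pos_ge0.
by apply: cvgM; apply: cvgD; (try exact: cvg_cst); exact: cs.
Qed.

Lemma ramp_ge0 u : 0 <= ramp u.
Proof. by rewrite divr_ge0// ?addr_ge0// sqr_pos_ge0. Qed.

Lemma ramp_le1 u : ramp u <= 1.
Proof.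
rewrite ler_pdivrMr ?mul1r ?lerDr//.
by rewrite ltr_pwDl// sqr_pos_ge0.
Qed.

Lemma ramp0 u : u <= 0 -> ramp u = 0.
Proof. by move=> u0; rewrite /ramp /sqr_pos max_l// expr0n/= mul0r. Qed.

Lemma cvg_ramp u : 0 < u -> ramp (m%:R * u) @[m --> \oo] --> (1 : R).
Proof.
move=> u0; apply/cvgrPdist_le => e e0.
near=> m.
have m0 : 1 <= m%:R :> R by rewrite ler1n; near: m; exact: nbhs_infty_gt.
have mu : 0 < m%:R * u by rewrite mulr_gt0// (lt_le_trans ltr01).
have mem : (e * u ^+ 2)^-1 <= m%:R by near: m; exact: nbhs_infty_ger.
rewrite /ramp /sqr_pos max_r; last exact: ltW.
have d0 : 0 < 1 + (m%:R * u) ^+ 2 by rewrite ltr_pwDl// sqr_ge0.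
rewrite (_ : 1 - _ = (1 + (m%:R * u) ^+ 2)^-1); last by field; rewrite gt_eqF.
rewrite ger0_norm ?invr_ge0 ?(ltW d0)// -[leRHS]invrK lef_pV2 ?posrE ?invr_gt0//.
have eu : 0 < e * u ^+ 2 by rewrite mulr_gt0// exprn_gt0.
have : e^-1 <= m%:R * u ^+ 2.
  have := ler_wpM2r (sqr_ge0 u) mem; rewrite invfM -mulrA mulVf ?mulr1//.
  by rewrite expf_neq0// gt_eqF.
move=> /le_trans; apply; rewrite exprMn.
apply: (@le_trans _ _ (m%:R ^+ 2 * u ^+ 2)); last by rewrite lerDr.
by rewrite ler_wpM2r// ?sqr_ge0// expr2 ler_peMl// (le_trans ler01).
Unshelve. all: by end_near.
Qed.

Lemma difference_quotient_line (V : normedModType R) (f : V -> R) (x v : V) (s : R) :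
  (fun h => h^-1 *: (((fun r => f (r *: v + x)) \o shift s) (h *: (1 : R)) - f (s *: v + x)))
  = (fun h => h^-1 *: ((f \o shift (s *: v + x)) (h *: v) - f (s *: v + x))).
Proof.
apply/funext => h /=; rewrite /shift/= [_%:A](_ : _ = h); last exact: mulr1.
by rewrite scalerDl addrA.
Qed.

Lemma is_derive_line (V : normedModType R) (f : V -> R) (x v : V) (s l : R) :
  is_derive s 1 (fun r : R => f (r *: v + x)) l <-> is_derive (s *: v + x) v f l.
Proof.
have E := difference_quotient_line f x v s.
have H : derivable (fun r : R => f (r *: v + x)) s 1 <-> derivable f (s *: v + x) v.
  by rewrite /derivable E.
have H' : 'D_1 (fun r : R => f (r *: v + x)) s = 'D_v f (s *: v + x).
  by rewrite /derive E.
split => -[d1 d2]; apply: DeriveDef.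
- exact: (H.1 d1).
- by rewrite -H'; exact: d2.
- exact: (H.2 d1).
- by rewrite H'; exact: d2.
Qed.

Lemma is_derive_at (V : normedModType R) (f : V -> R) (x v : V) (l : R) :
  is_derive (0 : R) 1 (fun r : R => f (r *: v + x)) l -> is_derive x v f l.
Proof. by move=> /is_derive_line; rewrite scale0r add0r. Qed.

Section several_variables.
Variable n : nat.
Implicit Types (f g : 'cV[R]_n -> R) (x y v : 'cV[R]_n).

Lemma lipschitz_line f x v (s M : R) :
  (forall r, `|r| <= `|s| -> is_derive (r *: v + x) v f ('D_v f (r *: v + x)) /\
     `|'D_v f (r *: v + x)| <= M) ->
  `|f (s *: v + x) - f x| <= M * `|s|.
Proof.
move=> H; pose q r := f (r *: v + x).
have Dq (r : R) : `|r| <= `|s| -> is_derive r 1 q ('D_v f (r *: v + x)).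
  by move=> /H[rs _]; apply/is_derive_line.
have q0 : f x = q 0 by rewrite /q scale0r add0r.
have cq r : `|r| <= `|s| -> {for r, continuous q}.
  by move=> /Dq[dq _]; apply/differentiable_continuous; exact/derivable1_diffP.
rewrite q0 -/(q s); have [s0|s0|->] := ltgtP s 0.
- have [r||r] := @MVT _ q (fun r => 'D_v f (r *: v + x)) s 0 s0.
  + rewrite in_itv/= => /andP[sr r0]; apply: Dq.
    by rewrite ltr0_norm// ltr0_norm// lerN2 ltW.
  + apply: continuous_in_subspaceT => r; rewrite inE/= in_itv/= => /andP[sr r0].
    by apply: cq; rewrite (ltr0_norm s0) ler0_norm// lerN2.
  + rewrite in_itv/= => /andP[sr r0] E.
    have [|_ rM] := H r; first by rewrite ltr0_norm// ltr0_norm// lerN2 ltW.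
    rewrite distrC E normrM; apply: ler_pM => //.
    by rewrite sub0r normrN.
- have [r||r] := @MVT _ q (fun r => 'D_v f (r *: v + x)) 0 s s0.
  + rewrite in_itv/= => /andP[r0 rs]; apply: Dq.
    by rewrite gtr0_norm// gtr0_norm// ltW.
  + apply: continuous_in_subspaceT => r; rewrite inE/= in_itv/= => /andP[r0 rs].
    by apply: cq; rewrite (gtr0_norm s0) ger0_norm.
  + rewrite in_itv/= => /andP[r0 rs] E.
    have [|_ rM] := H r; first by rewrite gtr0_norm// gtr0_norm// ltW.
    rewrite E normrM; apply: ler_pM => //.
    by rewrite subr0.
- by rewrite subrr !normr0 mulr0.
Qed.

(* Interpolate between x and y one coordinate at a time and apply the mean value
   theorem on each segment. *)
Lemma C1_continuous f : C1 f -> continuous f.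
Proof.
move=> C1f x.
pose e k : 'cV[R]_n := delta_mx k ord0.
pose M := \big[Num.max/0]_k `|'D_(e k) f x| + 1.
have [d d0 dM] : exists2 d : R, 0 < d & forall y, (forall i, `|x i ord0 - y i ord0| < d) ->
    forall k, `|'D_(e k) f y| <= M.
  apply/nbhs_cVP.
  apply: (@filter_forall _ _ (fun k => [set y | `|'D_(e k) f y| <= M]) (nbhs x)) => k.
  have /cvgrPdist_le/(_ 1 ltr01) := (C1f (e k)).2 x.
  apply: filterS => y xy; rewrite /= -[X in `|X| <= _](subKr ('D_(e k) f x)).
  rewrite (le_trans (ler_normB _ _))// lerD//.
  exact: (le_bigmax _ (fun k => `|'D_(e k) f x|) k).
pose z (y : 'cV[R]_n) j : 'cV[R]_n := \col_i (if (i < j)%N then y i ord0 else x i ord0).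
have zS y (k : 'I_n) : z y k.+1 = (y k ord0 - x k ord0) *: e k + z y k.
  apply/colP => i; rewrite !mxE eqxx andbT ltnS leq_eqVlt.
  have [->|ik] /= := eqVneq i k; first by rewrite eqxx ltnn/= mulr1 subrK.
  by rewrite (negbTE (ik : (i : nat) != k)) mulr0 add0r.
have step y (k : 'I_n) : (forall i, `|x i ord0 - y i ord0| < d) ->
    `|f (z y k.+1) - f (z y k)| <= M * `|x k ord0 - y k ord0|.
  move=> xyd; rewrite zS distrC (distrC (x k ord0)); rewrite -normrN opprB.
  apply: lipschitz_line => r rs; split.
    by apply: DeriveDef => //; exact: (C1f (e k)).1.
  apply: dM => i; rewrite !mxE eqxx andbT.
  have [->|ik] /= := eqVneq i k.
    by rewrite ltnn mulr1 opprD addrA -addrAC subrr sub0r normrN (le_lt_trans rs)// distrC.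
  by rewrite mulr0 add0r; case: ifP => _ //; rewrite subrr normr0.
have bound y : (forall i, `|x i ord0 - y i ord0| < d) ->
    `|f x - f y| <= \sum_(k < n) M * `|x k ord0 - y k ord0|.
  move=> xyd; have -> : f x = f (z y 0%N) by congr f; apply/colP => i; rewrite mxE.
  have -> : f y = f (z y n) by congr f; apply/colP => i; rewrite mxE ltn_ord.
  rewrite distrC -(telescope_sumr (fun k => f (z y k)) (leq0n n)) big_mkord.
  by rewrite (le_trans (ler_norm_sum _ _ _))// ler_sum// => k _; exact: step.
move=> A /nbhs_ballP[eps /= eps0 fA].
have M0 : 0 < M.
  by rewrite ltr_wpDl// big_seq; elim/big_ind: _ => // a b; rewrite le_max => ->.
(* The [n] coordinate steps then add up to [n / n.+1] of [eps], which is strictly smaller, also for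
   [n = 0]. *)
apply/nbhs_cVP; exists (Num.min d (eps / (M * n.+1%:R))).
  by rewrite lt_min d0 divr_gt0// mulr_gt0// ltr0n.
move=> y xy; have xyd i : `|x i ord0 - y i ord0| < d.
  by have := xy i; rewrite lt_min => /andP[].
apply: fA; rewrite /ball/= (le_lt_trans (bound y xyd))//.
apply: (@le_lt_trans _ _ (\sum_(k < n) eps / n.+1%:R)).
  apply: ler_sum => k _; have := xy k; rewrite lt_min => /andP[_ /ltW xk].
  apply: (le_trans (ler_wpM2l (ltW M0) xk)).
  by rewrite invfM (mulrCA M) (mulrA M) divff ?gt_eqF// mul1r.
rewrite sumr_const card_ord -[X in X < _]mulr_natr -mulrA gtr_pMr//.
by rewrite mulrC ltr_pdivrMr ?ltr0n// mul1r ltr_nat.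
Qed.

Lemma C1M f g : C1 f -> C1 g -> C1 (fun x => f x * g x).
Proof.
move=> C1f C1g v; have cf := C1_continuous C1f; have cg := C1_continuous C1g.
split => [x|]; first by apply: derivableM; [exact: (C1f v).1|exact: (C1g v).1].
rewrite [X in continuous X](_ : _ = (fun x => f x * 'D_v g x + g x * 'D_v f x)).
  by move=> x; exact: cvgD (cvgM (cf x) ((C1g v).2 x)) (cvgM (cg x) ((C1f v).2 x)).
apply/funext => x; rewrite deriveM//; [exact: (C1f v).1|exact: (C1g v).1].
Qed.

Lemma C1_cst (c : R) : C1 (fun _ : 'cV[R]_n => c).
Proof.
move=> v; split => [x|]; first exact: derivable_cst.
rewrite [X in continuous X](_ : _ = fun=> 0); first exact: cst_continuous.
by apply/funext => x; rewrite derive_cst.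
Qed.

Lemma C1_bigprod (I : Type) (r : seq I) (F : I -> 'cV[R]_n -> R) :
  (forall i, C1 (F i)) -> C1 (fun x => \prod_(i <- r) F i x).
Proof.
move=> C1F; elim: r => [|i r IH].
  rewrite (_ : (fun x => _) = fun=> 1); first exact: C1_cst.
  by apply/funext => x; rewrite big_nil.
rewrite (_ : (fun x => _) = fun x => F i x * \prod_(j <- r) F j x); first exact: C1M.
by apply/funext => x; rewrite big_cons.
Qed.

Lemma C1_comp_coord (r r' : R -> R) (i : 'I_n) : (forall s : R, is_derive s 1 r (r' s)) ->
  continuous r' -> C1 (fun x : 'cV[R]_n => r (x i ord0)).
Proof.
move=> Dr cr' v.
have D x : is_derive x v (fun x : 'cV[R]_n => r (x i ord0)) (v i ord0 * r' (x i ord0)).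
  apply: is_derive_at.
  rewrite (_ : (fun h => _) = r \o (fun h => h * v i ord0 + x i ord0)); last first.
    by apply/funext => h /=; rewrite !mxE.
  have D1 : is_derive (0 : R) 1 (fun h : R => h * v i ord0 + x i ord0) (v i ord0).
    apply: is_derive_eq; rewrite /GRing.scale/=; ring.
  have D2 : is_derive (0 * v i ord0 + x i ord0) 1 r (r' (x i ord0)).
    by rewrite mul0r add0r.
  by apply: (is_derive_eq (@is_derive1_comp _ r (fun h : R => h * v i ord0 + x i ord0) 0 _ _ D2 D1)); exact: mulrC.
split => [x|]; first by have [] := D x.
rewrite [X in continuous X](_ : _ = fun x : 'cV[R]_n => v i ord0 * r' (x i ord0)).
  move=> x; apply: continuousM; first exact: cst_continuous.
  by apply: (@continuous_comp _ _ _ (fun x : 'cV[R]_n => x i ord0) r'); [exact: coord_continuous|exact: cr'].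
by apply/funext => x; have [_ ->] := D x.
Qed.

(** One ramp per face of the box: a C^1 function that vanishes off the box and tends to its
    indicator as [m] grows. *)
Definition bump (a b : 'cV[R]_n) (m : nat) : 'cV[R]_n -> R := fun x =>
  (\prod_i ramp (m%:R * (x i ord0 - a i ord0))) *
  (\prod_i ramp (m%:R * (b i ord0 - x i ord0))).

Lemma C1_bump a b m : C1 (bump a b m).
Proof.
have Hlin (c d : R) i : C1 (fun x : 'cV[R]_n => ramp (m%:R * (c * x i ord0 + d))).
  apply: (@C1_comp_coord (fun s => ramp (m%:R * (c * s + d))) (fun s => (m%:R * c) * ramp' (m%:R * (c * s + d)))).
    move=> s; have D1 : is_derive s 1 (fun s : R => m%:R * (c * s + d)) (m%:R * c).
      by apply: is_derive_eq; rewrite /GRing.scale/=; ring.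
    have D2 := is_derive_ramp (m%:R * (c * s + d)).
    by apply: (is_derive_eq (@is_derive1_comp _ ramp (fun s : R => m%:R * (c * s + d)) s _ _ D2 D1)); exact: mulrC.
  move=> s; apply: cvgM; first exact: cvg_cst.
  apply: (@continuous_comp _ _ _ (fun s => m%:R * (c * s + d)) ramp'); last exact: continuous_ramp'.
  apply: cvgM; first exact: cvg_cst.
  by apply: cvgD; [apply: cvgM; [exact: cvg_cst|exact: cvg_id]|exact: cvg_cst].
apply: C1M; apply: C1_bigprod => i.
  rewrite (_ : (fun x => _) = (fun x : 'cV[R]_n => ramp (m%:R * (1 * x i ord0 + (- a i ord0)))))//.
  by apply/funext => x; rewrite mul1r.
rewrite (_ : (fun x => _) = (fun x : 'cV[R]_n => ramp (m%:R * (- 1 * x i ord0 + b i ord0))))//.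
by apply/funext => x; rewrite mulN1r addrC.
Qed.

Lemma prod_ramp01 (u : 'I_n -> R) : 0 <= \prod_i ramp (u i) <= 1.
Proof.
apply/andP; split; first by apply: prodr_ge0 => i _; exact: ramp_ge0.
by apply: prodr_ile1 => i _; rewrite ramp_ge0 ramp_le1.
Qed.

Lemma bump01 a b m x : 0 <= bump a b m x <= 1.
Proof.
have /andP[p0 p1] := prod_ramp01 (fun i => m%:R * (x i ord0 - a i ord0)).
have /andP[q0 q1] := prod_ramp01 (fun i => m%:R * (b i ord0 - x i ord0)).
by apply/andP; split; [exact: mulr_ge0|exact: mulr_ile1].
Qed.

Lemma bump_out a b m x : ~ box a b x -> bump a b m x = 0.
Proof.
move=> abx; have [i] : exists i, ~ (a i ord0 < x i ord0 < b i ord0) by exact/existsNP.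
move=> /negP; rewrite negb_and -!leNgt => /orP[xi|xi].
  by rewrite /bump (bigD1 i)//= ramp0 ?mul0r// mulr_ge0_le0// subr_le0.
by rewrite /bump mulrC (bigD1 i)//= ramp0 ?mul0r// mulr_ge0_le0// subr_le0.
Qed.

Lemma cvg_bump a b x : box a b x -> bump a b m x @[m --> \oo] --> (1 : R).
Proof.
have P (u : 'I_n -> R) : (forall i, 0 < u i) ->
    \prod_i ramp (m%:R * u i) @[m --> \oo] --> (1 : R).
  move=> u0; rewrite -[X in _ --> X](@big1 _ _ *%R 'I_n (index_enum _) predT (fun=> 1))//.
  apply: cvg_big; first exact: mul_continuous.
  by move=> i _; exact: cvg_ramp.
move=> abx; rewrite -[X in _ --> X]mulr1; apply: cvgM.
  by apply: (P (fun i => x i ord0 - a i ord0)) => i; rewrite subr_gt0; have /andP[] := abx i.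
by apply: (P (fun i => b i ord0 - x i ord0)) => i; rewrite subr_gt0; have /andP[] := abx i.
Qed.

End several_variables.

End C1_functions.

Section dot_convergence.
Context d (X : measurableType d) (R : realType).
Variables (m : {measure set X -> \bar R}) (D : set X).
Hypotheses (mD : measurable D) (Doo : (m D < +oo)%E).
Local Notation L2 := (L2 m D).
Local Notation dot := (dot_L2 m D).

Lemma dotBr (f g h : X -> R) : L2 f -> L2 g -> L2 h ->
  dot h (fun x => f x - g x) = dot h f - dot h g.
Proof.
move=> f2 g2 h2; rewrite -mulN1r -dotZr// -dotDr//; last exact: L2Z.
by congr dot_L2; apply/funext => x; rewrite mulN1r.
Qed.

Lemma dotBl (f g h : X -> R) : L2 f -> L2 g -> L2 h ->
  dot (fun x => f x - g x) h = dot f h - dot g h.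
Proof. by move=> f2 g2 h2; rewrite dotC dotBr// dotC (dotC _ _ g). Qed.

Lemma cvg_dot_bounded (B : R) (g v : X -> R) (u : nat -> X -> R) :
  L2 g -> L2 v -> (forall k, L2 (u k)) ->
  (forall k x, D x -> `|v x - u k x| <= B) ->
  (forall x, D x -> u k x @[k --> \oo] --> v x) ->
  dot g (u k) @[k --> \oo] --> dot g v.
Proof.
move=> g2 v2 u2 uB uv.
have dv := bounded_cvg_dist2 mD Doo v2 u2 uB uv.
have d2 k : L2 (fun x => v x - u k x) by exact: L2B.
have d0 : dot (fun x => v x - u k x) g @[k --> \oo] --> 0.
  exact: (@cvg_dot0 _ _ _ _ _ mD (fun k x => v x - u k x) (fun=> g) (dot g g)).
have -> : (fun k => dot g (u k)) = (fun k => dot g v - dot (fun x => v x - u k x) g).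
  apply/funext => k; rewrite dotC (dotC _ _ g v).
  have := @dotDl _ _ _ _ _ mD (fun x => v x - u k x) (u k) g (d2 k) (u2 k) g2.
  under [X in dot_L2 _ _ X _](_ : _ = v); first by apply/funext => x; rewrite subrK.
  by move=> ->; rewrite addrAC subrr add0r.
rewrite -[X in _ --> X]subr0; apply: cvgB => //; exact: cvg_cst.
Qed.

Lemma L2_indic (A : set X) : measurable A -> L2 (\1_A : X -> R).
Proof.
move=> mA; apply: (L2_bounded mD (C := 1)) Doo _ _.
  by apply: measurable_indic.
by move=> x _; rewrite indicE; case: (_ \in _); rewrite ?normr1 ?normr0.
Qed.

End dot_convergence.

(** * Functions orthogonal to all test functions *)

Section fundamental_lemma.
Variables (R : realType) (n : nat).

(** Boxes are stable under intersection ([box_setI]), as Dynkin's lemma requires. They generate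
    because an open half-space is a countable union of growing boxes. *)
Lemma cV_measurableE :
  (measurable : set (set 'cV[R]_n)) = <<s [set A | exists a b, A = box a b] >>.
Proof.
set G := [set A | _]; apply/seteqP; split; last first.
  apply: smallest_sub; first exact: sigma_algebra_measurable.
  by move=> _ [a [b ->]]; exact: measurable_box.
have mc i : measurable_fun setT (fun x : g_sigma_algebraType G => (x : 'cV[R]_n) i ord0).
  apply: (measurability _ (RGenOInfty.measurableE R)).
  move=> _ [_ [r ->] <-]; rewrite setTI.
  rewrite (_ : _ @^-1` _ = \bigcup_(k in [set: nat])
    (box (\col_j (if j == i then r else - k%:R)) (\col_j k%:R) : set 'cV[R]_n)); last first.
    apply/seteqP; split => x /=; rewrite in_itv/= andbT.
      move=> rx; pose M := \big[Num.max/0]_j `|x j ord0|.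
      have xM j : `|x j ord0| <= M by exact: (le_bigmax _ (fun j => `|x j ord0|) j).
      exists (Num.truncn M).+1 => // j; rewrite !mxE.
      have Mk := truncnS_gt M; have /(_ j) := xM; rewrite ler_norml => /andP[Mx xM'].
      apply/andP; split; last exact: le_lt_trans Mk.
      case: eqP => [->//|_]; apply: lt_le_trans Mx; by rewrite ltrN2.
    by move=> [k _ /(_ i)]; rewrite !mxE eqxx => /andP[].
  apply: bigcupT_measurable => k; apply: sub_sigma_algebra.
  by exists (\col_j (if j == i then r else - k%:R)), (\col_j k%:R).
apply: smallest_sub; first exact: sigma_algebra_measurable (g_sigma_algebraType G).
move=> A; rewrite -bigcup_seq => -[i _ [B mB <-]]; rewrite setTI.
by have := mc i measurableT B mB; rewrite setTI.
Qed.

Lemma box_setI (a b a' b' : 'cV[R]_n) : box a b `&` box a' b' =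
  box (\col_i Num.max (a i ord0) (a' i ord0)) (\col_i Num.min (b i ord0) (b' i ord0)).
Proof.
apply/seteqP; split => x /=.
  by move=> [ab ab'] i; rewrite !mxE gt_max lt_min; have /andP[-> ->] := ab i; have /andP[-> ->] := ab' i.
move=> H; split => i; have := H i; rewrite !mxE gt_max lt_min.
  by move=> /andP[/andP[-> _] /andP[-> _]].
by move=> /andP[/andP[_ ->] /andP[_ ->]].
Qed.

Variable D : set 'cV[R]_n.
Hypotheses (oD : open D) (Doo : (leb R n D < +oo)%E).

Let mD : measurable D. Proof. exact: open_measurable_cV. Qed.
Local Notation L2 := (L2 (leb R n) D).
Local Notation dot := (dot_L2 (leb R n) D).

Section scalar.
Variable g : 'cV[R]_n -> R.
Hypothesis g2 : L2 g.
Hypothesis gC1 : forall phi : 'cV[R]_n -> R, C1 phi ->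
  (exists K, [/\ compact K, K `<=` D & forall x, ~ K x -> phi x = 0]) -> dot g phi = 0.

Let dot_box a b : cbox a b `<=` D -> dot g (\1_(box a b)) = 0.
Proof.
move=> abD.
have mb := measurable_box a b.
have bump2 k : L2 (bump a b k).
  apply: (@L2_bounded _ _ _ _ _ mD 1) => //.
    apply: measurable_funTS; apply: continuous_measurable_cV; apply: C1_continuous.
    exact: C1_bump.
  by move=> x _; have /andP[? ?] := bump01 a b k x; rewrite ger0_norm.
have : dot g (bump a b k) @[k --> \oo] --> dot g (\1_(box a b)).
  apply: (cvg_dot_bounded mD Doo (B := 1)) => //.
  - exact: L2_indic.
  - move=> k x _; have /andP[? ?] := bump01 a b k x; rewrite indicE.
    case: (_ \in _); rewrite ler_norml /=; apply/andP; split; lra.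
  - move=> x _; rewrite indicE; case: (boolP (x \in box a b)) => [/set_mem|/negP] xab.
      exact: cvg_bump.
    rewrite (_ : (fun k => _) = fun=> 0); first exact: cvg_cst.
    by apply/funext => k; rewrite bump_out// => H; apply: xab; rewrite inE.
rewrite (_ : (fun k => _) = fun=> 0); last first.
  apply/funext => k; apply: gC1; first exact: C1_bump.
  exists (cbox a b); split => //; first exact: compact_cbox.
  by move=> x xab; rewrite bump_out// => H; apply: xab => i; have /andP[/ltW -> /ltW ->] := H i.
by move=> /(cvg_unique _)/(_ (cvg_cst _)) ->.
Qed.

(** Dynkin induction extends the orthogonality from boxes to all measurable subsets of one box. The
    restriction to a box whose closure lies in [D] supplies the compact supports. *)
Lemma fundamental_lemma_box a b : cbox a b `<=` D ->
  {ae leb R n, forall x, box a b x -> g x = 0}.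
Proof.
move=> abD; pose B := box a b; have mB : measurable B := measurable_box a b.
have BD : B `<=` D by move=> x xab; apply: abD => i; have /andP[/ltW -> /ltW ->] := xab i.
pose P := [set S | measurable S /\ dot g (\1_(S `&` B)) = 0].
have PS S : measurable S -> P S.
  rewrite cV_measurableE; apply: (dynkin_induction cV_measurableE).
  - move=> _ _ [a1 [b1 ->]] [a2 [b2 ->]]; rewrite box_setI.
    by do 2 eexists.
  - by split => //; rewrite setTI; exact: dot_box.
  - move=> _ [a1 [b1 ->]]; split; first exact: measurable_box.
    rewrite /B box_setI; apply: dot_box => x H; apply: abD => i; have := H i.
    rewrite !mxE ge_max le_min => /andP[/andP[_ ->] /andP[_ ->]] //.
  - move=> {S} S mS [_ S0]; split; first exact: measurableC.
    have E : dot g (\1_B) = dot g (\1_(S `&` B)) + dot g (\1_(~` S `&` B)).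
      rewrite -dotDr//; try by apply: L2_indic => //; apply: measurableI => //; exact: measurableC.
      congr dot_L2; apply/funext => x; rewrite !indicE !in_setI in_setC.
      by case: (x \in S); rewrite ?(add0r,addr0)// andbF.
    by move: E; rewrite S0 add0r dot_box.
  - move=> F mF tF PF; split; first exact: bigcupT_measurable.
    have mU k : measurable (\bigcup_(j < k) F j).
      by apply: bigcup_measurable => j _; exact: mF.
    (* Disjointness makes the indicators of finite unions additive; the countable union follows by
       dominated convergence. *)
    have U0 k : dot g (\1_((\bigcup_(j < k) F j) `&` B)) = 0.
      elim: k => [|k IH].
        rewrite (_ : _ `&` _ = set0); last first.
          by apply/seteqP; split => // x [[j /=]].
        by rewrite indic0 dotC dot0l.
      rewrite -[RHS](addr0 0) -{1}IH -(PF k).2 -dotDr//; try by apply: L2_indic => //; exact: measurableI.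
      congr dot_L2; apply/funext => x; rewrite !indicE !in_setI.
      case: (x \in B); rewrite ?andbF ?addr0// !andbT.
      rewrite (_ : (x \in \bigcup_(j < k.+1) F j) = (x \in \bigcup_(j < k) F j) || (x \in F k)).
        case: (boolP (x \in F k)) => xk; last by rewrite orbF addr0.
        rewrite (_ : (x \in \bigcup_(j < k) F j) = false) ?add0r//.
        apply/negP => /set_mem[j /= jk Fj]; move: xk => /set_mem Fk.
        have := tF j k I I; move=> /(_ (ex_intro _ x (conj Fj Fk))) jE.
        by rewrite jE ltnn in jk.
      apply/idP/orP => [/set_mem[j /=]|[/set_mem[j /= jk Fj]|/set_mem Fk]].
      + rewrite ltnS leq_eqVlt => /orP[/eqP -> Fk|jk Fj]; [by right; exact/mem_set|left].
        by apply/mem_set; exists j.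
      + by apply/mem_set; exists j => //=; exact: ltnW.
      + by apply/mem_set; exists k => /=.
    have : dot g (\1_((\bigcup_(j < k) F j) `&` B)) @[k --> \oo] --> dot g (\1_((\bigcup_k F k) `&` B)).
      apply: (cvg_dot_bounded mD Doo (B := 1)) => //.
      + by apply: L2_indic => //; apply: measurableI => //; exact: bigcupT_measurable.
      + by move=> k; apply: L2_indic => //; exact: measurableI.
      + move=> k x _; rewrite !indicE; case: (_ \in _); case: (_ \in _);
        by rewrite ler_norml /=; apply/andP; split; lra.
      + move=> x _; rewrite indicE; case: (boolP (x \in _)) => [/set_mem[[j _ Fj] Bx]|/negP xF].
          apply: cvg_near_cst; near=> k; rewrite indicE mem_set//; split => //.
          by exists j => //=; near: k; exact: nbhs_infty_gt.
        rewrite (_ : (fun k => _) = fun=> 0); first exact: cvg_cst.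
        apply/funext => k; rewrite indicE memNset// => -[[j _ Fj] Bx].
        by apply: xF; apply/mem_set; split => //; exists j.
    rewrite (_ : (fun k => _) = fun=> 0); last by apply/funext.
    by move=> /(cvg_unique _)/(_ (cvg_cst _)) ->.
have [mg _] := g2.
(* Testing with the sign of [g], a difference of two indicators, turns orthogonality into a
   vanishing integral of the absolute value of [g] over the box. *)
pose Gp := D `&` g @^-1` `]0, +oo[%classic; pose Gn := D `&` g @^-1` `]-oo, 0[%classic.
have mGp : measurable Gp by apply: mg => //.
have mGn : measurable Gn by apply: mg => //.
pose h x : R := \1_(Gp `&` B) x - \1_(Gn `&` B) x.
have h2 : L2 h by apply: L2B => //; apply: L2_indic => //; exact: measurableI.
have h0 : dot g h = 0.
  by rewrite dotBr// ?(PS _ mGp).2 ?(PS _ mGn).2 ?subrr//; apply: L2_indic => //; exact: measurableI.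
have gh x : D x -> `|g x * \1_B x| = g x * h x.
  move=> Dx; rewrite /h !indicE !in_setI.
  case: (x \in B); rewrite ?andbF ?subrr ?mulr0 ?normr0// !andbT mulr1.
  rewrite (mem_set Dx) !andTb.
  have -> : (x \in g @^-1` `]0, +oo[%classic) = (0 < g x).
    by apply/idP/idP => [/set_mem|H]; rewrite ?inE /= in_itv/= andbT.
  have -> : (x \in g @^-1` `]-oo, 0[%classic) = (g x < 0).
    by apply/idP/idP => [/set_mem|H]; rewrite ?inE /= in_itv/=.
  by have [g0|g0|->] := ltgtP (g x) 0; [rewrite ltr0_norm// sub0r mulrN1|
    rewrite gtr0_norm// subr0 mulr1|rewrite normr0 mul0r].
have igB : L2 (\1_B) by exact: L2_indic.
have mgB : measurable_fun D (fun x => (g x * \1_B x)%:E).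
  by apply/measurable_EFinP; apply: measurable_funM => //; have [] := igB.
have gB0 : (\int[leb R n]_(x in D) `|(g x * \1_B x)%:E| = 0)%E.
  rewrite -[RHS]/(0%:E) -h0 /dot_L2 /Rintegral fineK; last first.
    by apply: integrable_fin_num => //; exact: L2_mul_integrable.
  by apply: eq_integral => x /set_mem Dx; rewrite -gh.
have := (ae_eq_integral_abs _ mD mgB).1 gB0.
by apply: filterS => x H Bx; have := H (BD x Bx); rewrite indicE mem_set// mulr1 => -[].
Unshelve. all: by end_near.
Qed.

Lemma fundamental_lemma : {ae leb R n, forall x, D x -> g x = 0}.
Proof.
(* Pairs of rational corners are enumerated by their codes, so that countably many null sets are
   joined; a number that codes no pair imposes no condition. *)
pose F (k : nat) : set 'cV[R]_n := if unpickle k is Some (a, b)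
  then [set x | cbox (ratcV R a) (ratcV R b) `<=` D -> box (ratcV R a) (ratcV R b) x -> g x = 0]
  else setT.
have : {ae leb R n, forall x k, F k x}.
  apply/ae_foralln => k; rewrite /F; case: unpickle => [[a b]|]; last exact: aeW.
  have [abD|abD] := pselect (cbox (ratcV R a) (ratcV R b) `<=` D); last by apply: aeW => x /abD.
  by apply: filterS (fundamental_lemma_box abD) => x H _; exact: H.
apply: filterS => x H Dx; have [a [b [xab abD]]] := open_rat_box oD Dx.
by have := H (pickle (a, b)); rewrite /F pickleK; exact.
Qed.

End scalar.

Lemma fundamental_lemma_vector k (f : 'cV[R]_n -> 'cV[R]_k) : L2v D f ->
  (forall phi, C1c D phi -> dot_L2v D f phi = 0) ->
  {ae leb R n, forall x, D x -> f x = 0}.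
Proof.
move=> f2 fphi.
have H i : {ae leb R n, forall x, D x -> f x i ord0 = 0}.
  apply: fundamental_lemma => // phi C1phi [K [cK KD phiK]].
  pose Phi x : 'cV[R]_k := phi x *: delta_mx i ord0.
  rewrite -[RHS](fphi Phi); last first.
    split; last by exists K; split => // x /phiK; rewrite /Phi => ->; rewrite scale0r.
    move=> j; rewrite (_ : (fun x => _) = fun x => phi x * (j == i)%:R).
      by apply: C1M => //; exact: C1_cst.
    by apply/funext => x; rewrite !mxE eqxx andbT.
  apply: eq_Rintegral => x _; rewrite /dotv (bigD1 i)//= big1 ?addr0.
    by rewrite !mxE !eqxx mulr1.
  by move=> j ji; rewrite !mxE (negbTE ji) mulr0 mulr0.
have : {ae leb R n, forall x i, D x -> f x i ord0 = 0} by exact: filter_forall.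
by apply: filterS => x Hx Dx; apply/colP => i; rewrite mxE Hx.
Qed.

End fundamental_lemma.

(** * Weak curls and tensor products *)

Section test_functions.
Variable R : realType.

Lemma continuous_sum (T : topologicalType) (I : finType) (F : I -> T -> R) :
  (forall i, continuous (F i)) -> continuous (fun x => \sum_i F i x).
Proof.
move=> cF x; apply: cvg_big; first exact: add_continuous.
by move=> i _; exact: cF.
Qed.

Lemma compact_support_bounded n (f : 'cV[R]_n -> R) (K : set 'cV[R]_n) :
  continuous f -> compact K -> (forall x, ~ K x -> f x = 0) ->
  exists B, forall x, `|f x| <= B.
Proof.
move=> cf cK fK.
have /compact_bounded[M [_ fM]] : compact (f @` K).
  by apply: continuous_compact => //; exact: continuous_subspaceT.
have := fM (M + 1); rewrite ltrDl ltr01 => /(_ isT) {}fM.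
exists (Num.max 0 (M + 1)) => x; rewrite le_max.
have [Kx|/fK ->] := pselect (K x); last by rewrite normr0 lexx.
by rewrite (fM (f x)) ?orbT//; exists x.
Qed.

Lemma derive_off_support n (f : 'cV[R]_n -> R) (K : set 'cV[R]_n) v x :
  closed K -> (forall x, ~ K x -> f x = 0) -> ~ K x -> 'D_v f x = 0.
Proof.
move=> cK fK Kx.
have [->|v0] := eqVneq v 0.
  by rewrite /derive; under eq_fun do rewrite scaler0 /= add0r subrr scaler0; exact: lim_cst.
rewrite (@near_eq_derive _ _ _ f (fun=> 0) x v) ?derive_cst//.
have : nbhs x (~` K) by apply: open_nbhs_nbhs; split => //; exact: closed_openC.
by apply: filterS => y /fK.
Qed.

Section C1c.
Variables (n k : nat) (D : set 'cV[R]_n) (phi : 'cV[R]_n -> 'cV[R]_k).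
Hypothesis phiC : C1c D phi.

Lemma C1c_continuous i : continuous (fun x => phi x i ord0).
Proof. by apply: C1_continuous; have [+ _] := phiC; exact. Qed.

Lemma C1c_bounded i : exists B, forall x, `|phi x i ord0| <= B.
Proof.
have [_ [K [cK _ phiK]]] := phiC.
have := compact_support_bounded (@C1c_continuous i) cK; apply => x /phiK ->.
by rewrite mxE.
Qed.

Lemma C1c_derive_continuous i v : continuous (fun x => 'D_v (fun y => phi y i ord0) x).
Proof. by have [H _] := phiC; have [] := H i v. Qed.

Lemma C1c_derive_bounded i v :
  exists B, forall x, `|'D_v (fun y => phi y i ord0) x| <= B.
Proof.
have [_ [K [cK _ phiK]]] := phiC.
have := compact_support_bounded (@C1c_derive_continuous i v) cK; apply => x.
apply: derive_off_support => //.
  by apply: compact_closed => //; exact: norm_hausdorff.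
by move=> y /phiK ->; rewrite mxE.
Qed.

End C1c.

Lemma sum_delta2 (I J : finType) (a : I) (b : J) (F : I -> J -> R) :
  \sum_p \sum_q ((p == a) && (q == b))%:R * F p q = F a b.
Proof.
rewrite (bigD1 a)//= (bigD1 b)//= !eqxx mul1r !big1 ?addr0//.
  by move=> p /negbTE pa; rewrite big1// => q _; rewrite pa mul0r.
by move=> q /negbTE ->; rewrite mul0r.
Qed.

(** For [d = 3] this is the Levi-Civita symbol. With [curl_adj] as a sum of partial derivatives with
    constant coefficients, continuity, bounds and slicing are proved once for both dimensions. *)
Definition curl_coef (d : space_dim) : 'I_d -> 'I_d -> 'I_(curl_dim d) -> R :=
  match d with
  | Dim2 => fun i p q =>
     (i == ord0)%:R * ((p == inord 1) && (q == ord0))%:R -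
     (i != ord0)%:R * ((p == inord 0) && (q == ord0))%:R
  | Dim3 => fun i p q =>
     ((p == inord (i.+1 %% 3)) && (q == inord (i.+2 %% 3)))%:R -
     ((p == inord (i.+2 %% 3)) && (q == inord (i.+1 %% 3)))%:R
  end.

Lemma curl_adjE (d : space_dim) n (e : 'I_d -> 'cV[R]_n)
    (phi : 'cV[R]_n -> 'cV[R]_(curl_dim d)) z i :
  curl_adj e phi z i ord0 =
  \sum_p \sum_q curl_coef i p q * 'D_(e p) (fun y => phi y q ord0) z.
Proof.
case: d e phi i => e phi i.
- pose F (p : 'I_2) (q : 'I_1) := 'D_(e p) (fun y => phi y q ord0) z.
  transitivity ((i == ord0)%:R * F (inord 1) ord0 - (i != ord0)%:R * F (inord 0) ord0).
    rewrite /curl_adj /vec2 mxE -!/(F _ _); case: i => [[|[|]]]//= ?.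
      by rewrite mul1r mul0r subr0.
    by rewrite mul1r mul0r sub0r.
  rewrite -[X in _ * X - _](sum_delta2 _ _ F) -[X in _ - _ * X](sum_delta2 _ _ F).
  rewrite !mulr_sumr -sumrB; apply: eq_bigr => p _.
  rewrite !mulr_sumr -sumrB; apply: eq_bigr => q _.
  by rewrite !mulrA -mulrBl.
- pose F (p : 'I_3) (q : 'I_3) := 'D_(e p) (fun y => phi y q ord0) z.
  transitivity (F (inord (i.+1 %% 3)) (inord (i.+2 %% 3)) - F (inord (i.+2 %% 3)) (inord (i.+1 %% 3))).
    by rewrite /curl_adj /vec3 mxE -!/(F _ _); case: i => [[|[|[|]]]].
  rewrite -[X in X - _](sum_delta2 _ _ F) -[X in _ - X](sum_delta2 _ _ F).
  rewrite -sumrB; apply: eq_bigr => p _; rewrite -sumrB; apply: eq_bigr => q _.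
  by rewrite -mulrBl.
Qed.

Lemma difference_quotient_slice n (f : 'cV[R]_n.+1 -> R) (s : R) (x v : 'cV[R]_n) :
  (fun h => h^-1 *: (((fun y => f (cons_cV (s, y))) \o shift x) (h *: v) - f (cons_cV (s, x)))) =
  (fun h => h^-1 *: ((f \o shift (cons_cV (s, x))) (h *: cons_cV (0, v)) - f (cons_cV (s, x)))).
Proof.
apply/funext => h /=; congr (_ *: (f _ - _)).
apply/colP => i; have [j ->|->] := unliftP ord0 i; rewrite /shift [RHS]mxE [X in _ = X + _]mxE.
  by rewrite !cons_cVS !mxE.
by rewrite !cons_cV0 /= mulr0 add0r.
Qed.

Lemma derive_slice n (f : 'cV[R]_n.+1 -> R) (s : R) (x v : 'cV[R]_n) :
  'D_v (fun y => f (cons_cV (s, y))) x = 'D_(cons_cV (0, v)) f (cons_cV (s, x)).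
Proof.
by rewrite /derive difference_quotient_slice.
Qed.

Lemma derivable_slice n (f : 'cV[R]_n.+1 -> R) (s : R) (x v : 'cV[R]_n) :
  derivable f (cons_cV (s, x)) (cons_cV (0, v)) ->
  derivable (fun y => f (cons_cV (s, y))) x v.
Proof.
by rewrite /derivable difference_quotient_slice.
Qed.

(** Freezing the time keeps a test function admissible, since its support projects to a compact
    subset of [Omega]. *)
Lemma C1c_slice n k T (Omega : set 'cV[R]_n) (phi : 'cV[R]_n.+1 -> 'cV[R]_k) s :
  C1c (cylinder T Omega) phi -> C1c Omega (fun x => phi (cons_cV (s, x))).
Proof.
move=> [C1phi [K [cK KQ phiK]]]; split.
  move=> i v; have [Dv cv] := C1phi i (cons_cV (0, v)); split => [x|].
    exact: (@derivable_slice _ (fun z => phi z i ord0) s x v (Dv _)).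
  rewrite [X in continuous X](_ : _ = (fun x => 'D_(cons_cV (0, v)) (fun x => phi x i ord0) (cons_cV (s, x)))).
    move=> x; apply: (@continuous_comp _ _ _ (fun y => cons_cV (s, y))
      ('D_(cons_cV (0, v)) (fun x => phi x i ord0)) x); [exact: continuous_cons_cV|exact: cv].
  by apply/funext => x; rewrite (derive_slice (fun z => phi z i ord0)).
exists (@space_of R n @` K); split.
- by apply: continuous_compact => //; apply: continuous_subspaceT; exact: continuous_space_of.
- by move=> _ [z /KQ[_ Oz] <-].
- move=> x Kx; apply: phiK => Ksx; apply: Kx; exists (cons_cV (s, x)) => //.
  by rewrite space_of_cons.
Qed.

Lemma e_spaceE n (i : 'I_n) : e_space R i = cons_cV (0, delta_mx i ord0).
Proof.
apply/colP => j; have [l ->|->] := unliftP ord0 j.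
  by rewrite cons_cVS !mxE (inj_eq lift_inj).
by rewrite cons_cV0 mxE.
Qed.

Lemma curl_adj_slice (d : space_dim) (phi : 'cV[R]_d.+1 -> 'cV[R]_(curl_dim d)) s x :
  curl_adj (fun i : 'I_d => delta_mx i ord0) (fun y => phi (cons_cV (s, y))) x =
  curl_adj (@e_space R d) phi (cons_cV (s, x)).
Proof.
apply/colP => i; rewrite !curl_adjE; apply: eq_bigr => p _; apply: eq_bigr => q _.
by rewrite (derive_slice (fun z => phi z q ord0)) e_spaceE.
Qed.

Lemma curl_adj_continuous (d : space_dim) n (e : 'I_d -> 'cV[R]_n) D
  (phi : 'cV[R]_n -> 'cV[R]_(curl_dim d)) i : C1c D phi ->
  continuous (fun z => curl_adj e phi z i ord0).
Proof.
move=> phiC.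
rewrite (_ : (fun z => _) = (fun z => \sum_p \sum_q curl_coef i p q * 'D_(e p) (fun y => phi y q ord0) z)).
  apply: continuous_sum => p; apply: continuous_sum => q x.
  have := @C1c_derive_continuous _ _ _ _ phiC q (e p) x.
  exact: continuousM (@cst_continuous _ _ _ x).
by apply/funext => z; rewrite curl_adjE.
Qed.

Lemma curl_adj_bounded (d : space_dim) n (e : 'I_d -> 'cV[R]_n) D
  (phi : 'cV[R]_n -> 'cV[R]_(curl_dim d)) i : C1c D phi ->
  exists B, forall z, `|curl_adj e phi z i ord0| <= B.
Proof.
move=> phiC.
have /choice[B HB] (pq : 'I_d * 'I_(curl_dim d)) : exists B, forall z, `|'D_(e pq.1) (fun y => phi y pq.2 ord0) z| <= B.
  exact: C1c_derive_bounded phiC _ _.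
exists (\sum_p \sum_q `|curl_coef i p q| * B (p, q)) => z; rewrite curl_adjE.
rewrite (le_trans (ler_norm_sum _ _ _))// ler_sum// => p _.
rewrite (le_trans (ler_norm_sum _ _ _))// ler_sum// => q _.
by rewrite normrM ler_wpM2l// (HB (p, q)).
Qed.

End test_functions.

Section vector_valued_L2.
Variables (R : realType) (n k : nat) (D : set 'cV[R]_n).
Hypothesis mD : measurable D.
Implicit Types f g : 'cV[R]_n -> 'cV[R]_k.

Lemma L2v_sum (I : finType) (f : I -> 'cV[R]_n -> 'cV[R]_k) :
  (forall i, L2v D (f i)) -> L2v D (fun x => \sum_i f i x).
Proof.
move=> f2 j; rewrite (_ : (fun x => _) = fun x => \sum_i f i x j ord0).
  by apply: L2_sum => // i; exact: f2.
by apply/funext => x; rewrite summxE.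
Qed.

Lemma L2vZ (a : R) f : L2v D f -> L2v D (fun x => a *: f x).
Proof.
move=> f2 j; rewrite (_ : (fun x => _) = fun x => a * f x j ord0).
  by apply: L2Z => //; exact: f2.
by apply/funext => x; rewrite mxE.
Qed.

Lemma L2vB f g : L2v D f -> L2v D g -> L2v D (fun x => f x - g x).
Proof.
move=> f2 g2 j; rewrite (_ : (fun x => _) = fun x => f x j ord0 - g x j ord0).
  by apply: L2B.
by apply/funext => x; rewrite !mxE.
Qed.

Lemma dot_L2vE f g : L2v D f -> L2v D g ->
  dot_L2v D f g = \sum_i dot_L2 (leb R n) D (fun x => f x i ord0) (fun x => g x i ord0).
Proof.
move=> f2 g2; rewrite /dot_L2v /dotv.
have H (r : seq 'I_k) : (leb R n).-integrable D (fun x => (\sum_(i <- r) f x i ord0 * g x i ord0)%:E) /\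
   \int[leb R n]_(x in D) (\sum_(i <- r) f x i ord0 * g x i ord0) =
   \sum_(i <- r) dot_L2 (leb R n) D (fun x => f x i ord0) (fun x => g x i ord0).
  elim: r => [|i r [IH1 IH2]].
    split; first by under eq_fun do rewrite big_nil; exact: integrable0.
    by rewrite big_nil; rewrite /Rintegral integral0_eq// => x _; rewrite big_nil.
  have ii := L2_mul_integrable mD (f2 i) (g2 i).
  split; first by under eq_fun do rewrite big_cons EFinD; exact: integrableD.
  by rewrite big_cons; under eq_Rintegral do rewrite big_cons; rewrite RintegralD// IH2.
by have [] := H (index_enum _).
Qed.

Lemma ae_eq_dot_L2v f f' g g' :
  {ae leb R n, forall x, D x -> f x = f' x} ->
  {ae leb R n, forall x, D x -> g x = g' x} -> dot_L2v D f g = dot_L2v D f' g'.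
Proof.
move=> ff gg; congr fine; apply: ae_eq_integral_nomeas.
by apply: filterS2 ff gg => x fx gx Dx; rewrite fx// gx.
Qed.

Lemma dot_L2v_suml (I : finType) (f : I -> 'cV[R]_n -> 'cV[R]_k) g :
  (forall i, L2v D (f i)) -> L2v D g ->
  dot_L2v D (fun x => \sum_i f i x) g = \sum_i dot_L2v D (f i) g.
Proof.
move=> f2 g2; rewrite dot_L2vE//; last exact: L2v_sum.
under [RHS]eq_bigr do rewrite dot_L2vE//.
rewrite exchange_big/=; apply: eq_bigr => j _.
have := @dot_suml _ _ _ (leb R n) D mD I (index_enum _) (fun=> 1) (fun i x => f i x j ord0)
  (fun x => g x j ord0) (fun i => f2 i j) (g2 j).
under [RHS]eq_bigr do rewrite mul1r.
move=> <-; congr dot_L2; apply/funext => x; rewrite summxE.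
by apply: eq_bigr => i _; rewrite mul1r.
Qed.

Lemma dot_L2vC f g : dot_L2v D f g = dot_L2v D g f.
Proof.
by apply: eq_Rintegral => x _; apply: eq_bigr => i _; rewrite mulrC.
Qed.

Lemma dot_L2v_sumr (I : finType) (f : I -> 'cV[R]_n -> 'cV[R]_k) g :
  (forall i, L2v D (f i)) -> L2v D g ->
  dot_L2v D g (fun x => \sum_i f i x) = \sum_i dot_L2v D g (f i).
Proof.
move=> f2 g2; rewrite dot_L2vC dot_L2v_suml//.
by apply: eq_bigr => i _; rewrite dot_L2vC.
Qed.

Lemma dot_L2vZl a f g : L2v D f -> L2v D g ->
  dot_L2v D (fun x => a *: f x) g = a * dot_L2v D f g.
Proof.
move=> f2 g2; rewrite !dot_L2vE//; last exact: L2vZ.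
rewrite mulr_sumr; apply: eq_bigr => i _; rewrite -dotZl//.
by congr dot_L2; apply/funext => x; rewrite mxE.
Qed.

Lemma dot_L2vZr a f g : L2v D f -> L2v D g ->
  dot_L2v D g (fun x => a *: f x) = a * dot_L2v D g f.
Proof. by move=> f2 g2; rewrite dot_L2vC dot_L2vZl// dot_L2vC. Qed.

Lemma dot_L2vBl f f' g : L2v D f -> L2v D f' -> L2v D g ->
  dot_L2v D (fun x => f x - f' x) g = dot_L2v D f g - dot_L2v D f' g.
Proof.
move=> f2 f2' g2; rewrite !dot_L2vE//; last exact: L2vB.
rewrite -sumrB; apply: eq_bigr => i _; rewrite -dotBl//.
by congr dot_L2; apply/funext => x; rewrite !mxE.
Qed.

End vector_valued_L2.

Section L2_convergence_linear.
Context d (X : measurableType d) (R : realType).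
Variables (m : {measure set X -> \bar R}) (D : set X).
Hypothesis mD : measurable D.

Lemma cvg_L2D (f g : nat -> X -> R) (f' g' : X -> R) :
  (forall k, L2 m D (f k)) -> (forall k, L2 m D (g k)) -> L2 m D f' -> L2 m D g' ->
  cvg_L2 m D f f' -> cvg_L2 m D g g' ->
  cvg_L2 m D (fun k x => f k x + g k x) (fun x => f' x + g' x).
Proof.
move=> f2 g2 f2' g2'.
move=> /(cvg_L2P mD f2 f2') ff /(cvg_L2P mD g2 g2') gg.
apply/(cvg_L2P mD); [by move=> k; exact: L2D|exact: L2D|].
have le k : dist2 m D (fun x => f k x + g k x) (fun x => f' x + g' x) <=
    2 * dist2 m D (f k) f' + 2 * dist2 m D (g k) g'.
  have := dist2_triangle mD (L2D mD (f2 k) (g2 k)) (L2D mD f2' (g2 k)) (L2D mD f2' g2').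
  move=> /le_trans; apply; rewrite [X in 2 * X + _](_ : _ = dist2 m D (f k) f'); last first.
    by apply: eq_Rintegral => x _; ring.
  rewrite [X in _ + 2 * X <= _](_ : _ = dist2 m D (g k) g')//.
  by apply: eq_Rintegral => x _; ring.
have lim0 : 2 * dist2 m D (f k) f' + 2 * dist2 m D (g k) g' @[k --> \oo] --> 2 * 0 + 2 * (0 : R).
  by apply: cvgD; apply: cvgM; [exact: cvg_cst|exact: ff|exact: cvg_cst|exact: gg].
rewrite !mulr0 addr0 in lim0.
apply: (squeeze_cvgr _ (cvg_cst 0) lim0).
by apply: nearW => k; rewrite dist2_ge0 le.
Qed.

Lemma cvg_L2Z (a : R) (f : nat -> X -> R) (g : X -> R) :
  (forall k, L2 m D (f k)) -> L2 m D g -> cvg_L2 m D f g ->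
  cvg_L2 m D (fun k x => a * f k x) (fun x => a * g x).
Proof.
move=> f2 g2 /(cvg_L2P mD f2 g2) fg; apply/(cvg_L2P mD).
- by move=> k; exact: L2Z.
- exact: L2Z.
rewrite (_ : (fun k => _) = fun k => a ^+ 2 * dist2 m D (f k) g).
  by rewrite -(mulr0 (a ^+ 2)); apply: cvgM; [exact: cvg_cst|exact: fg].
apply/funext => k; rewrite -(dot_ZZ mD)//; last exact: L2B.
by apply: eq_Rintegral => x _; ring.
Qed.

Lemma cvg_L2_sum (I : Type) (r : seq I) (f : I -> nat -> X -> R) (f' : I -> X -> R) :
  (forall i k, L2 m D (f i k)) -> (forall i, L2 m D (f' i)) ->
  (forall i, cvg_L2 m D (f i) (f' i)) ->
  cvg_L2 m D (fun k x => \sum_(i <- r) f i k x) (fun x => \sum_(i <- r) f' i x).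
Proof.
move=> f2 f2' ff; elim: r => [|i r IH].
  apply/(cvg_L2P mD).
  - by move=> k; apply: (L2_sum mD) => i; exact: f2.
  - exact: (L2_sum mD).
  - rewrite (_ : (fun k => _) = fun=> 0); first exact: cvg_cst.
    apply/funext => k; rewrite /dist2 (_ : (fun x => _) = fun=> 0) ?dot0l//.
    by apply/funext => x; rewrite !big_nil subrr.
rewrite (_ : (fun k x => _) = (fun k x => f i k x + \sum_(j <- r) f j k x)); last first.
  by apply/funext => k; apply/funext => x; rewrite big_cons.
rewrite (_ : (fun x => _) = (fun x => f' i x + \sum_(j <- r) f' j x)); last first.
  by apply/funext => x; rewrite big_cons.
apply: cvg_L2D => //.
- by move=> k; apply: (L2_sum mD) => j; exact: f2.
- exact: (L2_sum mD).
Qed.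

End L2_convergence_linear.

(** * Tensor products on the space-time cylinder *)

Section tensor.
Variables (R : realType) (n k : nat) (T : R) (Omega : set 'cV[R]_n).
Hypotheses (T0 : 0 < T) (oO : open Omega) (bO : bounded_set Omega).
Local Notation mu := (@lebesgue_measure R).
Local Notation I := (`]0, T[%classic : set (measurableTypeR R)).
Local Notation Q := (cylinder T Omega).

Let mI : measurable I. Proof. exact: measurable_itvoo. Qed.
Let mO : measurable Omega. Proof. exact: open_measurable_cV. Qed.

Lemma measurable_cylinder : measurable Q.
Proof. by apply: open_measurable_cV; exact: open_cylinder. Qed.
Let mQ := measurable_cylinder.

Lemma L2_tensorQ (f : R -> R) (g : 'cV[R]_n -> R) : L2 mu I f -> L2 (leb R n) Omega g ->
  L2 (leb R n.+1) Q (fun z => f (time_of z) * g (space_of z)).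
Proof. by rewrite cylinderE; exact: L2_tensor. Qed.

Lemma dot_tensorQ (f f' : R -> R) (g g' : 'cV[R]_n -> R) :
  L2 mu I f -> L2 mu I f' -> L2 (leb R n) Omega g -> L2 (leb R n) Omega g' ->
  dot_L2 (leb R n.+1) Q (fun z => f (time_of z) * g (space_of z))
    (fun z => f' (time_of z) * g' (space_of z)) =
  dot_L2 mu I f f' * dot_L2 (leb R n) Omega g g'.
Proof. by rewrite cylinderE; exact: dot_tensor. Qed.

Lemma L2v_tensor (f : R -> R) (G : 'cV[R]_n -> 'cV[R]_k) : L2 mu I f -> L2v Omega G ->
  L2v Q (fun z => f (time_of z) *: G (space_of z)).
Proof.
move=> f2 G2 i; rewrite (_ : (fun z => _) = fun z => f (time_of z) * G (space_of z) i ord0).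
  by apply: (L2_tensorQ (g := fun x => G x i ord0)) => //; exact: G2.
by apply/funext => z; rewrite mxE.
Qed.

Lemma dot_L2v_tensor (f f' : R -> R) (G G' : 'cV[R]_n -> 'cV[R]_k) :
  L2 mu I f -> L2 mu I f' -> L2v Omega G -> L2v Omega G' ->
  dot_L2v Q (fun z => f (time_of z) *: G (space_of z))
    (fun z => f' (time_of z) *: G' (space_of z)) =
  dot_L2 mu I f f' * dot_L2v Omega G G'.
Proof.
move=> f2 f2' G2 G2'; rewrite !dot_L2vE//; try exact: L2v_tensor.
rewrite mulr_sumr; apply: eq_bigr => i _.
rewrite -(dot_tensorQ f2 f2' (G2 i) (G2' i)).
by congr dot_L2; apply/funext => z; rewrite mxE.
Qed.

(** The time functions enter only through their Gram matrix, which is the same for the sines and the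
    cosines; this gives the isometry for coefficients depending on space. *)
Lemma dot_tensor_sum (J : Type) (r : seq J) (s : J -> R -> R) (e : J -> 'cV[R]_n -> R) :
  (forall j, L2 mu I (s j)) -> (forall j, L2 (leb R n) Omega (e j)) ->
  dot_L2 (leb R n.+1) Q (fun z => \sum_(j <- r) s j (time_of z) * e j (space_of z))
    (fun z => \sum_(j <- r) s j (time_of z) * e j (space_of z)) =
  \sum_(j <- r) \sum_(l <- r) dot_L2 mu I (s j) (s l) * dot_L2 (leb R n) Omega (e j) (e l).
Proof.
move=> s2 e2; pose F j z := s j (time_of z) * e j (space_of z).
have F2 j : L2 (leb R n.+1) Q (F j) by exact: L2_tensorQ.
pose S z := \sum_(j <- r) F j z.
have S2 : L2 (leb R n.+1) Q S by exact: (L2_sum mQ).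
rewrite -/S [LHS](_ : _ = dot_L2 (leb R n.+1) Q (fun z => \sum_(j <- r) 1 * F j z) S); last first.
  by congr dot_L2; apply/funext => z; apply: eq_bigr => j _; rewrite mul1r.
rewrite (dot_suml mQ)//; apply: eq_bigr => j _; rewrite mul1r.
rewrite [LHS](_ : _ = dot_L2 (leb R n.+1) Q (F j) (fun z => \sum_(j <- r) 1 * F j z)); last first.
  by congr dot_L2; apply/funext => z; apply: eq_bigr => l _; rewrite mul1r.
rewrite (dot_sumr mQ)//; apply: eq_bigr => l _; rewrite mul1r.
exact: dot_tensorQ.
Qed.

Lemma cvg_L2_tensor (f : nat -> R -> R) (f' : R -> R) (g : 'cV[R]_n -> R) :
  (forall j, L2 mu I (f j)) -> L2 mu I f' -> L2 (leb R n) Omega g -> cvg_L2 mu I f f' ->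
  cvg_L2 (leb R n.+1) Q (fun j z => f j (time_of z) * g (space_of z))
    (fun z => f' (time_of z) * g (space_of z)).
Proof.
move=> f2 f2' g2 /(cvg_L2P mI f2 f2') ff; apply/(cvg_L2P mQ).
- by move=> j; exact: L2_tensorQ.
- exact: L2_tensorQ.
rewrite (_ : (fun j => _) = (fun j => dist2 mu I (f j) f' * dot_L2 (leb R n) Omega g g)).
  have : dist2 mu I (f j) f' * dot_L2 (leb R n) Omega g g @[j --> \oo] --> 0 * dot_L2 (leb R n) Omega g g.
    by apply: cvgM; [exact: ff|exact: cvg_cst].
  by rewrite mul0r.
apply/funext => j; rewrite -dot_tensorQ//; try exact: (L2B mI).
by apply: eq_Rintegral => z _; ring.
Qed.

(** The right-hand side has the two required expansions, so the choice in [mhilbert_x] succeeds. The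
    chosen value may come with other coefficient functions, and the isometry identifies it almost
    everywhere. *)
Lemma mhilbert_x_tensor (J : finType) (f f' : J -> R -> R) (B : J -> R)
    (G : J -> 'cV[R]_n -> 'cV[R]_k) (v : 'cV[R]_n.+1 -> 'cV[R]_k) :
  (forall j, {ae mu, forall s, I s -> f j s = f' j s}) ->
  (forall j, measurable_fun I (f' j)) ->
  (forall j s, I s -> `|f' j s| <= B j) ->
  (forall j, L2v Omega (G j)) ->
  {ae leb R n.+1, forall z, Q z -> v z = \sum_j f j (time_of z) *: G j (space_of z)} ->
  {ae leb R n.+1, forall z, Q z ->
    mhilbert_x T Omega v z = \sum_j mhilbert T (f j) (time_of z) *: G j (space_of z)}.
Proof.
move=> ff mf fB G2 vE.
have [c cP] := choice (fun j => (mhilbertP T0 (ff j) (mf j) (fB j)).2).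
have H2 j : L2 mu I (mhilbert T (f j)) := (mhilbertP T0 (ff j) (mf j) (fB j)).1.
have f2' j : L2 mu I (f' j) by exact: (L2_bounded mI (measure_time_lty T0) (mf j) (fB j)).
pose v' z := \sum_j f' j (time_of z) *: G j (space_of z).
have vv' : {ae leb R n.+1, forall z, Q z -> v z = v' z}.
  have : {ae leb R n.+1, forall z j, I (time_of z) -> f j (time_of z) = f' j (time_of z)}.
    by apply: filter_forall => j; exact: (@ae_time_of _ n (fun s => I s -> f j s = f' j s)).
  apply: filterS2 vE => z vz fz Qz; rewrite vz//; apply: eq_bigr => j _.
  by rewrite fz//= in_itv/=; case: Qz.
pose w z := \sum_j mhilbert T (f j) (time_of z) *: G j (space_of z).
(* The coefficient functions of [v]: the scalar expansions of all time factors collected frequency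
   by frequency. *)
pose a l x := \sum_j c j l *: G j x.
have a2 l : L2v Omega (a l) by apply: L2v_sum => // j; exact: L2vZ.
have v2' : L2v Q v' by apply: L2v_sum => // j; exact: L2v_tensor.
have w2 : L2v Q w by apply: L2v_sum => // j; exact: L2v_tensor.
pose P w := L2v Q w /\ exists c : nat -> 'cV[R]_n -> 'cV[R]_k,
    [/\ forall j, L2v Omega (c j),
      cvg_L2v Q (fun m z =>
        \sum_(j < m) sin (freq T j * time_of z) *: c j (space_of z)) v &
      cvg_L2v Q (fun m z =>
        \sum_(j < m) cos (freq T j * time_of z) *: c j (space_of z)) w].
have P1 : P w.
  split => //; exists a; split => // i.
  - apply: (@ae_eq_cvg_L2 _ _ _ _ _ _ (fun z => v' z i ord0)).
      by apply: filterS vv' => z vz Qz; rewrite vz.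
    rewrite (_ : (fun m z => _) = (fun m z => \sum_j sin_sum T (c j) m (time_of z) * G j (space_of z) i ord0)); last first.
      apply/funext => m; apply/funext => z; rewrite summxE.
      under [RHS]eq_bigr do rewrite mulr_suml.
      rewrite exchange_big/=; apply: eq_bigr => l _.
      rewrite mxE summxE mulr_sumr; apply: eq_bigr => j _; rewrite mxE; ring.
    rewrite (_ : (fun z => _) = (fun z => \sum_j f' j (time_of z) * G j (space_of z) i ord0)); last first.
      by apply/funext => z; rewrite summxE; apply: eq_bigr => j _; rewrite mxE.
    apply: (@cvg_L2_sum _ _ _ _ _ mQ _ _ (fun j m z => sin_sum T (c j) m (time_of z) * G j (space_of z) i ord0)
       (fun j z => f' j (time_of z) * G j (space_of z) i ord0)).
    + by move=> j m; apply: (L2_tensorQ (g := fun x => G j x i ord0)); [exact: L2_sin_sum|exact: G2].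
    + by move=> j; apply: (L2_tensorQ (g := fun x => G j x i ord0)); [exact: f2'|exact: G2].
    + move=> j; apply: (cvg_L2_tensor (g := fun x => G j x i ord0)) => //.
      * by move=> m; exact: L2_sin_sum.
      * exact: G2.
      * exact: (cP j).1.
  - rewrite (_ : (fun m z => _) = (fun m z => \sum_j cos_sum T (c j) m (time_of z) * G j (space_of z) i ord0)); last first.
      apply/funext => m; apply/funext => z; rewrite summxE.
      under [RHS]eq_bigr do rewrite mulr_suml.
      rewrite exchange_big/=; apply: eq_bigr => l _.
      rewrite mxE summxE mulr_sumr; apply: eq_bigr => j _; rewrite mxE; ring.
    rewrite (_ : (fun z => w z i ord0) = (fun z => \sum_j mhilbert T (f j) (time_of z) * G j (space_of z) i ord0)); last first.
      by apply/funext => z; rewrite summxE; apply: eq_bigr => j _; rewrite mxE.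
    apply: (@cvg_L2_sum _ _ _ _ _ mQ _ _ (fun j m z => cos_sum T (c j) m (time_of z) * G j (space_of z) i ord0)
       (fun j z => mhilbert T (f j) (time_of z) * G j (space_of z) i ord0)).
    + by move=> j m; apply: (L2_tensorQ (g := fun x => G j x i ord0)); [exact: L2_cos_sum|exact: G2].
    + by move=> j; apply: (L2_tensorQ (g := fun x => G j x i ord0)); [exact: H2|exact: G2].
    + move=> j; apply: (cvg_L2_tensor (g := fun x => G j x i ord0)) => //.
      * by move=> m; exact: L2_cos_sum.
      * exact: G2.
      * exact: (cP j).2.
(* [b] belongs to the chosen value and is unrelated to [a]; what they share is the limit of the sine
   sums. *)
have [w2' [b [b2 Sb Cb]]] := @xgetPex _ (fun=> 0) P (ex_intro _ w P1).
rewrite -/(mhilbert_x T Omega v) in w2' Cb *.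
have [_ [a' [a2' Sa Ca]]] := P1.
have sumL2 (s : nat -> R -> R) (e : nat -> 'cV[R]_n -> 'cV[R]_k) i m :
    (forall j, L2 mu I (s j)) -> (forall j, L2v Omega (e j)) ->
    L2 (leb R n.+1) Q (fun z => (\sum_(j < m) s j (time_of z) *: e j (space_of z)) i ord0).
  move=> s2 e2; have := @L2v_sum R n.+1 k Q mQ 'I_m (fun j z => s j (time_of z) *: e j (space_of z)).
  by apply => j; exact: L2v_tensor.
have comp i : {ae leb R n.+1, forall z, Q z -> mhilbert_x T Omega v z i ord0 = w z i ord0}.
  pose S (e : nat -> 'cV[R]_n -> 'cV[R]_k) (s : nat -> R -> R) (m : nat) z := (\sum_(j < m) s j (time_of z) *: e j (space_of z) : 'cV[R]_k) i ord0.
  apply: (@cvg_L2_isometry_unique _ _ _ _ _ mQ (S b (sink T)) (S a' (sink T))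
    (S b (cosk T)) (S a' (cosk T)) (fun z => v' z i ord0)) => //.
  - by move=> m; apply: sumL2 => // j; exact: L2_sink.
  - by move=> m; apply: sumL2 => // j; exact: L2_sink.
  - by move=> m; apply: sumL2 => // j; exact: L2_cosk.
  - by move=> m; apply: sumL2 => // j; exact: L2_cosk.
  - move=> m.
    have E s : (forall j, L2 mu I (s j)) -> dist2 (leb R n.+1) Q (S b s m) (S a' s m) =
        \sum_(j < m) \sum_(l < m) dot_L2 mu I (s j) (s l) *
          dot_L2 (leb R n) Omega (fun x => b j x i ord0 - a' j x i ord0) (fun x => b l x i ord0 - a' l x i ord0).
      move=> s2; rewrite -(dot_tensor_sum (index_enum 'I_m) (s := s)
        (e := fun (j : 'I_m) x => b j x i ord0 - a' j x i ord0))//.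
        rewrite /dist2; congr dot_L2; apply/funext => z; rewrite /S !summxE -sumrB;
        by apply: eq_bigr => j _; rewrite !mxE mulrBr.
      by move=> j; apply: (L2B mO); [exact: b2|exact: a2'].
    rewrite !E; last 2 first.
      by move=> j; exact: L2_sink.
      by move=> j; exact: L2_cosk.
    apply: eq_bigr => j _; apply: eq_bigr => l _; congr (_ * _).
    by rewrite dot_sink// dot_cosk.
  - apply: (@ae_eq_cvg_L2 _ _ _ _ _ _ (fun z => v z i ord0)); last exact: Sb.
    by apply: filterS vv' => z vz Qz; rewrite vz.
  - apply: (@ae_eq_cvg_L2 _ _ _ _ _ _ (fun z => v z i ord0)); last exact: Sa.
    by apply: filterS vv' => z vz Qz; rewrite vz.
  - exact: Cb.
  - exact: Ca.
have : {ae leb R n.+1, forall z i, Q z -> mhilbert_x T Omega v z i ord0 = w z i ord0} by exact: filter_forall.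
by apply: filterS => z Hz Qz; apply/colP => i; rewrite Hz.
Qed.

End tensor.

Section dotv_integrable.
Variables (R : realType) (n k : nat) (D : set 'cV[R]_n).
Hypothesis mD : measurable D.

Lemma dotv_integrable (f g : 'cV[R]_n -> 'cV[R]_k) : L2v D f -> L2v D g ->
  (leb R n).-integrable D (fun x => (dotv (f x) (g x))%:E).
Proof.
move=> f2 g2; under eq_fun do rewrite /dotv -sumEFin.
by apply: integrable_sum => // i _; exact: (L2_mul_integrable mD (f2 i) (g2 i)).
Qed.

Lemma L2v_continuous (f : 'cV[R]_n -> 'cV[R]_k) : (leb R n D < +oo)%E ->
  (forall i, continuous (fun x => f x i ord0)) ->
  (forall i, exists B, forall x, `|f x i ord0| <= B) -> L2v D f.
Proof.
move=> Doo cf fB i; have [B fB'] := fB i.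
apply: (L2_bounded mD (C := B)) => //.
by apply: measurable_funTS; exact: continuous_measurable_cV.
Qed.

End dotv_integrable.

(** * Uniqueness of the weak curl *)

Section weak_curl.
Variables (R : realType) (d : space_dim) (n : nat) (e : 'I_d -> 'cV[R]_n) (D : set 'cV[R]_n).
Hypotheses (oD : open D) (Doo : (leb R n D < +oo)%E).

Let mD : measurable D. Proof. exact: open_measurable_cV. Qed.

Lemma C1c_L2v k (phi : 'cV[R]_n -> 'cV[R]_k) : C1c D phi -> L2v D phi.
Proof.
move=> phiC; apply: L2v_continuous => // i; last exact: C1c_bounded phiC i.
exact: C1c_continuous phiC _.
Qed.

Lemma curl_adj_L2v (phi : 'cV[R]_n -> 'cV[R]_(curl_dim d)) : C1c D phi ->
  L2v D (curl_adj e phi).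
Proof.
move=> phiC; apply: L2v_continuous => // i; last exact: curl_adj_bounded phiC.
exact: curl_adj_continuous phiC.
Qed.

Lemma weak_curl_unique f g g' : is_weak_curl e D f g -> is_weak_curl e D f g' ->
  {ae leb R n, forall x, D x -> g x = g' x}.
Proof.
move=> [g2 gf] [g2' gf'].
have : {ae leb R n, forall x, D x -> g x - g' x = 0}.
  apply: (fundamental_lemma_vector oD Doo); first exact: L2vB.
  by move=> phi phiC; rewrite dot_L2vBl ?gf ?gf' ?subrr//; exact: C1c_L2v.
by apply: filterS => x H Dx; apply/eqP; rewrite -subr_eq0 H.
Qed.

Lemma weak_curlE f g : is_weak_curl e D f g ->
  {ae leb R n, forall x, D x -> weak_curl e D f x = g x}.
Proof.
move=> fg; apply: (@weak_curl_unique f) => //.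
exact: (@xgetPex _ (fun=> 0) [set g | is_weak_curl e D f g] (ex_intro _ g fg)).
Qed.

End weak_curl.

Lemma is_weak_curlZ (R : realType) (d : space_dim) n (e : 'I_d -> 'cV[R]_n) (D : set 'cV[R]_n)
    (oD : open D) (Doo : (leb R n D < +oo)%E) (a : R) f g :
  L2v D f -> is_weak_curl e D f g -> is_weak_curl e D (fun x => a *: f x) (fun x => a *: g x).
Proof.
move=> f2 [g2 fg]; have mD := open_measurable_cV oD.
split; first exact: L2vZ.
move=> phi phiC; have p2 := C1c_L2v oD Doo phiC; have c2 := curl_adj_L2v e oD Doo phiC.
by rewrite !dot_L2vZl// fg.
Qed.

(** * Weak curls of sums of tensors *)

Section tensor_curl.
Variables (R : realType) (d : space_dim) (T : R) (Omega : set 'cV[R]_d).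
Hypotheses (T0 : 0 < T) (oO : open Omega) (bO : bounded_set Omega).
Local Notation mu := (@lebesgue_measure R).
Local Notation I := (`]0, T[%classic : set (measurableTypeR R)).
Local Notation Q := (cylinder T Omega).

Let mI : measurable I. Proof. exact: measurable_itvoo. Qed.
Let mO : measurable Omega. Proof. exact: open_measurable_cV. Qed.
Let mQ : measurable Q. Proof. exact: measurable_cylinder. Qed.
Let Ooo : (leb R d Omega < +oo)%E. Proof. exact: leb_bounded_set. Qed.
Let Qoo : (leb R d.+1 Q < +oo)%E. Proof. exact: leb_cylinder_lty. Qed.

(** Fubini with time as the outer integral, so that at each fixed [s] the weak curl of [G] can be
    tested against the slice. *)
Lemma dot_L2v_slice k (f : R -> R) (G : 'cV[R]_d -> 'cV[R]_k) (Phi : 'cV[R]_d.+1 -> 'cV[R]_k) :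
  L2 mu I f -> L2v Omega G -> (forall i, continuous (fun z => Phi z i ord0)) ->
  (forall i, exists B, forall z, `|Phi z i ord0| <= B) ->
  dot_L2v Q (fun z => f (time_of z) *: G (space_of z)) Phi =
  \int[mu]_(s in I) (f s * dot_L2v Omega G (fun x => Phi (cons_cV (s, x)))).
Proof.
move=> f2 G2 cPhi bPhi.
have P2 : L2v Q Phi by exact: L2v_continuous.
have Ps2 s : L2v Omega (fun x => Phi (cons_cV (s, x))).
  apply: L2v_continuous => // i; last by have [B HB] := bPhi i; exists B => x; exact: HB.
  move=> x; apply: (@continuous_comp _ _ _ (fun y => cons_cV (s, y)) (fun z => Phi z i ord0)).
    exact: continuous_cons_cV.
  exact: cPhi.
have T2 : L2v Q (fun z => f (time_of z) *: G (space_of z)) by exact: L2v_tensor.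
have iF := dotv_integrable mQ T2 P2.
rewrite /dot_L2v /Rintegral; congr fine.
rewrite cylinderE in iF *; rewrite (prod_set_Fubini12 mI mO iF).
apply: eq_integral => s _; rewrite EFinM fineK; last first.
  by apply: integrable_fin_num => //; exact: dotv_integrable.
rewrite -integralZl//; last exact: dotv_integrable.
apply: eq_integral => x _; rewrite time_of_cons space_of_cons -EFinM; congr EFin.
by rewrite /dotv mulr_sumr; apply: eq_bigr => i _; rewrite mxE mulrA.
Qed.

Lemma is_weak_curl_tensor (J : finType) (f : J -> R -> R) G CG
    (v : 'cV[R]_d.+1 -> 'cV[R]_d) :
  (forall j, L2 mu I (f j)) -> (forall j, L2v Omega (G j)) ->
  (forall j, is_weak_curl (fun i : 'I_d => delta_mx i ord0) Omega (G j) (CG j)) ->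
  {ae leb R d.+1, forall z, Q z -> v z = \sum_j f j (time_of z) *: G j (space_of z)} ->
  is_weak_curl (@e_space R d) Q v (fun z => \sum_j f j (time_of z) *: CG j (space_of z)).
Proof.
move=> f2 G2 GC vE; have C2 j : L2v Omega (CG j) := (GC j).1.
split; first by apply: L2v_sum => // j; exact: L2v_tensor.
move=> phi phiC.
have oQ : open Q by exact: open_cylinder.
have p2 := C1c_L2v oQ Qoo phiC; have c2 := curl_adj_L2v (@e_space R d) oQ Qoo phiC.
rewrite [RHS](@ae_eq_dot_L2v _ _ _ _ _ _ _ (curl_adj (@e_space R d) phi) vE); last exact: aeW.
rewrite !dot_L2v_suml//; try by move=> j; exact: L2v_tensor.
apply: eq_bigr => j _.
have L := dot_L2v_slice (f2 j) (C2 j) (fun i => @C1c_continuous _ _ _ _ _ phiC i)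
  (fun i => C1c_bounded phiC i).
have R' := dot_L2v_slice (f2 j) (G2 j) (fun i => @curl_adj_continuous _ _ _ (@e_space R d) _ _ i phiC)
  (fun i => @curl_adj_bounded _ _ _ (@e_space R d) _ _ i phiC).
rewrite L R'; apply: eq_Rintegral => s _; congr (_ * _).
rewrite (GC j).2; last exact: C1c_slice phiC.
by congr dot_L2v; apply/funext => x; rewrite curl_adj_slice.
Qed.

Lemma curl_x_tensor (J : finType) (f : J -> R -> R) G CG
    (v : 'cV[R]_d.+1 -> 'cV[R]_d) :
  (forall j, L2 mu I (f j)) -> (forall j, L2v Omega (G j)) ->
  (forall j, is_weak_curl (fun i : 'I_d => delta_mx i ord0) Omega (G j) (CG j)) ->
  {ae leb R d.+1, forall z, Q z -> v z = \sum_j f j (time_of z) *: G j (space_of z)} ->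
  {ae leb R d.+1, forall z, Q z ->
    curl_x Omega T v z = \sum_j f j (time_of z) *: CG j (space_of z)}.
Proof.
move=> f2 G2 GC vE; apply: weak_curlE; first exact: open_cylinder.
  exact: Qoo.
exact: is_weak_curl_tensor GC vE.
Qed.

End tensor_curl.

Section tensor_dt.
Variables (R : realType) (n k : nat) (T : R) (Omega : set 'cV[R]_n).

Lemma is_derive_bigsum (J : Type) (r : seq J) (f : J -> R -> R) (f' : J -> R) (s : R) :
  (forall j, is_derive s 1 (f j) (f' j)) ->
  is_derive s 1 (fun u => \sum_(j <- r) f j u) (\sum_(j <- r) f' j).
Proof.
move=> ff; elim: r => [|j r IH].
  rewrite big_nil (_ : (fun u => _) = fun=> 0); first exact: is_derive_cst.
  by apply/funext => u; rewrite big_nil.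
rewrite big_cons (_ : (fun u => _) = f j + (fun u => \sum_(j <- r) f j u)).
  exact: is_deriveD.
by apply/funext => u; rewrite big_cons.
Qed.

(** The representation of [v] is assumed at every point of the cylinder: a time derivative is not
    determined by equality almost everywhere. Near [z] the time line stays in the cylinder, which is
    all that the difference quotient sees. *)
Lemma dt_tensor (J : finType) (f : J -> R -> R) (f' : J -> R)
    (G : J -> 'cV[R]_n -> 'cV[R]_k) (v : 'cV[R]_n.+1 -> 'cV[R]_k) z :
  (forall z, cylinder T Omega z -> v z = \sum_j f j (time_of z) *: G j (space_of z)) ->
  cylinder T Omega z -> (forall j, is_derive (time_of z) 1 (f j) (f' j)) ->
  dt v z = \sum_j f' j *: G j (space_of z).
Proof.
move=> vE [zT zO] ff; apply/colP => i; rewrite mxE.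
have tE (r : R) : time_of (r *: e_time R n + z) = r + time_of z.
  by rewrite /time_of !mxE eqxx mulr1.
have sE (r : R) : space_of (r *: e_time R n + z) = space_of z.
  by apply/colP => j; rewrite !mxE/= mulr0 add0r.
suff [_ ->] : is_derive z (e_time R n) (fun y => v y i ord0) ((\sum_j f' j *: G j (space_of z)) i ord0) by [].
apply: is_derive_at.
apply: (@near_eq_is_derive _ _ _ (fun r : R => \sum_j (G j (space_of z) i ord0 *: (fun r => f j (r + time_of z)) : R -> R) r)).
  have zT' : nbhs (0 : R) [set r : R | 0 < r + time_of z < T].
    have /andP[z0 zT1] := zT; apply/nbhs_ballP; exists (Num.min (time_of z) (T - time_of z)).
      by rewrite /= lt_min z0 subr_gt0.
    move=> r; rewrite /ball/= sub0r normrN lt_min => /andP[].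
    by rewrite !ltr_norml => /andP[? ?] /andP[? ?]; apply/andP; split; lra.
  apply: filterS zT' => r rT; rewrite vE; last by split; rewrite ?tE// sE.
  by rewrite tE sE summxE; apply: eq_bigr => j _; rewrite mxE /= mulrC.
rewrite summxE.
apply: is_derive_bigsum => j; rewrite mxE mulrC.
apply: is_deriveZ; rewrite (_ : (fun r : R => f j (r + time_of z)) = (fun r : R => f j (r *: (1 : R) + time_of z))).
  by apply/is_derive_line; rewrite scale0r add0r; exact: ff.
by apply/funext => r; congr (f j (_ + _)); exact/esym/mulr1.
Qed.

End tensor_dt.

Lemma ae_imply d (X : measurableType d) (R : realType)
    (m : {measure set X -> \bar R}) (P Q : X -> Prop) :
  (forall x, P x -> Q x) -> {ae m, forall x, P x} -> {ae m, forall x, Q x}.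
Proof. by move=> PQ; apply: filterS. Qed.

(** * The temporal mesh *)

Section temporal_mesh.
Variables (R : realType) (T : R) (N : nat) (t : nat -> R).
Hypothesis tM : temporal_mesh T N t.
Local Notation mu := (@lebesgue_measure R).
Local Notation I := (`]0, T[%classic : set (measurableTypeR R)).

Let mI : measurable I. Proof. exact: measurable_itvoo. Qed.

Lemma mesh_le l m : (l <= m <= N)%N -> t l <= t m.
Proof.
move=> /andP[lm mN]; have [_ _ tS] := tM.
elim: m lm mN => [|m IH]; first by rewrite leqn0 => /eqP ->.
rewrite leq_eqVlt => /orP[/eqP <-//|lm mN].
by rewrite (le_trans (IH lm (ltnW mN)))// ltW// tS.
Qed.

Lemma mesh_cell_in j s : (j < N)%N -> t j < s < t j.+1 -> 0 < s < T.
Proof.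
have [t0 tT _] := tM; move=> jN /andP[js sj]; rewrite -t0 -tT.
rewrite (le_lt_trans _ js) ?mesh_le//= ?(ltnW jN)// (lt_le_trans sj)// mesh_le// jN.
by rewrite leqnn.
Qed.

Lemma mesh_cell_unique j l s : (j < N)%N -> (l < N)%N ->
  t j < s < t j.+1 -> t l < s < t l.+1 -> j = l.
Proof.
move=> jN lN /andP[js sj] /andP[ls sl].
have [jl|lj|//] := ltngtP j l.
  by have := lt_trans ls sj; rewrite ltNge mesh_le// jl ltnW.
by have := lt_trans js sl; rewrite ltNge mesh_le// lj ltnW.
Qed.

Lemma mesh_cell_exists s : 0 < s < T -> (forall l, s != t l) ->
  exists2 j, (j < N)%N & t j < s < t j.+1.
Proof.
move=> /andP[s0 sT] snt; have [t0 tT _] := tM.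
have : exists l, t l > s by exists N; rewrite tT.
move=> /ex_minnP[[|j] sj jmin]; first by move: sj; rewrite t0 ltNge ltW.
have jN : (j < N)%N by apply: jmin; rewrite tT.
exists j => //; rewrite sj andbT lt_neqAle eq_sym snt /= leNgt.
by apply/negP => /jmin; rewrite ltnn.
Qed.

Lemma ae_off_nodes : {ae mu, forall s, forall l, s != t l}.
Proof.
apply/ae_foralln => l; exists [set t l]; split => //=.
- exact: lebesgue_measure_set1.
- by move=> s /negP; rewrite negbK => /eqP.
Qed.

Lemma ae_mesh_cell : {ae mu, forall s, I s -> exists2 j, (j < N)%N & t j < s < t j.+1}.
Proof.
by apply: ae_imply ae_off_nodes => s snt; rewrite /= in_itv/= => sI; exact: mesh_cell_exists.
Qed.

(** A cell has positive length and cannot lie in a null set; this extracts exact equations from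
    identities almost everywhere. *)
Lemma ae_exists_in_cell (P : R -> Prop) j : (j < N)%N ->
  {ae mu, forall s, I s -> P s} -> exists2 s, t j < s < t j.+1 & P s.
Proof.
move=> jN [E [mE E0 PE]]; have [_ _ tS] := tM; apply: contrapT => nP.
pose J : set R := `]t j, t j.+1[%classic.
have JE : J `<=` E.
  move=> s; rewrite /J/= in_itv/= => sJ; apply: PE => H; apply: nP; exists s => //.
  by apply: H; rewrite /= in_itv/=; exact: mesh_cell_in sJ.
have : (mu J <= mu E)%E by apply: le_measure; rewrite ?inE//; exact: measurable_itv.
rewrite E0 lebesgue_measure_itv/= lte_fin tS// -EFinB lee_fin subr_le0 leNgt.
by rewrite tS.
Qed.

(* Piecewise affine functions agree almost everywhere with a bounded measurable
   function; their values at the nodes are irrelevant. *)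
Lemma piecewise_affine_ae (f : R -> R) :
  (forall j, (j < N)%N -> exists a b, forall s, t j < s < t j.+1 -> f s = a + b * s) ->
  exists f' : R -> R, exists B : R,
    [/\ {ae mu, forall s, I s -> f s = f' s}, measurable_fun I f' &
        forall s, I s -> `|f' s| <= B].
Proof.
move=> fab.
have /choice[ab fE] (j : 'I_N) : exists p : R * R, forall s, t j < s < t j.+1 -> f s = p.1 + p.2 * s.
  by have [a [b E]] := fab j (ltn_ord j); exists (a, b).
pose J (j : 'I_N) : set (measurableTypeR R) := `]t j, t j.+1[%classic.
pose f' (s : R) := \sum_(j < N) \1_(J j) s * ((ab j).1 + (ab j).2 * s).
exists f', (\sum_(j < N) (`|(ab j).1| + `|(ab j).2| * T)); split.
- apply: ae_imply ae_mesh_cell => s + sI => /(_ sI)[j jN sj].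
  rewrite /f' (bigD1 (Ordinal jN))//= big1 ?addr0.
    by rewrite indicE mem_set/= ?mul1r ?(fE (Ordinal jN))// in_itv.
  move=> l lj; rewrite indicE memNset ?mul0r//; rewrite /J/= in_itv/= => sl.
  move/eqP: lj; apply; apply/val_inj => /=.
  by rewrite (mesh_cell_unique (ltn_ord l) jN sl sj).
- apply: measurable_sum => j; apply: measurable_funM.
    by apply: measurable_indic; exact: measurable_itv.
  by apply: measurable_funD => //; exact: measurable_funM.
- move=> s; rewrite /= in_itv/= => /andP[s0 sT].
  rewrite (le_trans (ler_norm_sum _ _ _))// ler_sum// => j _.
  rewrite normrM (@le_trans _ _ (1 * `|(ab j).1 + (ab j).2 * s|))//.
    by rewrite ler_wpM2r// indicE; case: (_ \in _); rewrite /= ?normr1 ?normr0.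
  rewrite mul1r (le_trans (ler_normD _ _))// lerD2l normrM ler_wpM2l//.
  by rewrite gtr0_norm// ltW.
Qed.

Lemma hatE m j s : (j < N)%N -> (m <= N)%N -> t j < s < t j.+1 ->
  hat N t m s = if m == j.+1 then (s - t j) / (t j.+1 - t j)
    else if m == j then (t j.+1 - s) / (t j.+1 - t j) else 0.
Proof.
move=> jN mN sj; have /andP[js js1] := sj; rewrite /hat.
have [->|mj1] := eqVneq m j.+1.
  by rewrite /= (ltW js) (ltW js1).
have -> : (0 < m)%N && (t m.-1 <= s <= t m) = false.
  apply/negP => /andP[m0 /andP[ms sm]].
  have [mj|] := leqP m j.
    by have := lt_le_trans js sm; rewrite ltNge mesh_le// mj ltnW.
  rewrite leq_eqVlt eq_sym (negbTE mj1)/= => jm.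
  have := le_lt_trans ms js1; rewrite ltNge mesh_le//.
  by rewrite -ltnS prednK// jm (leq_trans _ mN)// leq_pred.
have [->|mj] := eqVneq m j; first by rewrite jN (ltW js) (ltW js1).
have -> // : (m < N)%N && (t m <= s <= t m.+1) = false.
apply/negP => /andP[mN' /andP[ms sm]].
have [lt|lt|E] := ltngtP m j; last by rewrite E eqxx in mj.
  by have := lt_le_trans js sm; rewrite ltNge mesh_le// lt ltnW.
have [lt'|] := ltnP j.+1 m; last by rewrite leq_eqVlt ltnS (negbTE mj1)/= leqNgt lt.
by have := le_lt_trans ms js1; rewrite ltNge mesh_le// ltnW.
Qed.

Definition hat_slope (m j : nat) : R :=
  if m == j.+1 then (t j.+1 - t j)^-1 else if m == j then - (t j.+1 - t j)^-1 else 0.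

Lemma hat_affine m j : (j < N)%N -> (m <= N)%N ->
  exists a, forall s, t j < s < t j.+1 -> hat N t m s = a + hat_slope m j * s.
Proof.
move=> jN mN; rewrite /hat_slope; have [E|E1] := eqVneq m j.+1.
  exists (- t j / (t j.+1 - t j)) => s sj; rewrite (hatE jN)// E eqxx; ring.
have [E|E2] := eqVneq m j.
  exists (t j.+1 / (t j.+1 - t j)) => s sj.
  by rewrite (hatE jN)// (negbTE E1) E eqxx; ring.
by exists 0 => s sj; rewrite (hatE jN)// (negbTE E1) (negbTE E2); ring.
Qed.

Lemma is_derive_hat m j s : (j < N)%N -> (m <= N)%N -> t j < s < t j.+1 ->
  is_derive s 1 (hat N t m) (hat_slope m j).
Proof.
move=> jN mN sj; have [a aE] := hat_affine jN mN.
apply: (@near_eq_is_derive _ _ _ (fun s => a + hat_slope m j * s)).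
  have : nbhs s `]t j, t j.+1[%classic.
    by apply: open_nbhs_nbhs; split; [exact: interval_open|rewrite /= in_itv].
  by apply: filterS => u; rewrite /= in_itv/= => /aE ->.
by apply: is_derive_eq; rewrite /GRing.scale/=; ring.
Qed.

Lemma derive1_hat m j s : (j < N)%N -> (m <= N)%N -> t j < s < t j.+1 ->
  derive1 (hat N t m) s = hat_slope m j.
Proof. by move=> jN mN sj; rewrite derive1E; have [] := is_derive_hat jN mN sj. Qed.

Lemma hat_ae m : (m <= N)%N -> exists f' : R -> R, exists B : R,
    [/\ {ae mu, forall s, I s -> hat N t m s = f' s}, measurable_fun I f' &
        forall s, I s -> `|f' s| <= B].
Proof.
move=> mN; apply: piecewise_affine_ae => j jN.
by have [a aE] := hat_affine jN mN; exists a, (hat_slope m j).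
Qed.

Lemma derive1_hat_ae m : (m <= N)%N -> exists f' : R -> R, exists B : R,
    [/\ {ae mu, forall s, I s -> derive1 (hat N t m) s = f' s}, measurable_fun I f' &
        forall s, I s -> `|f' s| <= B].
Proof.
move=> mN; apply: piecewise_affine_ae => j jN.
by exists (hat_slope m j), 0 => s sj; rewrite (derive1_hat jN)// mul0r addr0.
Qed.

(** On cell [j] only [c j] and its predecessor contribute, with opposite slopes. On cell 0 there is
    no predecessor, as the hat at [t = 0] is not in the basis, so the coefficients vanish one after
    the other. *)
Lemma sum_derive1_hat_eq0 (c : 'I_N -> R) :
  {ae mu, forall s, I s -> \sum_l c l * derive1 (hat N t l.+1) s = 0} ->
  forall l, c l = 0.
Proof.
move=> c0; have [_ _ tS] := tM.
have cE j (jN : (j < N)%N) : \sum_l c l * hat_slope l.+1 j = 0.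
  have [s sj E] := ae_exists_in_cell jN c0; rewrite -[RHS]E.
  by apply: eq_bigr => l _; rewrite (derive1_hat jN).
suff H j (jN : (j < N)%N) : c (Ordinal jN) = 0.
  by move=> [j jN]; exact: H.
elim: j jN => [|j IH] jN.
  have := cE _ jN; rewrite (bigD1 (Ordinal jN))//= big1 ?addr0.
    rewrite /hat_slope eqxx => /eqP; rewrite mulf_eq0 invr_eq0 subr_eq0 => /orP[/eqP//|].
    by rewrite gt_eqF// tS.
  move=> l l0; rewrite /hat_slope eqSS (_ : (nat_of_ord l == 0%N) = false) ?mulr0//.
  by apply/negbTE; move: l0; apply: contra => /eqP l0; apply/eqP/val_inj.
have := cE _ jN; rewrite (bigD1 (Ordinal jN))//= big1 ?addr0.
  rewrite /hat_slope eqxx => /eqP; rewrite mulf_eq0 invr_eq0 subr_eq0 => /orP[/eqP//|].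
  by rewrite gt_eqF// tS.
move=> l lj; rewrite /hat_slope eqSS (_ : (nat_of_ord l == j.+1) = false); last first.
  by apply/negbTE; move: lj; apply: contra => /eqP l0; apply/eqP/val_inj.
rewrite eqSS; case: eqP => [E|_]; last by rewrite mulr0.
by rewrite (_ : l = Ordinal (ltnW jN)) ?IH ?mul0r//; apply/val_inj.
Qed.

End temporal_mesh.

(** * Positivity of the matrices *)

Section quadratic_forms.
Variable R : realType.

Definition qform n (A : 'M[R]_n) (z : 'I_n -> R) : R := \sum_l \sum_k z l * A l k * z k.

Lemma qformE n (A : 'M[R]_n) (y : 'cV[R]_n) :
  (y^T *m A *m y) ord0 ord0 = qform A (fun i => y i ord0).
Proof.
rewrite mxE; under eq_bigr do rewrite mxE mulr_suml.
rewrite exchange_big/=; apply: eq_bigr => l _; apply: eq_bigr => k _.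
by rewrite mxE.
Qed.

Lemma qform_tr n (A : 'M[R]_n) z : qform A^T z = qform A z.
Proof.
rewrite /qform exchange_big/=; apply: eq_bigr => l _; apply: eq_bigr => k _.
by rewrite mxE; ring.
Qed.

Lemma qform_trmul n (W : 'M[R]_n) z : qform (W^T *m W) z =
  \sum_i (\sum_k W i k * z k) ^+ 2.
Proof.
rewrite /qform; under eq_bigr => l _ do under eq_bigr => k _ do rewrite mxE mulr_sumr mulr_suml.
under eq_bigr => l _ do rewrite exchange_big/=.
rewrite exchange_big/=; apply: eq_bigr => i _.
rewrite expr2 mulr_suml; apply: eq_bigr => l _; rewrite mulr_sumr; apply: eq_bigr => k _.
by rewrite mxE; ring.
Qed.

Lemma qform_block n (a : R) (b : 'cV[R]_n) (C : 'M[R]_n) (s : R) (u : 'cV[R]_n) :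
  ((col_mx s%:M u)^T *m block_mx a%:M b^T b C *m col_mx s%:M u) ord0 ord0 =
  a * s ^+ 2 + 2 * s * (b^T *m u) ord0 ord0 + (u^T *m C *m u) ord0 ord0.
Proof.
rewrite tr_col_mx mul_row_block mul_row_col !mulmxDl tr_scalar_mx -!scalar_mxM.
rewrite mul_scalar_mx -scalemxAl mul_mx_scalar.
have -> : u^T *m b = b^T *m u.
  by rewrite -[LHS]trmxK trmx_mul trmxK [RHS]mx11_scalar [LHS]mx11_scalar mxE.
set p := b^T *m u; set q := u^T *m C *m u.
by rewrite !mxE !eqxx/=; ring.
Qed.

(* Symmetric Gaussian elimination: split off one row and one column and recurse on
   the Schur complement. *)
Lemma psd_factor n (M : 'M[R]_n) : M^T = M -> (forall z, 0 <= qform M z) ->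
  exists W : 'M[R]_n, M = W^T *m W.
Proof.
elim: n M => [|n IH] M symM psdM.
  by exists 0; apply/matrixP => -[].
pose M' : 'M[R]_(1 + n) := M; have symM' : M'^T = M' := symM.
suff [W E] : exists W : 'M[R]_(1 + n), M' = W^T *m W by exists W.
pose a := ulsubmx M' ord0 ord0; pose b : 'cV[R]_n := dlsubmx M'; pose C := drsubmx M'.
have eM : M' = block_mx a%:M b^T b C.
  rewrite -[LHS]submxK; congr block_mx; first by rewrite [LHS]mx11_scalar.
  by rewrite /b trmx_dlsub symM'.
have symC : C^T = C.
  by rewrite /C trmx_drsub symM'.
have psd (s : R) (u : 'cV[R]_n) :
    0 <= a * s ^+ 2 + 2 * s * (b^T *m u) ord0 ord0 + (u^T *m C *m u) ord0 ord0.
  by rewrite -qform_block -eM qformE; exact: psdM.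
have a0 : 0 <= a.
  have := psd 1 0; rewrite mulmx0 trmx0 !mul0mx !mxE expr1n; lra.
have [az|an] := eqVneq a 0.
  have b0 : b = 0.
    have bb : (b^T *m b) ord0 ord0 = 0.
      apply/eqP; apply: contraT => bb.
      (* With [a = 0] the form is affine in [s]; for [b != 0] this [s] gives it the value -1. *)
      have := psd (- ((b^T *m C *m b) ord0 ord0 + 1) / (2 * (b^T *m b) ord0 ord0)) b.
      set q := (b^T *m b) ord0 ord0 in bb *; set r := (b^T *m C *m b) ord0 ord0.
      rewrite az mul0r add0r (_ : 2 * _ * q = - (r + 1)); first by lra.
      by field.
    apply/colP => i; rewrite [RHS]mxE; apply/eqP; rewrite -sqrf_eq0.
    move: bb; clearbody b; rewrite mxE => /eqP; rewrite psumr_eq0.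
      by move=> /allP/(_ i (mem_index_enum _))/=; rewrite mxE expr2.
    by move=> j _; rewrite mxE -expr2 sqr_ge0.
  have psdC z : 0 <= qform C z.
    pose u : 'cV[R]_n := \col_i z i.
    have := psd 0 u; rewrite expr0n/= !mulr0 mul0r !add0r qformE.
    by rewrite (_ : (fun i => u i ord0) = z)//; apply/funext => i; rewrite mxE.
  have [W CW] := IH C symC psdC.
  exists (block_mx (0 : 'M[R]_1) 0 0 W : 'M[R]_(1 + n)).
  rewrite eM az b0 CW tr_block_mx (mulmx_block (0 : 'M[R]_1)^T) !trmx0 !mul0mx !mulmx0 !addr0.
  by rewrite add0r raddf0.
have ap : 0 < a by rewrite lt_neqAle eq_sym an.
pose C' := C - a^-1 *: (b *m b^T).
have symC' : C'^T = C' by rewrite /C' linearB linearZ/= symC trmx_mul trmxK.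
have psdC' z : 0 <= qform C' z.
  pose u : 'cV[R]_n := \col_i z i.
  rewrite (_ : qform C' z = (u^T *m C' *m u) ord0 ord0); last first.
    by rewrite qformE; congr qform; apply/funext => i; rewrite mxE.
  have E : u^T *m (b *m b^T) *m u = (b^T *m u)^T *m (b^T *m u).
    by rewrite trmx_mul trmxK !mulmxA.
  have Y : ((b^T *m u)^T *m (b^T *m u)) ord0 ord0 = (b^T *m u) ord0 ord0 ^+ 2.
    by rewrite [LHS]mxE big_ord1 [X in X * _]mxE expr2.
  rewrite /C' mulmxBr mulmxBl -scalemxAr -scalemxAl E.
  rewrite [leRHS]mxE [X in _ + X]mxE [X in - X]mxE Y.
  (* The minimiser in the split-off variable; the minimum is the form of the Schur complement
     [C']. *)
  have := psd (- a^-1 * (b^T *m u) ord0 ord0) u.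
  set q := (b^T *m u) ord0 ord0; set r := (u^T *m C *m u) ord0 ord0.
  rewrite (_ : _ + r = r - a^-1 * q ^+ 2)//.
  by clearbody a q r; field.
have [W CW] := IH C' symC' psdC'.
pose r := Num.sqrt a.
have rr : r * r = a by rewrite -expr2 sqr_sqrtr.
have rn : r != 0 by rewrite gt_eqF// sqrtr_gt0.
(* The Cholesky step, with [r] the square root of the pivot. *)
exists (block_mx (r%:M : 'M[R]_1) (r^-1 *: b^T) 0 W : 'M[R]_(1 + n)).
rewrite eM tr_block_mx (mulmx_block (r%:M : 'M[R]_1)^T) !trmx0 !mul0mx !mulmx0 !addr0.
have -> : (r^-1 *: b^T)^T = r^-1 *: b by rewrite [LHS]linearZ/= trmxK.
rewrite tr_scalar_mx -scalar_mxM rr -CW /C'.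
congr block_mx.
- by rewrite mul_scalar_mx scalerA divff// scale1r.
- by rewrite mul_mx_scalar scalerA divff// scale1r.
- rewrite -scalemxAl -scalemxAr scalerA -invfM rr.
  by rewrite addrC subrK.
Qed.

Lemma sum_mxtens (V : nmodType) m n (F : 'I_m -> 'I_n -> V) :
  \sum_(p < m * n) F (mxtens_unindex p).1 (mxtens_unindex p).2 = \sum_l \sum_k F l k.
Proof.
rewrite pair_big (reindex (@mxtens_index m n)); last first.
  by exists (@mxtens_unindex m n) => p _; [exact: mxtens_indexK|exact: mxtens_unindexK].
by apply: eq_bigr => p _; rewrite mxtens_indexK.
Qed.

Lemma qform_tens m n (A : 'M[R]_m) (W : 'M[R]_n) (y : 'I_(m * n) -> R) :
  qform (A *t (W^T *m W)) y =
  \sum_i qform A (fun l => \sum_k W i k * y (mxtens_index (l, k))).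
Proof.
have yE p : y p = y (mxtens_index ((mxtens_unindex p).1, (mxtens_unindex p).2)).
  by rewrite -surjective_pairing mxtens_unindexK.
transitivity (\sum_l \sum_k \sum_l' \sum_k' y (mxtens_index (l, k)) *
    (A l l' * (\sum_i W i k * W i k')) * y (mxtens_index (l', k'))).
  rewrite /qform -[RHS](sum_mxtens (fun l k => \sum_l' \sum_k' y (mxtens_index (l, k)) *
    (A l l' * (\sum_i W i k * W i k')) * y (mxtens_index (l', k')))).
  apply: eq_bigr => p _.
  rewrite -[RHS](sum_mxtens (fun l' k' => y (mxtens_index ((mxtens_unindex p).1, (mxtens_unindex p).2)) *
    (A (mxtens_unindex p).1 l' * (\sum_i W i (mxtens_unindex p).2 * W i k')) * y (mxtens_index (l', k')))).
  apply: eq_bigr => q _; rewrite -!yE mxE; congr (_ * (_ * _) * _).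
  by rewrite mxE; apply: eq_bigr => i _; rewrite mxE.
rewrite /qform [RHS]exchange_big/=; apply: eq_bigr => l _.
rewrite [RHS]exchange_big/= [LHS]exchange_big/=; apply: eq_bigr => l' _.
under eq_bigr => k _ do under eq_bigr => k' _ do rewrite mulr_sumr mulr_sumr mulr_suml.
under eq_bigr => k _ do rewrite exchange_big/=.
rewrite exchange_big/=; apply: eq_bigr => i _.
rewrite mulr_suml mulr_suml; apply: eq_bigr => k _.
by rewrite mulr_sumr; apply: eq_bigr => k' _; ring.
Qed.

Lemma qform_tens_ge0 m n (A : 'M[R]_m) (M : 'M[R]_n) y :
  (forall z, 0 <= qform A z) -> M^T = M -> (forall z, 0 <= qform M z) ->
  0 <= qform (A *t M) y.
Proof.
move=> A0 symM M0; have [W ->] := psd_factor symM M0.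
by rewrite qform_tens; apply: sumr_ge0 => i _.
Qed.

(** A vanishing sum of nonnegative forms makes every contraction of [y] with a row of [W] zero. For
    each fixed [l], [W] therefore kills the space part of [y], and definiteness of [M] ends the
    argument. *)
Lemma qform_tens_eq0 m n (A : 'M[R]_m) (M : 'M[R]_n) y :
  (forall z, 0 <= qform A z) -> (forall z, qform A z = 0 -> forall i, z i = 0) ->
  M^T = M -> (forall z, 0 <= qform M z) -> (forall z, qform M z = 0 -> forall i, z i = 0) ->
  qform (A *t M) y = 0 -> forall p, y p = 0.
Proof.
move=> A0 A1 symM M0 M1; have [W MW] := psd_factor symM M0.
rewrite MW qform_tens => /eqP; rewrite psumr_eq0; last by move=> i _; exact: A0.
move=> /allP yW p; rewrite -(mxtens_unindexK p); case: (mxtens_unindex p) => l k.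
apply: (M1 (fun k => y (mxtens_index (l, k)))); rewrite MW qform_trmul big1// => i _.
have /eqP/A1/(_ l) -> := yW i (mem_index_enum _).
by rewrite expr0n.
Qed.

Lemma posdef_unitmx n (K : 'M[R]_n) : posdef K -> K \in unitmx.
Proof.
move=> Kpos; rewrite -unitmx_tr -row_free_unit -kermx_eq0; apply/rowV0P => v /sub_kermxP vK.
apply/eqP; apply: contraT => v0; have := Kpos v^T; rewrite -trmx_eq0 trmxK => /(_ v0).
rewrite -mulmxA (_ : K *m v^T = 0); first by rewrite mulmx0 mxE ltxx.
by rewrite -[LHS]trmxK trmx_mul trmxK vK trmx0.
Qed.

End quadratic_forms.

Section ae_bounded.
Context d (X : measurableType d) (R : realType).
Variables (m : {measure set X -> \bar R}) (D : set X).
Hypothesis mD : measurable D.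

Lemma L2_ae_eq (f f' : X -> R) : measurable_fun D f ->
  {ae m, forall x, D x -> f x = f' x} -> L2 m D f' -> L2 m D f.
Proof.
move=> mf ff [mf' f2']; split => //; apply/integrableP; split.
  by apply/measurable_EFinP; exact: measurable_funX.
have /integrableP[_] := f2'; congr (_ < _)%E.
by apply: ae_eq_integral_nomeas; apply: filterS ff => x H Dx; rewrite H.
Qed.

Lemma L2_ae_bounded_mul (C : R) (h f : X -> R) : measurable_fun D h ->
  {ae m, forall x, D x -> `|h x| <= C} -> L2 m D f -> L2 m D (fun x => h x * f x).
Proof.
move=> mh hC f2; have [mf _] := f2.
pose A := D `&` h @^-1` `[- C, C]%classic.
have mA : measurable A by apply: mh => //; exact: measurable_itv.
(* Setting [h] to zero off [A] alters it only on a null set and makes the bound hold at every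
   point. *)
apply: (@L2_ae_eq _ (fun x => (\1_A x * h x) * f x)).
- exact: measurable_funM.
- apply: filterS hC => x H Dx; rewrite indicE mem_set ?mul1r//.
  by split => //; rewrite /= in_itv/= -ler_norml; exact: H.
- apply: (@L2_bounded_mul _ _ _ _ _ mD (Num.max 0 C)) => //.
    by apply: measurable_funM => //; exact: measurable_indic.
  move=> x Dx; rewrite indicE; case: (boolP (x \in A)) => [/set_mem[_]|_].
    by rewrite /= in_itv/= -ler_norml mul1r le_max => ->; rewrite orbT.
  by rewrite mul0r normr0 le_max lexx.
Qed.

Lemma ae_Rintegral_ge0 (f : X -> R) : {ae m, forall x, D x -> 0 <= f x} ->
  0 <= \int[m]_(x in D) f x.
Proof.
move=> f0; rewrite [leRHS](_ : _ = \int[m]_(x in D) `|f x|).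
  by apply: Rintegral_ge0 => x _.
congr fine; apply: ae_eq_integral_nomeas; apply: filterS f0 => x H Dx.
by rewrite ger0_norm// H.
Qed.

End ae_bounded.

(** * Gram matrices with a matrix weight *)

Section gram_matrix.
Variables (R : realType) (n k : nat) (D : set 'cV[R]_n).
Hypothesis mD : measurable D.
Variable F : 'cV[R]_n -> 'M[R]_k.
Hypothesis Foo : forall i j, Linfty (leb R n) D (fun x => F x i j).

Lemma dotvC (x y : 'cV[R]_k) : dotv x y = dotv y x.
Proof. by apply: eq_bigr => i _; rewrite mulrC. Qed.

Lemma L2v_coef f : L2v D f -> L2v D (fun x => F x *m f x).
Proof.
move=> f2 i; rewrite (_ : (fun x => _) = fun x => \sum_j F x i j * f x j ord0).
  apply: L2_sum => // j; have [mF [C FC]] := Foo i j.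
  exact: (L2_ae_bounded_mul mD mF FC (f2 j)).
by apply/funext => x; rewrite mxE.
Qed.

Variables (N : nat) (g : 'I_N -> 'cV[R]_n -> 'cV[R]_k).
Hypothesis g2 : forall l, L2v D (g l).

Definition gram : 'M[R]_N := \matrix_(l, j) dot_L2v D (fun x => F x *m g j x) (g l).

Let comb (z : 'I_N -> R) x := \sum_l z l *: g l x.

Let comb2 z : L2v D (comb z).
Proof. by apply: L2v_sum => // l; exact: L2vZ. Qed.

Lemma qform_gram z : qform gram z = dot_L2v D (fun x => F x *m comb z x) (comb z).
Proof.
have E : (fun x => F x *m comb z x) = (fun x => \sum_l z l *: (F x *m g l x)).
  apply/funext => x; rewrite /comb mulmx_sumr; apply: eq_bigr => l _.
  by rewrite scalemxAr.
have Fg2 l : L2v D (fun x => F x *m g l x) by exact: L2v_coef.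
rewrite /qform exchange_big/= [in RHS]E dot_L2v_suml//; last by move=> l; exact: L2vZ.
apply: eq_bigr => j _; rewrite dot_L2vZl//.
rewrite dot_L2v_sumr//; last by move=> l; exact: L2vZ.
rewrite mulr_sumr; apply: eq_bigr => l _; rewrite dot_L2vZr// mxE; ring.
Qed.

Lemma gram_sym : {ae leb R n, forall x, D x -> (F x)^T = F x} -> gram^T = gram.
Proof.
move=> symF; apply/matrixP => l j; rewrite !mxE.
congr fine; apply: ae_eq_integral_nomeas; apply: filterS symF => x H Dx; congr EFin.
rewrite -[in LHS]H// dotvC /dotv.
under eq_bigr do rewrite mxE mulr_sumr.
rewrite exchange_big/=; apply: eq_bigr => i _; rewrite mxE mulr_suml.
by apply: eq_bigr => p _; rewrite mxE; ring.
Qed.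

Lemma gram_ge0 z : {ae leb R n, forall x, D x -> forall y, 0 <= dotv y (F x *m y)} ->
  0 <= qform gram z.
Proof.
move=> F0; rewrite qform_gram; apply: ae_Rintegral_ge0.
by apply: filterS F0 => x H Dx; rewrite dotvC; exact: H.
Qed.

(** Coercivity bounds the squared norm of the combination by the form, so each component has norm
    zero. *)
Lemma gram_eq0 c z : 0 < c ->
  {ae leb R n, forall x, D x -> forall y, c * dotv y y <= dotv y (F x *m y)} ->
  qform gram z = 0 -> {ae leb R n, forall x, D x -> comb z x = 0}.
Proof.
move=> c0 Fc; rewrite qform_gram => q0.
have v2 := comb2 z; have Fv2 := L2v_coef v2; have cv2 := L2vZ mD c v2.
have : 0 <= dot_L2v D (fun x => F x *m comb z x - c *: comb z x) (comb z).
  apply: ae_Rintegral_ge0; apply: filterS Fc => x H Dx.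
  rewrite (_ : dotv _ _ = dotv (comb z x) (F x *m comb z x) - c * dotv (comb z x) (comb z x)).
    by rewrite subr_ge0; exact: H.
  rewrite /dotv mulr_sumr -sumrB; apply: eq_bigr => i _; rewrite mxE [X in _ + X]mxE [X in - X]mxE; ring.
rewrite dot_L2vBl// dot_L2vZl// q0 sub0r oppr_ge0 pmulr_rle0//.
rewrite dot_L2vE// => sum0.
have comp i : {ae leb R n, forall x, D x -> comb z x i ord0 = 0}.
  apply: (dot_eq0 mD (v2 i)); apply/eqP; rewrite eq_le dot_ge0 andbT.
  apply: le_trans sum0; rewrite (bigD1 i)//= lerDl sumr_ge0// => j _.
  exact: dot_ge0.
have : {ae leb R n, forall x i, D x -> comb z x i ord0 = 0} by exact: filter_forall.
by apply: filterS => x H Dx; apply/colP => i; rewrite mxE H.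
Qed.

End gram_matrix.

(** * Inverses of the coefficient matrices *)

Section inverse_coefficients.
Variables (R : realType) (d : space_dim) (Omega : set 'cV[R]_d).
Hypothesis mO : measurable Omega.

Lemma measurable_inv : measurable_fun setT (fun x : R => x^-1).
Proof.
rewrite -(setvU [set (0 : R)]); apply/measurable_funU => //; first exact: measurableC.
split; last exact: measurable_fun_set1.
apply: open_continuous_measurable_fun.
  exact/closed_openC/accessible_closed_set1/hausdorff_accessible.
by move=> x; rewrite inE/= => /eqP x0; exact: inv_continuous.
Qed.

Lemma measurable_det k (F : 'cV[R]_d -> 'M[R]_k) :
  (forall i j, measurable_fun Omega (fun x => F x i j)) ->
  measurable_fun Omega (fun x => \det (F x)).
Proof.
move=> mF; rewrite /determinant; apply: measurable_sum => s.
apply: measurable_funM => //; apply: measurable_prod => i _; exact: mF.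
Qed.

Lemma measurable_invmx k (F : 'cV[R]_d -> 'M[R]_k) :
  (forall i j, measurable_fun Omega (fun x => F x i j)) ->
  forall i j, measurable_fun Omega (fun x => invmx (F x) i j).
Proof.
move=> mF i j; have mdet := measurable_det mF.
pose Z := Omega `&` (fun x => \det (F x)) @^-1` [set 0].
have mZ : measurable Z by exact: mdet.
have mcof : measurable_fun Omega (fun x => cofactor (F x) j i).
  rewrite /cofactor; apply: measurable_funM => //; apply: measurable_det => p q.
  rewrite (_ : (fun x => _) = fun x => F x (lift j p) (lift i q)); first exact: mF.
  by apply/funext => x; rewrite !mxE.
(* [invmx] returns a singular matrix unchanged, hence the second term; on [Z] the first one vanishes
   because the inverse of 0 is 0. *)
apply: (eq_measurable_fun (fun x => (\det (F x))^-1 * cofactor (F x) j i + \1_Z x * F x i j)).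
  move=> x /set_mem Ox; rewrite /invmx unitmxE unitfE indicE.
  have [d0|dn0] := eqVneq (\det (F x)) 0.
    by rewrite mem_set ?d0 ?invr0 ?mul0r ?add0r ?mul1r.
  rewrite memNset ?mul0r ?addr0; last by case => _ /= /eqP; rewrite (negbTE dn0).
  by rewrite !mxE.
apply: measurable_funD; apply: measurable_funM => //.
exact: (measurableT_comp measurable_inv mdet).
Qed.

(** For the entry bound, coercivity is tested with column [j] of the inverse, which [A] sends to a
    unit vector: [c] times its squared norm is at most its entry [j]. So that entry is at most
    [c^-1], and the norm as well. *)
Lemma spd_inv k (A : 'M[R]_k) (c : R) : 0 < c -> A^T = A ->
  (forall y : 'cV[R]_k, c * dotv y y <= dotv y (A *m y)) ->
  [/\ forall i j, `|invmx A i j| <= c^-1, (invmx A)^T = invmx A &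
      forall y : 'cV[R]_k, 0 <= dotv y (invmx A *m y)].
Proof.
move=> c0 symA Ac.
have dotvv (y : 'cV[R]_k) i : y i ord0 ^+ 2 <= dotv y y.
  rewrite /dotv (bigD1 i)//= -expr2 lerDl sumr_ge0// => j _.
  by rewrite -expr2 sqr_ge0.
have dotv0 (y : 'cV[R]_k) : 0 <= dotv y y.
  by apply: sumr_ge0 => j _; rewrite -expr2 sqr_ge0.
have uA : A \in unitmx.
  apply: posdef_unitmx => y y0.
  rewrite (_ : _ ord0 ord0 = dotv y (A *m y)); last first.
    by rewrite -mulmxA mxE; apply: eq_bigr => i _; rewrite mxE.
  apply: lt_le_trans (Ac y); rewrite mulr_gt0//.
  rewrite lt_neqAle dotv0 andbT eq_sym; apply: contra y0 => /eqP yy.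
  apply/eqP/colP => i; apply/eqP; rewrite mxE -sqrf_eq0 eq_le sqr_ge0 andbT.
  by rewrite -[leRHS]yy.
split.
- move=> i j; pose y := col j (invmx A).
  have yA : A *m y = delta_mx j ord0.
    by rewrite /y colE mulmxA mulmxV// mul1mx.
  have := Ac y; rewrite yA.
  rewrite (_ : dotv y (delta_mx j ord0) = y j ord0); last first.
    rewrite /dotv (bigD1 j)//= big1 ?addr0; first by rewrite [X in _ * X]mxE !eqxx mulr1.
    by move=> l lj; rewrite [X in _ * X]mxE (negbTE lj) mulr0.
  move=> H; have yy : dotv y y <= c^-1 * y j ord0.
    by rewrite -(ler_pM2l c0) mulrA divff ?gt_eqF// mul1r.
  rewrite (_ : invmx A i j = y i ord0); last by rewrite mxE.
  have ci : 0 < c^-1 by rewrite invr_gt0.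
  have yj : y j ord0 <= c^-1.
    have := le_trans (dotvv y j) yy; have [y0|y0] := leP (y j ord0) 0.
      by move=> _; exact: le_trans (ltW ci).
    by rewrite expr2 ler_pM2r.
  have yi : y i ord0 ^+ 2 <= c^-1 ^+ 2.
    apply: le_trans (dotvv y i) _; apply: le_trans yy _.
    by rewrite expr2 ler_pM2l.
  rewrite -ler_sqr ?nnegrE ?(ltW ci)//.
  by rewrite real_normK// num_real.
- by rewrite trmx_inv symA.
- move=> y; pose w := invmx A *m y.
  have -> : y = A *m w by rewrite mulKVmx.
  rewrite mulKmx// dotvC; apply: le_trans (Ac w); exact: mulr_ge0 (ltW c0) _.
Qed.

Lemma uniformly_spd_inv k (F : 'cV[R]_d -> 'M[R]_k) : uniformly_spd Omega F ->
  [/\ forall i j, Linfty (leb R d) Omega (fun x => invmx (F x) i j),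
      {ae leb R d, forall x, Omega x -> (invmx (F x))^T = invmx (F x)} &
      {ae leb R d, forall x, Omega x -> forall y, 0 <= dotv y (invmx (F x) *m y)}].
Proof.
move=> [Foo Fsym [c [c0 Fc]]].
have H : {ae leb R d, forall x, Omega x -> [/\ forall i j, `|invmx (F x) i j| <= c^-1,
    (invmx (F x))^T = invmx (F x) & forall y : 'cV[R]_k, 0 <= dotv y (invmx (F x) *m y)]}.
  by apply: filterS2 Fsym Fc => x H1 H2 Ox; apply: (spd_inv c0); [exact: H1|exact: H2].
split.
- move=> i j; split; first by apply: measurable_invmx => p q; have [] := Foo p q.
  by exists c^-1; apply: filterS H => x /[apply] -[].
- by apply: filterS H => x /[apply] -[].
- by apply: filterS H => x /[apply] -[].
Qed.

End inverse_coefficients.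

Lemma uniformly_spd_permeability (R : realType) (d : space_dim) (Omega : set 'cV[R]_d)
    (mu : permeability R d) : admissible_permeability Omega mu ->
  uniformly_spd Omega (permeability_mx mu).
Proof.
case: d Omega mu => // Omega mu [[mmu [C muC]] ess].
have coer : exists c : R, 0 < c /\ {ae leb R 2, forall x, Omega x -> c <= mu x}.
  have [[c| |] cS c0] := ereal_sup_gt ess; last by rewrite ltNge leNye in c0.
    by exists c; split; [rewrite -lte_fin|apply: filterS cS => x /[apply]; rewrite lee_fin].
  (* A lower bound [+oo] for real values is contradictory at almost every point of [Omega], so any
     constant serves. *)
  by exists 1; split => //; apply: filterS cS => x /[apply]; rewrite leye_eq.
split.
- move=> i j; rewrite (_ : (fun x => _) = mu); last first.
    by apply/funext => x; rewrite /permeability_mx mxE !ord1 eqxx.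
  by split => //; exists C.
- by apply: aeW => x _; rewrite tr_scalar_mx.
- have [c [c0 muc]] := coer; exists c; split => //.
  apply: filterS muc => x H Ox y; rewrite /permeability_mx mul_scalar_mx.
  rewrite /dotv mulr_sumr; apply: ler_sum => i _; rewrite mxE.
  by rewrite [leRHS]mulrCA ler_wpM2r -?expr2 ?sqr_ge0// H.
Qed.

(** * The form of the transform on finitely many functions of time *)

Section time_form.
Variables (R : realType) (T : R).
Hypothesis T0 : 0 < T.
Local Notation mu := (@lebesgue_measure R).
Local Notation I := (`]0, T[%classic : set (measurableTypeR R)).

Let mI : measurable I. Proof. exact: measurable_itvoo. Qed.

Variables (N : nat) (h h' : 'I_N -> R -> R) (B : 'I_N -> R).
Hypothesis hh : forall l, {ae mu, forall s, I s -> h l s = h' l s}.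
Hypothesis mh : forall l, measurable_fun I (h' l).
Hypothesis hB : forall l s, I s -> `|h' l s| <= B l.

(** One matrix for both time forms: with the derivatives of the hats it is [A_t], with the hats the
    transpose of [M_t], which has the same quadratic form. *)
Definition hilbert_gram : 'M[R]_N :=
  \matrix_(l, k) dot_L2 mu I (mhilbert T (h k)) (h l).

Let h2 l : L2 mu I (h' l).
Proof. exact: (L2_bounded mI (measure_time_lty T0) (mh l) (@hB l)). Qed.

Let H2 l : L2 mu I (mhilbert T (h l)).
Proof. exact: (mhilbertP T0 (hh l) (mh l) (@hB l)).1. Qed.

Let v z s := \sum_l z l * h' l s.
Let w z s := \sum_l z l * mhilbert T (h l) s.

Let v2 z : L2 mu I (v z).
Proof. by apply: (L2_sum mI) => l; exact: L2Z. Qed.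

Let w2 z : L2 mu I (w z).
Proof. by apply: (L2_sum mI) => l; exact: L2Z. Qed.

Let series z : exists c : nat -> R,
  cvg_L2 mu I (sin_sum T c) (v z) /\ cvg_L2 mu I (cos_sum T c) (w z).
Proof.
have [c cP] := choice (fun l => (mhilbertP T0 (hh l) (mh l) (@hB l)).2).
exists (fun j => \sum_l z l * c l j); split.
- rewrite (_ : sin_sum T _ = fun m s => \sum_l z l * sin_sum T (c l) m s); last first.
    apply/funext => m; apply/funext => s; rewrite /sin_sum.
    under eq_bigr do rewrite mulr_suml.
    rewrite exchange_big/=; apply: eq_bigr => l _; rewrite mulr_sumr.
    by apply: eq_bigr => j _; rewrite mulrA.
  apply: (@cvg_L2_sum _ _ _ mu I mI _ _ (fun l m s => z l * sin_sum T (c l) m s) (fun l s => z l * h' l s)).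
  + by move=> l m; apply: (L2Z mI); exact: L2_sin_sum.
  + by move=> l; exact: (L2Z mI).
  + by move=> l; apply: (cvg_L2Z mI) (cP l).1; [move=> m; exact: L2_sin_sum|exact: h2].
- rewrite (_ : cos_sum T _ = fun m s => \sum_l z l * cos_sum T (c l) m s); last first.
    apply/funext => m; apply/funext => s; rewrite /cos_sum.
    under eq_bigr do rewrite mulr_suml.
    rewrite exchange_big/=; apply: eq_bigr => l _; rewrite mulr_sumr.
    by apply: eq_bigr => j _; rewrite mulrA.
  apply: (@cvg_L2_sum _ _ _ mu I mI _ _ (fun l m s => z l * cos_sum T (c l) m s) (fun l s => z l * mhilbert T (h l) s)).
  + by move=> l m; apply: (L2Z mI); exact: L2_cos_sum.
  + by move=> l; exact: (L2Z mI).
  + by move=> l; apply: (cvg_L2Z mI) (cP l).2; [move=> m; exact: L2_cos_sum|exact: H2].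
Qed.

Lemma hilbert_gramE l k : hilbert_gram l k = dot_L2 mu I (mhilbert T (h k)) (h' l).
Proof. by rewrite mxE; apply: ae_eq_dot; [exact: aeW|exact: hh]. Qed.

Let qformE z : qform hilbert_gram z = dot_L2 mu I (v z) (w z).
Proof.
rewrite dotC (dot_suml mI)// /qform exchange_big/=; apply: eq_bigr => k _.
rewrite (dot_sumr mI)// mulr_sumr; apply: eq_bigr => l _.
rewrite hilbert_gramE; ring.
Qed.

Lemma hilbert_gram_ge0 z : 0 <= qform hilbert_gram z.
Proof.
have [c [Sc Cc]] := series z; rewrite qformE.
exact: (dot_mhilbert_ge0 T0 (v2 z) (w2 z) Sc Cc).
Qed.

Lemma hilbert_gram_eq0 z : qform hilbert_gram z = 0 ->
  {ae mu, forall s, I s -> \sum_l z l * h l s = 0}.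
Proof.
have [c [Sc Cc]] := series z; rewrite qformE => q0.
have := dot_mhilbert_eq0 T0 (v2 z) (w2 z) Sc Cc q0.
have : {ae mu, forall s l, I s -> h l s = h' l s}.
  have G d (X : measurableType d) (m : {measure set X -> \bar R}) (P : X -> 'I_N -> Prop) :
      (forall l, {ae m, forall x, P x l}) -> {ae m, forall x l, P x l}.
    by move=> H; exact: filter_forall.
  by apply: G => l; exact: hh.
have G d (X : measurableType d) (m : {measure set X -> \bar R}) (P Q S : X -> Prop) :
    (forall x, P x -> Q x -> S x) -> {ae m, forall x, P x} -> {ae m, forall x, Q x} ->
    {ae m, forall x, S x}.
  by move=> PQS; apply: filterS2.
apply: G => s hs vs Is; rewrite -[RHS](vs Is); apply: eq_bigr => l _.
by rewrite hs.
Qed.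

End time_form.

(** * Positive definiteness of the system matrix *)

Section positivity.
Variables (R : realType) (d : space_dim) (Omega : set 'cV[R]_d) (T : R).
Variables (eps : 'cV[R]_d -> 'M[R]_d) (mu : permeability R d).
Variables (N : nat) (t : nat -> R).
Variables (Nx : nat) (psi : 'I_Nx -> 'cV[R]_d -> 'cV[R]_d).
Hypotheses (T0 : 0 < T) (oO : open Omega) (tM : temporal_mesh T N t).
Hypotheses (eps_spd : uniformly_spd Omega eps) (mu_adm : admissible_permeability Omega mu).
Hypothesis psiH : forall k, Hcurl Omega (psi k).
Hypothesis psi_free : forall c : 'I_Nx -> R,
  {ae leb R d, forall x, Omega x -> \sum_i c i *: psi i x = 0} -> forall i, c i = 0.

Let mO : measurable Omega. Proof. exact: open_measurable_cV. Qed.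

Lemma Hcurl_curl f : Hcurl Omega f ->
  is_weak_curl (fun i : 'I_d => delta_mx i ord0) Omega f (curl Omega f).
Proof. by move=> [_ fg]; exact: (@xgetPex _ (fun=> 0) [set g | is_weak_curl _ Omega f g] fg). Qed.

Lemma A_tE : A_t T N t = hilbert_gram T (fun l : 'I_N => derive1 (hat N t l.+1)).
Proof. by []. Qed.

Lemma M_tE : M_t T N t = (hilbert_gram T (fun l : 'I_N => hat N t l.+1))^T.
Proof. by apply/matrixP => l k; rewrite !mxE dotC. Qed.

(** [A_x] is used only as a semidefinite matrix. In the other summand [A_t] is definite by
    independence of the hat derivatives and [M_x] by coercivity of [eps] and independence of the
    basis. *)
Lemma system_matrix_posdef : posdef (system_matrix Omega T eps mu N t psi).
Proof.
move=> y y0; rewrite qformE /system_matrix.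
set z := fun i => y i ord0.
have psi2 k : L2v Omega (psi k) := (psiH k).1.
have cpsi2 k : L2v Omega (curl Omega (psi k)) := (Hcurl_curl (psiH k)).1.
have [Foo Fsym [c [c0 Fc]]] := eps_spd.
have [Goo Gsym G0] := uniformly_spd_inv mO (uniformly_spd_permeability mu_adm).
have F0 : {ae leb R d, forall x, Omega x -> forall y, 0 <= dotv y (eps x *m y)}.
  apply: filterS Fc => x H Ox u; apply: le_trans (H Ox u).
  by apply: mulr_ge0; [exact: ltW|apply: sumr_ge0 => i _; rewrite -expr2 sqr_ge0].
have Mx0 u : 0 <= qform (M_x Omega eps psi) u by exact: (gram_ge0 mO Foo psi2).
have Mx1 u : qform (M_x Omega eps psi) u = 0 -> forall i, u i = 0.
  by move=> q0; apply: psi_free; exact: (gram_eq0 mO Foo psi2 c0 Fc q0).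
have Mxs : (M_x Omega eps psi)^T = M_x Omega eps psi by exact: (gram_sym psi).
have Ax0 u : 0 <= qform (A_x Omega mu psi) u by exact: (gram_ge0 mO Goo cpsi2).
have Axs : (A_x Omega mu psi)^T = A_x Omega mu psi.
  exact: (gram_sym (fun k => curl Omega (psi k)) Gsym).
have [dh dhP] := choice (fun l : 'I_N => derive1_hat_ae tM (ltn_ord l)).
have [dB dBP] := choice dhP.
have [hh hhP] := choice (fun l : 'I_N => hat_ae tM (ltn_ord l)).
have [hB hBP] := choice hhP.
have At0 u : 0 <= qform (A_t T N t) u.
  rewrite A_tE; apply: (@hilbert_gram_ge0 _ _ T0 _ _ dh dB); by move=> l; have [] := dBP l.
have At1 u : qform (A_t T N t) u = 0 -> forall i, u i = 0.
  rewrite A_tE => /(@hilbert_gram_eq0 _ _ T0 _ _ dh dB) H; apply: (sum_derive1_hat_eq0 tM).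
  by apply: H => l; have [] := dBP l.
have Mt0 u : 0 <= qform (M_t T N t) u.
  rewrite M_tE qform_tr; apply: (@hilbert_gram_ge0 _ _ T0 _ _ hh hB); by move=> l; have [] := hBP l.
have -> : qform (A_t T N t *t M_x Omega eps psi + M_t T N t *t A_x Omega mu psi) z =
   qform (A_t T N t *t M_x Omega eps psi) z + qform (M_t T N t *t A_x Omega mu psi) z.
  rewrite /qform -big_split; apply: eq_bigr => l _; rewrite -big_split; apply: eq_bigr => k _.
  by rewrite [X in _ * X * _]mxE mulrDr mulrDl.
apply: ltr_wpDr; first exact: qform_tens_ge0.
rewrite lt_neqAle qform_tens_ge0// andbT eq_sym; apply: contra y0 => /eqP q0.
by apply/eqP/colP => p; rewrite mxE; exact: (qform_tens_eq0 At0 At1 Mxs Mx0 Mx1 q0 p).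
Qed.

End positivity.

(** * The Galerkin system *)

Section galerkin.
Variables (R : realType) (d : space_dim) (Omega : set 'cV[R]_d) (T : R).
Variables (eps : 'cV[R]_d -> 'M[R]_d) (mu : permeability R d).
Variables (N : nat) (t : nat -> R) (M : simplicial_mesh R d).
Variables (Nx : nat) (psi : 'I_Nx -> 'cV[R]_d -> 'cV[R]_d).
Hypotheses (T0 : 0 < T) (oO : open Omega) (bO : bounded_set Omega).
Hypotheses (tM : temporal_mesh T N t).
Hypotheses (eps_spd : uniformly_spd Omega eps) (mu_adm : admissible_permeability Omega mu).
Hypothesis psiB : is_basis Omega (nedelec0 Omega M) psi.

Local Notation lambda := (@lebesgue_measure R).
Local Notation I := (`]0, T[%classic : set (measurableTypeR R)).
Local Notation Q := (cylinder T Omega).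
Local Notation hat := (fun l : 'I_N => hat N t l.+1).
Local Notation hat' := (fun l : 'I_N => derive1 (Defs.hat N t l.+1)).
Local Notation cpsi := (fun k => curl Omega (psi k)).

Let mI : measurable I. Proof. exact: measurable_itvoo. Qed.
Let mO : measurable Omega. Proof. exact: open_measurable_cV. Qed.
Let mQ : measurable Q. Proof. exact: measurable_cylinder. Qed.
Let Ooo : (leb R d Omega < +oo)%E. Proof. exact: leb_bounded_set. Qed.

Let psiH k : Hcurl Omega (psi k). Proof. by have [/(_ k)[[]]] := psiB. Qed.
Let psi2 k : L2v Omega (psi k). Proof. exact: (psiH k).1. Qed.
Let psiC k := Hcurl_curl (psiH k).
Let cpsi2 k : L2v Omega (cpsi k). Proof. exact: (psiC k).1. Qed.
Let p1 (p : 'I_(N * Nx)) := (mxtens_unindex p).1.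
Let p2 (p : 'I_(N * Nx)) := (mxtens_unindex p).2.

(** The time and space factors are parameters, so that one coefficient vector describes [v], its
    time derivative, its transform and its curl. *)
Definition tensor_comb k (h : 'I_N -> R -> R) (g : 'I_Nx -> 'cV[R]_d -> 'cV[R]_k)
    (x : 'I_(N * Nx) -> R) (z : 'cV[R]_d.+1) : 'cV[R]_k :=
  \sum_p h (p1 p) (time_of z) *: (x p *: g (p2 p) (space_of z)).

Lemma tensor_comb_ae k h h' (g : 'I_Nx -> 'cV[R]_d -> 'cV[R]_k) x :
  (forall l, {ae lambda, forall s, I s -> h l s = h' l s}) ->
  {ae leb R d.+1, forall z, Q z -> tensor_comb h g x z = tensor_comb h' g x z}.
Proof.
move=> hh.
have : {ae leb R d.+1, forall z l, I (time_of z) -> h l (time_of z) = h' l (time_of z)}.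
  by apply: filter_forall => l; exact: (@ae_time_of _ d (fun s => I s -> h l s = h' l s)).
apply: filterS => z H Qz; apply: eq_bigr => p _; rewrite H//=.
by rewrite in_itv/=; case: Qz.
Qed.

Lemma L2v_tensor_comb k h (g : 'I_Nx -> 'cV[R]_d -> 'cV[R]_k) x :
  (forall l, L2 lambda I (h l)) -> (forall l, L2v Omega (g l)) -> L2v Q (tensor_comb h g x).
Proof.
move=> h2 g2; apply: (L2v_sum mQ) => p.
by apply: (L2v_tensor oO (G := fun y => x p *: g (p2 p) y)) => //; exact: L2vZ.
Qed.

Lemma dot_tensor_comb k h h' (g g' : 'I_Nx -> 'cV[R]_d -> 'cV[R]_k) x x' :
  (forall l, L2 lambda I (h l)) -> (forall l, L2 lambda I (h' l)) ->
  (forall l, L2v Omega (g l)) -> (forall l, L2v Omega (g' l)) ->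
  dot_L2v Q (tensor_comb h g x) (tensor_comb h' g' x') =
  \sum_q x' q * \sum_p dot_L2 lambda I (h (p1 p)) (h' (p1 q)) *
    dot_L2v Omega (g (p2 p)) (g' (p2 q)) * x p.
Proof.
move=> h2 h2' g2 g2'.
have T2 (a : 'I_(N * Nx) -> R) hh (gg : 'I_Nx -> 'cV[R]_d -> 'cV[R]_k) p : (forall l, L2 lambda I (hh l)) ->
   (forall l, L2v Omega (gg l)) ->
   L2v Q (fun z => hh (p1 p) (time_of z) *: (a p *: gg (p2 p) (space_of z))).
  move=> H2 G2; apply: (L2v_tensor oO (G := fun y => a p *: gg (p2 p) y)) => //.
  exact: L2vZ.
rewrite [LHS]dot_L2v_sumr//; [|by move=> q; exact: T2|exact: L2v_tensor_comb].
apply: eq_bigr => q _; rewrite mulr_sumr dot_L2v_suml//; [|by move=> p; exact: T2|exact: T2].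
apply: eq_bigr => p _.
have -> := dot_L2v_tensor oO (h2 (p1 p)) (h2' (p1 q)) (L2vZ mO (x p) (g2 (p2 p)))
  (L2vZ mO (x' q) (g2' (p2 q))).
rewrite dot_L2vZl//; last exact: L2vZ.
rewrite dot_L2vZr//; ring.
Qed.

(** The second clause is separate because equality almost everywhere in the first says nothing about
    [dt v]. *)
Definition represents (v : 'cV[R]_d.+1 -> 'cV[R]_d) (x : 'I_(N * Nx) -> R) :=
  {ae leb R d.+1, forall z, Q z -> v z = tensor_comb hat psi x z} /\
  {ae leb R d.+1, forall z, Q z -> dt v z = tensor_comb hat' psi x z}.

Lemma tensor_combE h (X : 'I_N -> 'I_Nx -> R) z :
  tensor_comb h psi (fun p => X (p1 p) (p2 p)) z =
  \sum_l h l (time_of z) *: \sum_k X l k *: psi k (space_of z).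
Proof.
rewrite /tensor_comb.
rewrite (sum_mxtens (fun l k => h l (time_of z) *: (X l k *: psi k (space_of z)))).
by apply: eq_bigr => l _; rewrite scaler_sumr.
Qed.

(** The space factors match the basis only off a null set of [x], which removes whole time lines. On
    the remaining lines one differentiates in time first and substitutes afterwards. *)
Lemma hat_sum_represents v (G : 'I_N -> 'cV[R]_d -> 'cV[R]_d) (X : 'I_N -> 'I_Nx -> R) :
  (forall z, Q z -> v z = \sum_l hat l (time_of z) *: G l (space_of z)) ->
  (forall l, {ae leb R d, forall y, Omega y -> G l y = \sum_k X l k *: psi k y}) ->
  represents v (fun p => X (p1 p) (p2 p)).
Proof.
move=> vE GE.
have GE' : {ae leb R d.+1, forall z l, Omega (space_of z) ->
    G l (space_of z) = \sum_k X l k *: psi k (space_of z)}.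
  apply: filter_forall => l.
  exact: (@ae_space_of _ d (fun y => Omega y -> G l y = \sum_k X l k *: psi k y)).
split.
  apply: filterS GE' => z H Qz; rewrite vE// tensor_combE; apply: eq_bigr => l _.
  by rewrite H//; case: Qz.
apply: filterS2 GE' (@ae_time_of _ d _ (ae_mesh_cell tM)) => z H1 H2 Qz.
have [|j jN zj] := H2; first by rewrite /= in_itv/=; case: Qz.
have -> := dt_tensor vE Qz (fun l : 'I_N => is_derive_hat tM jN (ltn_ord l) zj).
rewrite tensor_combE; apply: eq_bigr => l _.
by rewrite (derive1_hat tM jN (ltn_ord l) zj) H1//; case: Qz.
Qed.

Lemma ansatz_represents v : ansatz_space Omega T N t M v -> exists x, represents v x.
Proof.
move=> [m [f [g [Sf Vg vE]]]]; have [_ _ span] := psiB.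
have [c cE] := choice Sf.
have [e eE] := choice (fun i => span _ (Vg i)).
exists (fun p => \sum_i c i (p1 p) * e i (p2 p)).
apply: (hat_sum_represents (G := fun l y => \sum_i c i l *: g i y)
  (X := fun l k => \sum_i c i l * e i k)).
  move=> z Qz; rewrite vE//; under [RHS]eq_bigr do rewrite scaler_sumr.
  rewrite exchange_big/=; apply: eq_bigr => i _.
  rewrite cE; last by case: Qz => /andP[/ltW -> /ltW ->].
  by rewrite scaler_suml; apply: eq_bigr => l _; rewrite scalerA mulrC.
move=> l; have : {ae leb R d, forall y i, Omega y -> g i y = \sum_k e i k *: psi k y}.
  exact: filter_forall.
apply: filterS => y H Oy.
under [RHS]eq_bigr do rewrite scaler_suml.
rewrite exchange_big/=; apply: eq_bigr => i _; rewrite H// scaler_sumr.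
by apply: eq_bigr => k _; rewrite scalerA.
Qed.

Lemma ansatz_tensor_comb x : ansatz_space Omega T N t M (tensor_comb hat psi x) /\
  represents (tensor_comb hat psi x) x.
Proof.
split.
  exists (N * Nx)%N, (fun p s => x p * hat (p1 p) s), (fun p => psi (p2 p)); split.
  - move=> p; exists (fun l => if l == p1 p then x p else 0) => s _.
    rewrite (bigD1 (p1 p))//= eqxx big1 ?addr0// => l /negbTE ->.
    by rewrite mul0r.
  - by move=> p; have [+ _ _] := psiB; exact.
  - by move=> z _; apply: eq_bigr => p _; rewrite scalerA mulrC.
pose X l k := x (mxtens_index (l, k)).
have xE : x = fun p => X (p1 p) (p2 p).
  by apply/funext => p; rewrite /X /p1 /p2 -surjective_pairing mxtens_unindexK.
rewrite {2}xE; apply: (hat_sum_represents (G := fun l y => \sum_k X l k *: psi k y)).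
  by move=> z _; rewrite {1}xE tensor_combE.
by move=> l; exact: aeW.
Qed.

Section hat_data.
Variables (h h' : 'I_N -> R -> R) (B B' : 'I_N -> R).
Hypothesis hE : forall l, {ae lambda, forall s, I s -> hat l s = h l s}.
Hypothesis mh : forall l, measurable_fun I (h l).
Hypothesis hB : forall l s, I s -> `|h l s| <= B l.
Hypothesis hE' : forall l, {ae lambda, forall s, I s -> hat' l s = h' l s}.
Hypothesis mh' : forall l, measurable_fun I (h' l).
Hypothesis hB' : forall l s, I s -> `|h' l s| <= B' l.

Let H := fun l => mhilbert T (hat l).
Let H' := fun l => mhilbert T (hat' l).

Let h2 l : L2 lambda I (h l).
Proof. exact: (L2_bounded mI (measure_time_lty T0) (mh l) (@hB l)). Qed.
Let h2' l : L2 lambda I (h' l).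
Proof. exact: (L2_bounded mI (measure_time_lty T0) (mh' l) (@hB' l)). Qed.
Let H2 l : L2 lambda I (H l).
Proof. exact: (mhilbertP T0 (hE l) (mh l) (@hB l)).1. Qed.
Let H2' l : L2 lambda I (H' l).
Proof. exact: (mhilbertP T0 (hE' l) (mh' l) (@hB' l)).1. Qed.

(** The last item applies the factorwise curl to time factors known only to be square integrable,
    since the transform of a hat comes without a bound. *)
Lemma represents_data v x : represents v x ->
  [/\ {ae leb R d.+1, forall z, Q z -> dt v z = tensor_comb h' psi x z},
      {ae leb R d.+1, forall z, Q z -> mhilbert_x T Omega v z = tensor_comb H psi x z},
      {ae leb R d.+1, forall z, Q z -> mhilbert_x T Omega (dt v) z = tensor_comb H' psi x z},
      {ae leb R d.+1, forall z, Q z -> curl_x Omega T v z = tensor_comb h cpsi x z} &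
      {ae leb R d.+1, forall z, Q z ->
        curl_x Omega T (mhilbert_x T Omega v) z = tensor_comb H cpsi x z}].
Proof.
move=> [vE dvE].
have G2 p : L2v Omega (fun y => x p *: psi (p2 p) y) by exact: L2vZ.
have GC p : is_weak_curl (fun i : 'I_d => delta_mx i ord0) Omega (fun y => x p *: psi (p2 p) y)
    (fun y => x p *: cpsi (p2 p) y) by exact: is_weak_curlZ.
have Hv : {ae leb R d.+1, forall z, Q z -> mhilbert_x T Omega v z = tensor_comb H psi x z}.
  exact: (mhilbert_x_tensor T0 oO (fun p => hE (p1 p)) (fun p => mh (p1 p))
    (fun p => @hB (p1 p)) G2 vE).
split; [|exact: Hv| | |].
- have E := tensor_comb_ae psi x hE'.
  by apply: filterS2 dvE E => z H3 H4 Qz; rewrite H3// H4.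
- exact: (mhilbert_x_tensor T0 oO (fun p => hE' (p1 p)) (fun p => mh' (p1 p))
    (fun p => @hB' (p1 p)) G2 dvE).
- apply: (curl_x_tensor oO bO (f := fun p => h (p1 p)) _ G2 GC) => //.
  have E := tensor_comb_ae psi x hE.
  by apply: filterS2 vE E => z H3 H4 Qz; rewrite H3// H4.
- exact: (curl_x_tensor oO bO (f := fun p => H (p1 p)) _ G2 GC).
Qed.

Let K := system_matrix Omega T eps mu N t psi.

Lemma galerkin_form A v x x' : represents A x -> represents v x' ->
  dot_L2v Q (fun z => eps (space_of z) *m mhilbert_x T Omega (dt A) z) (dt v) +
  dot_L2v Q (fun z => invmx (permeability_mx mu (space_of z)) *m curl_x Omega T A z)
    (curl_x Omega T (mhilbert_x T Omega v)) =
  \sum_q x' q * \sum_p K q p * x p.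
Proof.
move=> /represents_data[_ _ A1 A2 _] /represents_data[v1 _ _ _ v2].
have [Foo _ _] := eps_spd.
have [Goo _ _] := uniformly_spd_inv mO (uniformly_spd_permeability mu_adm).
have mulE k (F : 'cV[R]_d -> 'M[R]_k) f hh (g : 'I_Nx -> 'cV[R]_d -> 'cV[R]_k) :
    {ae leb R d.+1, forall z, Q z -> f z = tensor_comb hh g x z} ->
    {ae leb R d.+1, forall z, Q z -> F (space_of z) *m f z =
       tensor_comb hh (fun l y => F y *m g l y) x z}.
  apply: filterS => z fE Qz; rewrite fE// mulmx_sumr; apply: eq_bigr => p _.
  by rewrite -!scalemxAr.
rewrite (ae_eq_dot_L2v (mulE _ eps _ _ _ A1) v1).
rewrite (ae_eq_dot_L2v (mulE _ (fun y => invmx (permeability_mx mu y)) _ _ _ A2) v2).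
rewrite !dot_tensor_comb//; try by move=> l; exact: L2v_coef.
rewrite -big_split/=; apply: eq_bigr => q _; rewrite -mulrDr; congr (_ * _).
rewrite -big_split/=; apply: eq_bigr => p _; rewrite -mulrDl; congr (_ * _).
rewrite /K /system_matrix mxE; congr (_ + _); rewrite mxE -/(p1 _) -/(p2 _) -/(p1 _) -/(p2 _).
- rewrite [X in _ = X * _]mxE [X in _ = _ * X]mxE; congr (_ * _).
  by apply: ae_eq_dot; [exact: aeW|apply: ae_imply (hE' (p1 q)) => s /[apply] ->].
- rewrite [X in _ = X * _]mxE [X in _ = _ * X]mxE; congr (_ * _).
  by apply: ae_eq_dot; [apply: ae_imply (hE (p1 p)) => s /[apply] ->|exact: aeW].
Qed.

Variables rhs rhs' : 'cV[R]_d.+1 -> 'cV[R]_d.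
Hypothesis rhs2 : L2v Q rhs'.
Hypothesis rhsE : {ae leb R d.+1, forall z, Q z -> rhs z = rhs' z}.

Definition load (q : 'I_(N * Nx)) : R :=
  dot_L2v Q rhs' (fun z => H (p1 q) (time_of z) *: psi (p2 q) (space_of z)).

Lemma galerkin_load v x' : represents v x' ->
  dot_L2v Q rhs (mhilbert_x T Omega v) = \sum_q x' q * load q.
Proof.
move=> /represents_data[_ Hv _ _ _].
rewrite (ae_eq_dot_L2v rhsE Hv) dot_L2v_sumr//.
- apply: eq_bigr => q _; rewrite /load -dot_L2vZr//; last exact: L2v_tensor.
  by congr dot_L2v; apply/funext => z; rewrite !scalerA mulrC.
- move=> q; apply: (L2v_tensor oO (G := fun y => x' q *: psi (p2 q) y)) => //.
  exact: L2vZ.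
Qed.

Lemma uniquely_solvable_rhs : uniquely_solvable Omega T eps mu N t M rhs.
Proof.
have [_ psi_free _] := psiB.
have uK : K \in unitmx.
  exact: posdef_unitmx (system_matrix_posdef T0 oO tM eps_spd mu_adm psiH psi_free).
pose b : 'cV[R]_(N * Nx) := \col_q load q.
pose x0 : 'cV[R]_(N * Nx) := invmx K *m b.
have Kx0 q : \sum_p K q p * x0 p ord0 = load q.
  have : K *m x0 = b by rewrite /x0 mulKVmx.
  by move=> /(congr1 (fun y : 'cV[R]_(N * Nx) => y q ord0)); rewrite mxE [RHS]mxE.
pose A := tensor_comb hat psi (fun p => x0 p ord0).
have [ansA repA] := ansatz_tensor_comb (fun p => x0 p ord0).
exists A; split.
  split => // v ansv; have [x' repv] := ansatz_represents ansv.
  rewrite (galerkin_form repA repv) (galerkin_load repv).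
  by apply: eq_bigr => q _; rewrite Kx0.
move=> B0 [ansB solB]; have [x repB] := ansatz_represents ansB.
have Kx q : \sum_p K q p * x p = load q.
  (* Testing with the basis tensor of index [q] reads off row [q] of the linear system. *)
  pose e p : R := (p == q)%:R.
  have [anse repe] := ansatz_tensor_comb e.
  have := solB _ anse; rewrite (galerkin_form repB repe) (galerkin_load repe).
  have S (F : 'I_(N * Nx) -> R) : \sum_q0 e q0 * F q0 = F q.
    rewrite (bigD1 q)//= /e eqxx mul1r big1 ?addr0// => l /negbTE ->.
    by rewrite mul0r.
  by rewrite !S.
have xE p : x p = x0 p ord0.
  pose xc : 'cV[R]_(N * Nx) := \col_p x p.
  have : K *m xc = b.
    apply/colP => q; rewrite mxE [RHS]mxE -Kx.
    by apply: eq_bigr => l _; rewrite [X in _ * X]mxE.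
  move=> /(congr1 (mulmx (invmx K))); rewrite mulKmx// => E.
  by rewrite /x0 -E mxE.
have [BE _] := repB; apply: filterS BE => z BE Qz; rewrite BE// /A.
by apply: eq_bigr => p _; rewrite xE.
Qed.

End hat_data.

Lemma uniquely_solvable_L2 rhs rhs' : L2v Q rhs' ->
  {ae leb R d.+1, forall z, Q z -> rhs z = rhs' z} ->
  uniquely_solvable Omega T eps mu N t M rhs.
Proof.
move=> rhs2 rhsE.
have [dh /choice[dB dP]] := choice (fun l : 'I_N => derive1_hat_ae tM (ltn_ord l)).
have [h /choice[hB hP]] := choice (fun l : 'I_N => hat_ae tM (ltn_ord l)).
apply: (@uniquely_solvable_rhs h dh hB dB) rhs2 rhsE => l; (try by have [] := dP l);
  by have [] := hP l.
Qed.

(** The time factors are affine only inside the cells; bounded measurable representatives replace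
    them, changing the function on a null set. *)
Lemma tensor_space_L2v (S : set (R -> R)) (V : set ('cV[R]_d -> 'cV[R]_d)) f :
  (forall u, S u -> forall j, (j < N)%N ->
     exists a b, forall s, t j < s < t j.+1 -> u s = a + b * s) ->
  (forall g, V g -> L2v Omega g) -> tensor_space T Omega S V f ->
  exists f', L2v Q f' /\ {ae leb R d.+1, forall z, Q z -> f z = f' z}.
Proof.
move=> Saff V2 [m [u [g [Su Vg fE]]]].
have [u' /choice[B uP]] := choice (fun i => piecewise_affine_ae tM (Saff _ (Su i))).
exists (fun z => \sum_i u' i (time_of z) *: g i (space_of z)); split.
  apply: (L2v_sum mQ) => i; have [_ mu' uB] := uP i.
  apply: (L2v_tensor oO); last exact/V2/Vg.
  exact: (L2_bounded mI (measure_time_lty T0) mu' uB).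
have : {ae leb R d.+1, forall z i, I (time_of z) -> u i (time_of z) = u' i (time_of z)}.
  apply: filter_forall => i; have [uE _ _] := uP i.
  exact: (@ae_time_of _ d (fun s => I s -> u i s = u' i s)).
apply: filterS => z H Qz; rewrite fE//; apply: eq_bigr => i _.
by rewrite H//= in_itv/=; case: Qz.
Qed.

(** Both outcomes of the choice in [orthogonal_projection] are right-hand sides with a square
    integrable representative: a member of the tensor space, or the default value 0. *)
Lemma uniquely_solvable_projection (S : set (R -> R)) (V : set ('cV[R]_d -> 'cV[R]_d)) f :
  (forall u, S u -> forall j, (j < N)%N ->
     exists a b, forall s, t j < s < t j.+1 -> u s = a + b * s) ->
  (forall g, V g -> L2v Omega g) ->
  uniquely_solvable Omega T eps mu N t M (orthogonal_projection Q (tensor_space T Omega S V) f).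
Proof.
move=> Saff V2; rewrite /orthogonal_projection; case: xgetP => [g _ [Vg _]|_].
  by have [g' [g2 gE]] := tensor_space_L2v Saff V2 Vg; exact: uniquely_solvable_L2 g2 gE.
apply: (@uniquely_solvable_L2 _ (fun=> 0)); last exact: aeW.
move=> i; apply: eq_L2 (L2_0 _ _) => // z _; by rewrite mxE.
Qed.

End galerkin.

Theorem mainTheorem2 (R : realType) (d : space_dim)
  (Omega : set 'cV[R]_d) (T : R)
  (eps : 'cV[R]_d -> 'M[R]_d) (mu : permeability R d)
  (j : 'cV[R]_d.+1 -> 'cV[R]_d)
  (Nt : nat) (t : nat -> R)
  (Tx : nat -> simplicial_mesh R d) (nu : nat)
  (Nx : nat) (psi : 'I_Nx -> 'cV[R]_d -> 'cV[R]_d)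
  (Omega_domain : polytopal_lipschitz_domain Omega)
  (T_gt0 : 0 < T)
  (Q_star : star_shaped_wrt_ball (cylinder T Omega))
  (eps_spd : uniformly_spd Omega eps)
  (mu_adm : admissible_permeability Omega mu)
  (j_L2 : L2v (cylinder T Omega) j)
  (t_mesh : temporal_mesh T Nt t)
  (Tx_mesh : forall k, admissible_mesh Omega (Tx k))
  (Tx_regular : shape_regular Tx)
  (Tx_uniform : globally_quasi_uniform Tx)
  (psi_basis : is_basis Omega (nedelec0 Omega (Tx nu)) psi) :
  posdef (system_matrix Omega T eps mu Nt t psi) /\
  uniquely_solvable Omega T eps mu Nt t (Tx nu)
    (Pi0 Omega T Nt t (Tx nu) j) /\
  uniquely_solvable Omega T eps mu Nt t (Tx nu)
    (PiRT1 Omega T Nt t (Tx nu) j).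
Proof.
have [[_ oO _ bO] _] := Omega_domain.
have [psiV psi_free _] := psi_basis.
split; [|split].
- by apply: system_matrix_posdef => // k; have [[]] := psiV k.
- apply: (uniquely_solvable_projection T_gt0 oO bO t_mesh eps_spd mu_adm psi_basis).
    by move=> u Su l lN; have [c uc] := Su l lN; exists c, 0 => s /uc ->; rewrite mul0r addr0.
  by move=> g [].
- apply: (uniquely_solvable_projection T_gt0 oO bO t_mesh eps_spd mu_adm psi_basis).
    move=> u [_ Su] l lN; have [a [b uab]] := Su l lN; exists a, b => s /andP[s1 s2].
    by apply: uab; rewrite !ltW.
  by move=> g [[]].
Qed.
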